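(* For $B>0$ let $U_{\mathrm{avg}}(T)=u_{\mathrm{avg}}(T/(B\gamma);B)$ be the $\sigma$-weighted domain average, in slow time $T=B\gamma t$, of the solution of the nondimensional Robin heat equation with initial condition $1$; let $\widetilde U^{1}_{\mathrm{avg}}(T)=\exp(-T)$ and $$E^{1}_{\mathrm{avg}}(T_{\mathrm{final}})=\max_{T\in[0,T_{\mathrm{final}}]}\big(U_{\mathrm{avg}}(T)-\widetilde U^{1}_{\mathrm{avg}}(T)\big).$$ Then, for all $B>0$, $$E^{1}_{\mathrm{avg}}(T_{\mathrm{final}})\le\frac12\sqrt{\frac{\phi B}{\gamma}}\qquad\text{for all }T_{\mathrm{final}}\in[0,\infty).$$
   Context: Setting: $d\in\{1,2,3\}$; $\Omega\subset\mathbb{R}^d$ is a bounded connected Lipschitz domain; $|\Omega|$ is its volume, $|\partial\Omega|$ its surface measure (for $d=1$, counting measure), $\gamma=|\partial\Omega|/|\Omega|$. The scalar coefficients $\sigma,\kappa\in L^\infty(\Omega)$ satisfy: $\sigma$ bounded below by a positive constant, $\frac{1}{|\Omega|}\int_\Omega\sigma=1$, $\operatorname{ess\,inf}_\Omega\kappa=1$. Heat equation: for $B\ge0$, $u(\cdot,t;B)\in C^0([0,t_{\mathrm{final}}];L^2(\Omega))\cap L^2((0,t_{\mathrm{final}});H^1(\Omega))$ (for every final time $t_{\mathrm{final}}$) is the unique weak solution of $$\int_\Omega\sigma\,\partial_tu\,v+\int_\Omega\kappa\nabla u\cdot\nabla v+B\int_{\partial\Omega}uv=0\quad\text{for all }v\in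 H^1(\Omega),\ t>0,\qquad u(\cdot,0;B)=1.$$ The domain average is $u_{\mathrm{avg}}(t;B)=\frac{1}{|\Omega|}\int_\Omega\sigma u(\cdot,t;B)$. Definition of $\phi$: $\phi=\int_\Omega\kappa|\nabla\psi'^{\,0}|^2$, where $\psi'^{\,0}\in H^1(\Omega)$ is the unique function with $\int_\Omega\sigma\psi'^{\,0}=0$ and $\int_\Omega\kappa\nabla\psi'^{\,0}\cdot\nabla v=|\Omega|^{-1/2}\big(\gamma\int_\Omega\sigma v-\int_{\partial\Omega}v\big)$ for all $v\in H^1(\Omega)$. *)

(* Defs.v *)
From HB Require Import structures.
From mathcomp Require Import all_boot all_order all_algebra.
From mathcomp Require Import all_classical all_reals all_analysis.
From mathcomp Require Import ess_sup_inf.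
Set Implicit Arguments.
Unset Strict Implicit.
Unset Printing Implicit Defensive.
Import Order.TTheory GRing.Theory Num.Theory.
Import numFieldNormedType.Exports.
Local Open Scope classical_set_scope.
Local Open Scope ring_scope.

Definition matrix_display : measure_display.
Proof. exact: default_measure_display. Qed.

Section matrix_measurable.
Context {R : realType} (m n : nat).

Definition matrix_coord_gen : set (set 'M[R]_(m, n)) :=
  [set A | exists i j, exists2 B : set R, measurable B &
     A = [set x : 'M[R]_(m, n) | B (x i j)]].

Let mx_set0 : <<s matrix_coord_gen >> set0.
Proof. exact: sigma_algebra0. Qed.
Let mx_setC A : <<s matrix_coord_gen >> A -> <<s matrix_coord_gen >> (~` A).
Proof. exact: sigma_algebraC. Qed.
Let mx_bigcup (F : _^nat) : (forall i, <<s matrix_coord_gen >> (F i)) ->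
  <<s matrix_coord_gen >> (\bigcup_i (F i)).
Proof. exact: sigma_algebra_bigcup. Qed.

(* The sigma-algebra generated by the coordinates is the Borel one. *)
HB.instance Definition _ := @isMeasurable.Build matrix_display
  'M[R]_(m, n) <<s matrix_coord_gen >> mx_set0 mx_setC mx_bigcup.
End matrix_measurable.

Section matrix_measurable_lemmas.
Context {R : realType} (m n : nat).

Lemma measurable_coord i j :
  measurable_fun [set: 'M[R]_(m, n)] (fun x => x i j).
Proof.
move=> _ B mB; rewrite setTI; apply: sub_sigma_algebra.
by exists i, j, B.
Qed.

Lemma measurable_mxP d (T : measurableType d) (f : T -> 'M[R]_(m, n)) :
  (forall i j, measurable_fun setT (fun x => f x i j)) ->
  measurable_fun setT f.
Proof.
move=> mf; apply: (@measurability _ _ _ _ _ _ (@matrix_coord_gen R m n)) => //.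
by move=> _ [_ [i [j [B mB ->]]] <-]; exact: mf.
Qed.
End matrix_measurable_lemmas.

Section lebesgue_rV.
Context {R : realType}.

Definition cons_rV n (p : R * 'rV[R]_n) : 'rV[R]_n.+1 :=
  row_mx (const_mx p.1 : 'rV_1) p.2.

Lemma cons_rV0 n p : cons_rV p 0 (@ord0 n) = p.1.
Proof.
rewrite /cons_rV (_ : ord0 = lshift n (@ord0 0)); last exact/val_inj.
by rewrite (@row_mxEl _ 1 1 n) mxE.
Qed.

Lemma cons_rVS n p j : @cons_rV n p 0 (lift ord0 j) = p.2 0 j.
Proof.
rewrite /cons_rV (_ : lift ord0 j = rshift 1 j); last exact/val_inj.
by rewrite (@row_mxEr _ 1 1 n).
Qed.

Lemma measurable_cons_rV n : measurable_fun setT (@cons_rV n).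
Proof.
apply: measurable_mxP => i j; rewrite ord1.
have [k ->|->] := unliftP ord0 j.
  under eq_fun do rewrite cons_rVS.
  apply: (@measurableT_comp _ _ _ _ _ _ (fun x : 'rV[R]_n => x 0 k)) => //.
  exact: measurable_coord.
by under eq_fun do rewrite cons_rV0; exact: measurable_fst.
Qed.

Definition uncons_rV n (x : 'rV[R]_n.+1) : R * 'rV[R]_n :=
  (x 0 ord0, \row_j x 0 (lift ord0 j)).

Lemma cons_rVK n : cancel (@cons_rV n) (@uncons_rV n).
Proof.
move=> [r x]; rewrite /uncons_rV cons_rV0; congr pair.
by apply/rowP => j; rewrite mxE cons_rVS.
Qed.

Lemma measurable_uncons_rV n : measurable_fun setT (@uncons_rV n).
Proof.
apply/measurable_fun_pairP; split => /=; first exact: measurable_coord.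
apply: measurable_mxP => i j; rewrite ord1.
under eq_fun do rewrite /= mxE.
exact: measurable_coord.
Qed.

Section lebesgue_push.
Variables (n : nat) (m : {sigma_finite_measure set 'rV[R]_n -> \bar R}).

Definition lebesgue_push : set 'rV[R]_n.+1 -> \bar R :=
  pushforward (@lebesgue_measure R \x m)%E (@cons_rV n).

Let push0 : lebesgue_push set0 = 0%E.
Proof. by rewrite /lebesgue_push /pushforward preimage_set0 measure0. Qed.

Let push_ge0 A : (0 <= lebesgue_push A)%E.
Proof. by rewrite /lebesgue_push /pushforward; exact: measure_ge0. Qed.

Let mcons A : measurable A -> measurable (@cons_rV n @^-1` A).
Proof. by move=> mA; rewrite -[X in measurable X]setTI; exact: measurable_cons_rV. Qed.

Let push_sigma_additive : semi_sigma_additive lebesgue_push.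
Proof.
move=> F mF tF mUF; rewrite /lebesgue_push /pushforward preimage_bigcup.
apply: measure_semi_sigma_additive.
- by move=> k; exact: mcons.
- apply/trivIsetP => /= i j _ _ ij; rewrite -preimage_setI.
  by move/trivIsetP : tF => /(_ _ _ _ _ ij) ->//; rewrite preimage_set0.
- by rewrite -preimage_bigcup; exact: mcons.
Qed.

HB.instance Definition _ := isMeasure.Build _ _ _ lebesgue_push
  push0 push_ge0 push_sigma_additive.

Let push_sigma_finite : sigma_finite setT lebesgue_push.
Proof.
have /sigma_finiteP[F [FT ndF mF]] := sigma_finiteT (@lebesgue_measure R).
have /sigma_finiteP[G [GT ndG mG]] := sigma_finiteT m.
exists (fun k => @uncons_rV n @^-1` (F k `*` G k)).
  apply/esym; rewrite -subTset => x _.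
  have [i _ Fi] : (\bigcup_i F i) (x 0 ord0) by rewrite -FT.
  have [j _ Gj] : (\bigcup_i G i) (uncons_rV x).2 by rewrite -GT.
  exists (maxn i j) => //; split => /=.
    by have /subsetPset := ndF _ _ (leq_maxl i j); apply.
  by have /subsetPset := ndG _ _ (leq_maxr i j); apply.
move=> k; have [mFk Fk] := mF k; have [mGk Gk] := mG k.
have mFG := measurableX mFk mGk; split.
  by rewrite -[X in measurable X]setTI; exact: measurable_uncons_rV.
rewrite /lebesgue_push /pushforward (_ : _ @^-1` (_ @^-1` _) = F k `*` G k).
  by rewrite product_measure1E// lte_mul_pinfty// ge0_fin_numE.
by rewrite -comp_preimage (_ : _ \o _ = id)//; apply/funext; exact: cons_rVK.
Qed.

HB.instance Definition _ := Measure_isSigmaFinite.Build _ _ _ lebesgue_push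
  push_sigma_finite.

End lebesgue_push.

(* Lebesgue measure on R^n, as the iterated product of the one on R. *)
Fixpoint lebesgue_rV (n : nat) : {sigma_finite_measure set 'rV[R]_n -> \bar R} :=
  match n with
  | 0 => @dirac _ 'rV[R]_0 0 R
  | n.+1 => lebesgue_push (lebesgue_rV n)
  end.

End lebesgue_rV.

Section hausdorff.
Context {R : realType}.

Definition enorm n (x : 'rV[R]_n) : R := Num.sqrt (\sum_i x 0 i ^+ 2).

Definition ediam n (A : set 'rV[R]_n) : \bar R :=
  ereal_sup [set (enorm (x - y))%:E | x in A & y in A].

(* Volume of the Euclidean unit ball of R^k. *)
Fixpoint unit_ball_vol (k : nat) : R :=
  match k with
  | 0 => 1
  | 1 => 2
  | k'.+2 => 2 * pi / k'.+2%:R * unit_ball_vol k'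
  end.

Variables (n k : nat).
Local Notation E := 'rV[R]_n.

(* With k = 0, a nonempty set of diameter 0 has size 0 ^+ 0 = 1, which gives
   the counting measure. *)
Definition hausdorff_size (delta : R) (C : set E) : \bar R :=
  if C == set0 then 0%E
  else if (ediam C <= delta%:E)%E
       then (unit_ball_vol k * (fine (ediam C) / 2) ^+ k)%:E
       else +oo%E.

(* mu_ext takes the infimum over countable coverings by Borel sets, instead of
   arbitrary ones; this is the same since a set and its closure have the same
   diameter. *)
Definition hausdorff_delta (delta : R) : set E -> \bar R :=
  mu_ext (hausdorff_size delta).

Definition hausdorff_measure (A : set E) : \bar R :=
  ereal_sup [set hausdorff_delta delta A | delta in [set delta | 0 < delta]].

Lemma coord_le_enorm m (x : 'rV[R]_m) i : `|x 0 i| <= enorm x.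
Proof.
rewrite -sqrtr_sqr ler_wsqrtr// (bigD1 i)//= lerDl.
by apply: sumr_ge0 => j _; exact: sqr_ge0.
Qed.

Lemma unit_ball_vol_ge0 m : 0 <= unit_ball_vol m.
Proof.
suff: 0 <= unit_ball_vol m /\ 0 <= unit_ball_vol m.+1 by case.
elim: m => [|m [IH1 IH2]]; first by split => /=.
split => //=; rewrite mulr_ge0// divr_ge0// mulr_ge0//.
exact: pi_ge0.
Qed.

Lemma ediam_ge0 (C : set E) x : C x -> (0 <= ediam C)%E.
Proof.
move=> Cx; apply: (@le_trans _ _ (enorm (x - x))%:E).
  by rewrite lee_fin sqrtr_ge0.
by apply: ereal_sup_ubound => /=; exists x => //; exists x.
Qed.

Lemma hausdorff_size0 d : hausdorff_size d set0 = 0%E.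
Proof. by rewrite /hausdorff_size eqxx. Qed.

Lemma hausdorff_size_ge0 d C : (0 <= hausdorff_size d C)%E.
Proof.
rewrite /hausdorff_size; case: eqVneq => // /set0P[x Cx].
case: ifP => // _; rewrite lee_fin mulr_ge0 ?unit_ball_vol_ge0//.
by rewrite exprn_ge0// divr_ge0// fine_ge0//; exact: ediam_ge0 Cx.
Qed.

Lemma hausdorff_delta_ge0 d A : (0 <= hausdorff_delta d A)%E.
Proof. by apply: mu_ext_ge0; exact: hausdorff_size_ge0. Qed.

Lemma le_hausdorff_delta d1 d2 A : d1 <= d2 ->
  (hausdorff_delta d2 A <= hausdorff_delta d1 A)%E.
Proof.
move=> d12; apply: le_ereal_inf_tmp => _ [F [mF AF] <-].
apply: (@le_trans _ _ (\sum_(i <oo) hausdorff_size d2 (F i))%E).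
  by apply: ereal_inf_lbound; exists F.
apply: lee_nneseries => [i _ _|i _]; first exact: hausdorff_size_ge0.
rewrite /hausdorff_size; case: eqVneq => // _.
case: (boolP (ediam (F i) <= d1%:E)%E) => h1; last by rewrite leey.
by rewrite (le_trans h1) ?lee_fin.
Qed.

Lemma hausdorff_delta_le d A : 0 < d ->
  (hausdorff_delta d A <= hausdorff_measure A)%E.
Proof. by move=> d0; apply: ereal_sup_ubound; exists d. Qed.

Let hausdorff0 : hausdorff_measure set0 = 0%E.
Proof.
apply/eqP; rewrite eq_le; apply/andP; split.
  apply: ge_ereal_sup => _ [d _ <-]; rewrite /hausdorff_delta mu_ext0//.
    exact: hausdorff_size0.
  exact: hausdorff_size_ge0.
by apply: le_trans (hausdorff_delta_le _ (@ltr01 R)); exact: hausdorff_delta_ge0.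
Qed.

Let hausdorff_ge0 A : (0 <= hausdorff_measure A)%E.
Proof.
by apply: le_trans (hausdorff_delta_le _ (@ltr01 R)); exact: hausdorff_delta_ge0.
Qed.

Let le_hausdorff : {homo hausdorff_measure : A B / A `<=` B >-> (A <= B)%E}.
Proof.
move=> A B AB; apply: ge_ereal_sup => _ [d d0 <-].
by apply: le_trans (hausdorff_delta_le _ d0); exact: le_mu_ext.
Qed.

Let hausdorff_sigma_subadditive : sigma_subadditive hausdorff_measure.
Proof.
move=> A; apply: ge_ereal_sup => _ [d d0 <-].
apply: (@le_trans _ _ (\sum_(i <oo) hausdorff_delta d (A i))%E).
  by apply: mu_ext_sigma_subadditive; exact: hausdorff_size_ge0.
apply: lee_nneseries => [i _ _|i _]; first exact: hausdorff_delta_ge0.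
exact: hausdorff_delta_le.
Qed.

HB.instance Definition _ := isOuterMeasure.Build R E hausdorff_measure
  hausdorff0 hausdorff_ge0 le_hausdorff hausdorff_sigma_subadditive.

Lemma hausdorff_delta_separated e d (A B : set E) : d < e ->
  (forall x y, A x -> B y -> e <= enorm (x - y)) ->
  (hausdorff_delta d A + hausdorff_delta d B <= hausdorff_delta d (A `|` B))%E.
Proof.
move=> de sep; apply: le_ereal_inf_tmp => _ [F [mF ABF] <-].
pose G (A : set E) i := if F i `&` A == set0 then set0 else F i.
have mG C i : measurable (G C i) by rewrite /G; case: ifP.
have covG C : C `<=` A `|` B -> C `<=` \bigcup_i G C i.
  move=> CAB x Cx; have [i _ Fix] := ABF _ (CAB _ Cx).
  exists i => //; rewrite /G; case: eqVneq => // H0.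
  by have : (F i `&` C) x by []; rewrite H0.
have le C : C `<=` A `|` B ->
    (hausdorff_delta d C <= \sum_(i <oo) hausdorff_size d (G C i))%E.
  move=> CAB; apply: ereal_inf_lbound; exists (G C) => //.
  by split; [exact: mG|exact: covG].
apply: (le_trans (leeD (le A _) (le B _))).
- exact: subsetUl.
- exact: subsetUr.
rewrite -nneseriesD; try by move=> *; exact: hausdorff_size_ge0.
apply: lee_nneseries => [i _ _|i _].
  by rewrite adde_ge0//; exact: hausdorff_size_ge0.
rewrite /G; case: eqVneq => [_|/set0P[x [Fx Ax]]].
  rewrite hausdorff_size0 add0e; case: ifP => // _.
  by rewrite hausdorff_size0 hausdorff_size_ge0.
case: eqVneq => [_|/set0P[y [Fy By]]]; first by rewrite hausdorff_size0 adde0.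
rewrite {3}/hausdorff_size; case: eqVneq => [F0|_]; first by move: Fx; rewrite F0.
case: ifPn => [diamF|_]; last by rewrite leey.
have : ((enorm (x - y))%:E <= d%:E)%E.
  apply: le_trans diamF; apply: ereal_sup_ubound => /=.
  by exists x => //; exists y.
by rewrite lee_fin leNgt (lt_le_trans de (sep _ _ Ax By)).
Qed.

Lemma hausdorff_separated e (A B : set E) : 0 < e ->
  (forall x y, A x -> B y -> e <= enorm (x - y)) ->
  (hausdorff_measure A + hausdorff_measure B <= hausdorff_measure (A `|` B))%E.
Proof.
move=> e0 sep.
have [Aoo|Afin] := eqVneq (hausdorff_measure A) +oo%E.
  rewrite [leRHS](_ : _ = +oo%E) ?leey//; apply/eqP.
  by rewrite -leye_eq -Aoo; apply: le_hausdorff; exact: subsetUl.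
have [Boo|Bfin] := eqVneq (hausdorff_measure B) +oo%E.
  rewrite [leRHS](_ : _ = +oo%E) ?leey//; apply/eqP.
  by rewrite -leye_eq -Boo; apply: le_hausdorff; exact: subsetUr.
have fB : hausdorff_measure B \is a fin_num.
  by rewrite ge0_fin_numE ?ltey// hausdorff_ge0.
rewrite -leeBrDr//; apply: ge_ereal_sup => _ [d1 d10 <-].
have fd : hausdorff_delta d1 A \is a fin_num.
  rewrite ge0_fin_numE ?hausdorff_delta_ge0//.
  by rewrite (le_lt_trans (hausdorff_delta_le _ d10))// ltey.
rewrite leeBrDr// -leeBrDl//; apply: ge_ereal_sup => _ [d2 d20 <-].
rewrite leeBrDl//.
pose d := Num.min (Num.min d1 d2) (e / 2).
have d0 : 0 < d by rewrite !lt_min d10 d20 divr_gt0.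
have de : d < e.
  by rewrite /d gt_min; apply/orP; right; rewrite ltr_pdivrMr// ltr_pMr// ltr1n.
apply: le_trans (hausdorff_delta_le _ d0).
apply: le_trans (hausdorff_delta_separated de sep).
by apply: leeD; apply: le_hausdorff_delta; rewrite /d !ge_min lexx ?orbT.
Qed.

Section halfspace.
Variables (X : set E) (i : 'I_n) (c : R).
Let P := [set x : E | c < x 0 i].
Let r (j : nat) : R := c + j.+1%:R^-1.
Let A j := X `&` [set x : E | r j <= x 0 i].
Let D j := X `&` [set x : E | r j.+2 <= x 0 i < r j.+1].

Let r_gtc j : c < r j. Proof. by rewrite ltrDl invr_gt0. Qed.

Let r_lt j l : (j < l)%N -> r l < r j.
Proof. by move=> jl; rewrite ltrD2l ltf_pV2 ?posrE// ltr_nat ltnS. Qed.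

Let r_le j l : (j <= l)%N -> r l <= r j.
Proof. by rewrite leq_eqVlt => /orP[/eqP->//|/r_lt/ltW]. Qed.

Let gap (x y : E) a b : a <= x 0 i -> y 0 i <= b -> a - b <= enorm (x - y).
Proof.
move=> ax yb; apply: le_trans (coord_le_enorm _ i); rewrite !mxE.
by apply: le_trans (ler_norm _); rewrite lerB.
Qed.

Let far j : (hausdorff_measure (A j) + hausdorff_measure (X `&` ~` P)
  <= hausdorff_measure X)%E.
Proof.
have sep x y : A j x -> (X `&` ~` P) y -> r j - c <= enorm (x - y).
  by move=> [_ xj] [_ /= /negP]; rewrite -leNgt; exact: gap.
have := @hausdorff_separated _ _ _ _ sep; rewrite subr_gt0 => /(_ (r_gtc _)).
by move/le_trans; apply; apply: le_hausdorff => x [] [].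
Qed.

Let shells e m : (\sum_(0 <= j < m) hausdorff_measure (D (j.*2 + e))
  <= hausdorff_measure (A (m.*2 + e)))%E.
Proof.
elim: m => [|m IH]; first by rewrite big_nil hausdorff_ge0.
rewrite big_nat_recr//= (le_trans (leeD2r _ IH))//.
set l := (m.*2 + e)%N.
have sep x y : A l x -> D l y -> r l - r l.+1 <= enorm (x - y).
  by move=> [_ xj] [_ /= /andP[_ /ltW yl]]; exact: gap.
have := @hausdorff_separated _ _ _ _ sep; rewrite subr_gt0 => /(_ (r_lt _)).
move=> /(_ (leqnn _)) /le_trans; apply; apply: le_hausdorff.
have -> : (m.+1.*2 + e = l.+2)%N by rewrite doubleS !addSn.
move=> x [] [Xx] /=; first by move=> rx; split => //=; apply: le_trans rx; apply: r_le; rewrite ltnW.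
by move=> /andP[].
Qed.

Let shells_sum : (hausdorff_measure X < +oo)%E ->
  (\sum_(0 <= j <oo) hausdorff_measure (D j) < +oo)%E.
Proof.
move=> Xoo; have leX m : (hausdorff_measure (A m) <= hausdorff_measure X)%E.
  by apply: le_hausdorff => x [].
apply: (@le_lt_trans _ _ (hausdorff_measure X + hausdorff_measure X)%E).
  apply: lime_le; first by apply: is_cvg_nneseries => *; exact: hausdorff_ge0.
  apply: nearW => m.
  apply: (@le_trans _ _ (\sum_(0 <= j < m.*2) hausdorff_measure (D j))%E).
    rewrite [leRHS](big_cat_nat _ (n := m))//=; last by rewrite -addnn leq_addr.
    by rewrite leeDl// sume_ge0// => *; exact: hausdorff_ge0.
  have -> : (\sum_(0 <= j < m.*2) hausdorff_measure (D j) =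
     \sum_(0 <= j < m) hausdorff_measure (D (j.*2 + 0)) +
     \sum_(0 <= j < m) hausdorff_measure (D (j.*2 + 1)))%E.
    elim: m => [|m IH]; first by rewrite !big_nil adde0.
    rewrite doubleS !big_nat_recr//= IH addn0 addn1 -!addeA; congr (_ + _)%E.
    by rewrite addeCA; congr (_ + _)%E.
  by apply: leeD; exact: le_trans (shells _ _) (leX _).
by rewrite lte_add_pinfty.
Qed.

Let cover j : X `&` P `<=` A j.+1 `|` \bigcup_(l in ~` `I_j) D l.
Proof.
move=> x [Xx Px]; have [jx|xj] := leP (r j.+1) (x 0 i); first by left.
right; have exm : exists m, r m <= x 0 i.
  by have [m /ltW] := ltr_add_invr Px; exists m.
case: (ex_minnP exm) => m rm mmin.
have jm : (j.+1 < m)%N.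
  by rewrite ltnNge; apply/negP => mj; move: xj; rewrite ltNge (le_trans (r_le mj)).
case: m => [//|[//|l]] in rm mmin jm *.
exists l; first by move=> /=; apply/negP; rewrite -leqNgt -ltnS -ltnS.
split => //=; rewrite rm /= ltNge; apply/negP => /mmin.
by rewrite ltnn.
Qed.

Lemma hausdorff_halfspace :
  (hausdorff_measure (X `&` P) + hausdorff_measure (X `&` ~` P)
   <= hausdorff_measure X)%E.
Proof.
have [->|Xfin] := eqVneq (hausdorff_measure X) +oo%E; first by rewrite leey.
have Xoo : (hausdorff_measure X < +oo)%E by rewrite ltey.
have H j : (hausdorff_measure (X `&` P) + hausdorff_measure (X `&` ~` P)
   <= hausdorff_measure X + \sum_(j <= l <oo) hausdorff_measure (D l))%E.
  apply: le_trans (leeD2r _ (far j.+1)).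
  rewrite addeAC leeD2r//; apply: le_trans (le_hausdorff (@cover j)) _.
  apply: le_trans (outer_measureU2 _ _ _) _; rewrite leeD2l//.
  exact: outer_measure_sigma_subadditive_tail.
have := nneseries_tail_cvg (shells_sum Xoo) (fun l _ => hausdorff_ge0 (D l)).
move=> tail.
have : (fun j => hausdorff_measure X + \sum_(j <= l <oo) hausdorff_measure (D l))%E
    @ \oo --> (hausdorff_measure X + 0)%E.
  apply: cvgeD => //; first by rewrite fin_num_adde_defl.
  exact: cvg_cst.
rewrite adde0 => lim; rewrite -(cvg_lim _ lim)//.
apply: lime_ge; first by apply/cvg_ex; eexists; exact: lim.
by apply: nearW.
Qed.

End halfspace.

Lemma measurable_caratheodory_hausdorff (A : set E) :
  measurable A -> hausdorff_measure.-caratheodory A.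
Proof.
suff : <<s @matrix_coord_gen R 1 n >> `<=` hausdorff_measure.-caratheodory.
  by apply.
apply: smallest_sub.
  split; first exact: caratheodory_measurable_set0.
    by move=> B mB; rewrite setTD; exact: caratheodory_measurable_setC.
  exact: caratheodory_measurable_bigcup.
move=> _ [i [j [B mB ->]]]; rewrite ord1.
move: mB; rewrite [measurable](measurable_realfun.RGenOInfty.measurableE R).
pose M := [set B : set R | hausdorff_measure.-caratheodory [set x : E | B (x 0 j)]].
move: B; change (<<s @measurable_realfun.RGenOInfty.G R >> `<=` M).
apply: smallest_sub.
  split.
  - exact: caratheodory_measurable_set0.
  - by move=> C mC; rewrite setTD; exact: caratheodory_measurable_setC mC.
  - by move=> F mF; exact: caratheodory_measurable_bigcup mF.
move=> _ [c ->]; apply: le_caratheodory_measurable => X.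
have -> : [set x : E | `]c, +oo[%classic (x 0 j)] = [set x | c < x 0 j].
  by apply/seteqP; split => x /=; rewrite in_itv/= andbT.
exact: hausdorff_halfspace.
Qed.

Let hausdorff_sigma_additive : semi_sigma_additive hausdorff_measure.
Proof.
move=> F mF tF mUF; apply: caratheodory_measure_sigma_additive => //.
- by move=> l; exact: measurable_caratheodory_hausdorff.
- exact: measurable_caratheodory_hausdorff.
Qed.

HB.instance Definition _ := isMeasure.Build _ _ _ hausdorff_measure
  hausdorff0 hausdorff_ge0 hausdorff_sigma_additive.

End hausdorff.

Section geometry.
Context {R : realType} {n : nat}.
Local Notation E := 'rV[R]_n.+1.
Implicit Type Omega : set E.

Definition boundary Omega : set E := closure Omega `\` Omega°.

Definition surface_measure : {measure set E -> \bar R} :=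
  @hausdorff_measure R n.+1 n.

Definition volume Omega : R := fine (lebesgue_rV n.+1 Omega).

Definition surface Omega : R := fine (surface_measure (boundary Omega)).

Definition surface_to_volume Omega : R := surface Omega / volume Omega.

(* Near each boundary point, in the orthonormal coordinates z = y *m Q,
   Omega is the strict epigraph of a Lipschitz function g of the last n
   coordinates. *)
Definition lipschitz_boundary Omega : Prop :=
  forall x, boundary Omega x ->
  exists (r : R) (Q : 'M[R]_n.+1) (g : 'rV[R]_n -> R) (L : R),
    [/\ 0 < r, Q *m Q^T = 1%:M,
        (forall a b, `|g a - g b| <= L * enorm (a - b)) &
        forall y, enorm (y - x) < r ->
          (Omega y <-> g (uncons_rV (y *m Q)).2 < (uncons_rV (y *m Q)).1)].

Definition lipschitz_domain Omega : Prop :=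
  [/\ open Omega, connected Omega, Omega !=set0, bounded_set Omega &
      lipschitz_boundary Omega].

End geometry.

Section sobolev.
Context {R : realType} {n : nat}.
Local Notation E := 'rV[R]_n.+1.
Local Notation leb := (lebesgue_rV n.+1).
Local Notation surf := surface_measure.
Implicit Types (Omega : set E) (u v : E -> R) (Du Dv : E -> E).

Definition square_integrable d (T : measurableType d)
    (mu : {measure set T -> \bar R}) (D : set T) (f : T -> R) : Prop :=
  measurable_fun D f /\ mu.-integrable D (fun x => (f x ^+ 2)%:E).

Definition dot (a b : E) : R := \sum_i a 0 i * b 0 i.

Definition partial (i : 'I_n.+1) (f : E -> R) : E -> R :=
  fun x => 'D_(delta_mx 0 i) f x.

Fixpoint iter_partial (s : seq 'I_n.+1) (f : E -> R) : E -> R :=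
  if s is i :: s' then partial i (iter_partial s' f) else f.

Definition smooth (f : E -> R) : Prop :=
  forall s, continuous (iter_partial s f) /\
    forall i x, derivable (iter_partial s f) x (delta_mx 0 i).

Definition test_function Omega (f : E -> R) : Prop :=
  smooth f /\ exists K : set E,
    [/\ compact K, K `<=` Omega & forall x, ~ K x -> f x = 0].

Definition weak_gradient Omega u Du : Prop :=
  forall i f, test_function Omega f ->
    (\int[leb]_(x in Omega) (u x * partial i f x)) =
    - (\int[leb]_(x in Omega) (Du x 0 i * f x)).

(* u belongs to H^1(Omega) and Du represents its weak gradient, which is unique
   up to null sets. *)
Definition H1 Omega u Du : Prop :=
  [/\ square_integrable leb Omega u,
      (forall i, square_integrable leb Omega (fun x => Du x 0 i)) &
      weak_gradient Omega u Du].

Definition H1_sqnorm Omega u Du : \bar R :=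
  (\int[leb]_(x in Omega) (u x ^+ 2 + dot (Du x) (Du x))%:E)%E.

(* The trace operator H^1(Omega) -> L^2(boundary): the bounded linear operator
   that extends the restriction of functions continuous up to the boundary.
   On a Lipschitz domain it exists, and is unique up to surface-null sets. *)
Record trace_operator Omega (tr : (E -> R) -> E -> R) : Prop := {
  trace_L2 : forall u Du, H1 Omega u Du ->
    square_integrable surf (boundary Omega) (tr u) ;
  trace_linear : forall (a : R) u Du v Dv, H1 Omega u Du -> H1 Omega v Dv ->
    {ae surf, forall x, boundary Omega x ->
       tr (fun y => a * u y + v y) x = a * tr u x + tr v x} ;
  trace_bounded : exists C : R, forall u Du, H1 Omega u Du ->
    ((\int[surf]_(x in boundary Omega) (tr u x ^+ 2)%:E)
       <= C%:E * H1_sqnorm Omega u Du)%E ;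
  trace_restriction : forall u Du, H1 Omega u Du ->
    {within closure Omega, continuous u} ->
    {ae surf, forall x, boundary Omega x -> tr u x = u x} }.

Definition H1_simple Omega (s : R -> E -> R) (Ds : R -> E -> E) : Prop :=
  exists (N : nat) (A : 'I_N -> set R) (w : 'I_N -> E -> R) (Dw : 'I_N -> E -> E),
    [/\ (forall j, measurable (A j)), (forall j, H1 Omega (w j) (Dw j)),
        s = (fun t x => \sum_j \1_(A j) t * w j x) &
        Ds = (fun t x => \sum_j \1_(A j) t *: Dw j x)].

(* u, with space gradient Du, belongs to the Bochner space
   L^2((0, tf); H^1(Omega)). *)
Definition L2_H1 Omega (tf : R) (u : R -> E -> R) (Du : R -> E -> E) : Prop :=
  [/\ {ae @lebesgue_measure R, forall t, t \in `]0, tf[ -> H1 Omega (u t) (Du t)},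
      (exists (s : nat -> R -> E -> R) (Ds : nat -> R -> E -> E),
        (forall k, H1_simple Omega (s k) (Ds k)) /\
        {ae @lebesgue_measure R, forall t, t \in `]0, tf[ ->
          H1_sqnorm Omega (fun x => u t x - s k t x)
            (fun x => Du t x - Ds k t x) @[k --> \oo] --> 0%E}) &
      ((\int[@lebesgue_measure R]_(t in `]0%R, tf[) H1_sqnorm Omega (u t) (Du t))
        < +oo)%E].

(* u belongs to C^0([0, +oo[; L^2(Omega)). *)
Definition C0_L2 Omega (u : R -> E -> R) : Prop :=
  (forall t, 0 <= t -> square_integrable leb Omega (u t)) /\
  forall t, 0 <= t ->
    (\int[leb]_(x in Omega) ((u s x - u t x) ^+ 2))
      @[s --> within [set s : R | 0 <= s] (nbhs t)] --> (0 : R).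

End sobolev.

Section heat.
Context {R : realType} {n : nat}.
Local Notation E := 'rV[R]_n.+1.
Local Notation leb := (lebesgue_rV n.+1).
Local Notation surf := surface_measure.
Implicit Types (Omega : set E) (sigma kappa : E -> R).

Definition essentially_bounded Omega (f : E -> R) : Prop :=
  measurable_fun Omega f /\
  exists M : R, {ae leb, forall x, Omega x -> `|f x| <= M}.

Record admissible_coefficients Omega sigma kappa : Prop := {
  sigma_Linfty : essentially_bounded Omega sigma ;
  kappa_Linfty : essentially_bounded Omega kappa ;
  sigma_pos : exists2 c : R, 0 < c & {ae leb, forall x, Omega x -> c <= sigma x} ;
  sigma_mean : (volume Omega)^-1 * (\int[leb]_(x in Omega) sigma x) = 1 ;
  (* The extension by +oo makes this the essential infimum over Omega. *)
  kappa_inf :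
    ess_inf leb (fun x => if x \in Omega then (kappa x)%:E else +oo%E) = 1%E }.

Definition time_test_function (eta : R -> R) : Prop :=
  (forall k t, derivable (derive1n k eta) t 1) /\
  exists a b : R, 0 < a /\ forall t, t \notin `[a, b] -> eta t = 0.

(* The equation is tested against each v in H^1(Omega), the time derivative of
   \int sigma u v being taken in the sense of distributions on ]0, +oo[. *)
Record heat_solution Omega sigma kappa (tr : (E -> R) -> E -> R) (B : R)
    (u : R -> E -> R) (Du : R -> E -> E) : Prop := {
  heat_C0_L2 : C0_L2 Omega u ;
  heat_L2_H1 : forall tf, 0 < tf -> L2_H1 Omega tf u Du ;
  heat_eq : forall v Dv, H1 Omega v Dv -> forall eta, time_test_function eta ->
    - (\int[@lebesgue_measure R]_(t in `]0, +oo[)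
         (derive1 eta t * (\int[leb]_(x in Omega) (sigma x * u t x * v x)))) +
    (\int[@lebesgue_measure R]_(t in `]0, +oo[)
       (eta t *
         ((\int[leb]_(x in Omega) (kappa x * dot (Du t x) (Dv x))) +
          B * (\int[surf]_(x in boundary Omega) (tr (u t) x * tr v x))))) = 0 ;
  heat_init : {ae leb, forall x, Omega x -> u 0 x = 1} }.

Definition domain_average Omega sigma (u : R -> E -> R) (t : R) : R :=
  (volume Omega)^-1 * (\int[leb]_(x in Omega) (sigma x * u t x)).

(* psi is the function \psi'^0 that defines phi. *)
Record phi_potential Omega sigma kappa (tr : (E -> R) -> E -> R)
    (psi : E -> R) (Dpsi : E -> E) : Prop := {
  psi_H1 : H1 Omega psi Dpsi ;
  psi_mean : (\int[leb]_(x in Omega) (sigma x * psi x)) = 0 ;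
  psi_eq : forall v Dv, H1 Omega v Dv ->
    (\int[leb]_(x in Omega) (kappa x * dot (Dpsi x) (Dv x))) =
    (Num.sqrt (volume Omega))^-1 *
      (surface_to_volume Omega * (\int[leb]_(x in Omega) (sigma x * v x))
       - (\int[surf]_(x in boundary Omega) tr v x)) }.

Definition phi Omega kappa (Dpsi : E -> E) : R :=
  \int[leb]_(x in Omega) (kappa x * dot (Dpsi x) (Dpsi x)).

(* The average in the slow time T = B gamma t. *)
Definition slow_average Omega sigma (B : R) (u : R -> E -> R) (T : R) : R :=
  domain_average Omega sigma u (T / (B * surface_to_volume Omega)).

Definition is_max (D : set R) (f : R -> R) (M : R) : Prop :=
  (exists2 T, D T & f T = M) /\ forall T, D T -> f T <= M.

(* M is the maximum E^1_avg(Tfinal). *)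
Definition lumped_error Omega sigma (B : R) (u : R -> E -> R) (Tfinal M : R)
    : Prop :=
  is_max `[0, Tfinal] (fun T => slow_average Omega sigma B u T - expR (- T)) M.

End heat.

(* Main.v *)
(** The average f(t) = int sigma u(t) is compared with exp(- B gamma t) by testing
    the equation with the constant 1.  By the equation of psi'^0, the boundary term
    B int_{boundary Omega} u equals B gamma f - B |Omega|^(1/2) m, where
    m = int kappa grad psi'^0 . grad u, so that the error is
    B |Omega|^(-1/2) times the convolution of m with exp(- B gamma .).  As
    m^2 <= phi a(u, u), with a the bilinear form of the equation, Young's
    inequality bounds the error by phi and the dissipation, the integral over time
    of a(u(t), u(t)), which is at most |Omega| / 2; the optimal Young parameter
    gives the factor sqrt(phi B / gamma) / 2.

    The equation being tested against fixed functions only, the energy inequality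
    int_0^T a(u, u) <= F(0, 0) / 2, for F(t, s) = int sigma u(t) u(s), is derived
    without differentiating F on the diagonal.  The integrals
    A_h(c) = int_c^(c+h) (F(c, q) - F(c+h, q)) dq satisfy
    int_0^T A_h <= h^2 (F(0, 0) / 2 + o(1)) because 2 A_h is, up to sign, the
    derivative of c |-> int int_{[c, c+h]^2} F.  On the other hand the equation
    makes A_h(c) the double integral of a(u(r), u(q)) over [c, c+h]^2, which is at
    least 2 h int_c^(c+h) a(u(r), w) dr - h^2 a(w, w) for every w; taking w in a
    countable set that is dense in the range of u, liminf A_h(c) / h^2 is at least
    a(u(c), u(c)) for almost every c, and Fatou's lemma applies. *)
Require Import Defs.
From mathcomp Require Import all_boot all_order all_algebra.
From mathcomp Require Import all_classical all_reals all_analysis.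
From mathcomp Require Import measurable_realfun ess_sup_inf.
From mathcomp Require Import ring lra.
Set Implicit Arguments.
Unset Strict Implicit.
Unset Printing Implicit Defensive.
Import Order.TTheory GRing.Theory Num.Theory.
Import numFieldNormedType.Exports.
Local Open Scope classical_set_scope.
Local Open Scope ring_scope.

(** * Integrals and null sets *)

(** The time derivative of the solution exists only in the sense of distributions and only against a
    fixed [v], so the usual formula for the derivative of the squared norm, which tests with [u(t)]
    itself, is out of reach. The second variable of [F] removes this obstacle: [F(t, s)] can be
    differentiated in [t] while [u(s)] is frozen as a test function, for almost every [s]. The lower
    bound of [A_h] expresses [0 <= a(S - h w, S - h w)] for [S] the integral of [u] over
    [[c, c + h]]; this vector-valued integral is never formed, and a near minimiser of the quadratic
    functional that [S] would minimise stands in for it. Functions equal almost everywhere are not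
    identified, so the forms are only nonnegative and every estimate goes through Young's inequality
    with an explicit parameter. In the error estimate the parameter at time [r] is
    [l exp(beta (r - t))] with [beta = B gamma]: after multiplication by the integrating factor the
    dissipation has a weight independent of [r], and the term in [phi] integrates to an exponential.
    The error is then at most [l p + q / l] with [p q = phi B / (16 gamma)], whence the factor
    1/2. *)

Section ae_integral.
Context d (T : measurableType d) (R : realType) (mu : {measure set T -> \bar R}).
Import HBNNSimple.

Let nnintegral (f : T -> \bar R) := ereal_sup [set sintegral mu h |
  h in [set h : {nnsfun T >-> R} | forall x, ((h x)%:E <= f x)%E]].

(** A simple function below [f], set to 0 on a measurable null set that contains the exceptional
    points, lies below [g] everywhere and keeps its integral. *)
Let le_nnintegral_ae (f g : T -> \bar R) :
  {ae mu, forall x, (f x <= g x)%E} -> (forall x, 0 <= g x)%E ->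
  (nnintegral f <= nnintegral g)%E.
Proof.
move=> [N [mN N0 subN]] g0; apply: ge_ereal_sup => _ [h /= hf <-].
pose h' := proj_nnsfun h (measurableC mN).
have h'E x : h' x = h x * \1_(~` N) x by [].
apply: (@le_trans _ _ (sintegral mu h')); last first.
  apply: ereal_sup_ubound; exists h' => //= x.
  rewrite -[leLHS]/((h' x)%:E) h'E indicE; have [xN|] := boolP (x \in ~` N);
    last by rewrite mulr0 g0.
  rewrite mulr1; apply: le_trans (hf x) _.
  by apply: contrapT => fg; move: xN; rewrite inE; apply; apply: subN.
rewrite -!integralT_nnsfun; apply: ae_ge0_le_integral => //.
- by move=> x _; rewrite lee_fin.
- by apply/measurable_EFinP.
- by move=> x _; rewrite lee_fin h'E mulr_ge0 ?indicE.
- exact/measurable_EFinP.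
exists N; split=> // x /= /not_implyP[_] hx; apply: contrapT => xN; apply: hx.
by rewrite -[leRHS]/((h' x)%:E) h'E indicE mem_set// mulr1.
Qed.

Lemma ge0_le_integral_ae (D : set T) (f g : T -> \bar R) :
  (forall x, D x -> 0 <= f x)%E -> (forall x, D x -> 0 <= g x)%E ->
  {ae mu, forall x, D x -> (f x <= g x)%E} ->
  (\int[mu]_(x in D) f x <= \int[mu]_(x in D) g x)%E.
Proof.
move=> f0 g0 fg; rewrite !ge0_integralE//; apply: le_nnintegral_ae.
  by apply: filterS fg => x fgx; rewrite !patchE; case: ifPn => // /set_mem/fgx.
by move=> x; rewrite patchE; case: ifPn => // /set_mem/g0.
Qed.

(* Unlike [ae_eq_integral], no measurability is required: the integral is a
   supremum over simple functions, which can be cut off a null set. *)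
Lemma eq_integral_ae (D : set T) (f g : T -> \bar R) :
  {ae mu, forall x, D x -> f x = g x} ->
  (\int[mu]_(x in D) f x = \int[mu]_(x in D) g x)%E.
Proof.
move=> fg; rewrite /integral -!/(nnintegral _).
suff H : forall p q : T -> \bar R, {ae mu, forall x, p x = q x} ->
    (nnintegral p^\+ = nnintegral q^\+)%E /\
    (nnintegral p^\- = nnintegral q^\-)%E.
  have [|-> ->] := H (f \_ D) (g \_ D); last by [].
  by apply: filterS fg => x fgx; rewrite !patchE; case: ifPn => // /set_mem/fgx.
move=> p q pq; split; apply/eqP; rewrite eq_le !le_nnintegral_ae//.
- by apply: filterS pq => x pqx; rewrite !funeposE pqx.
- by apply: filterS pq => x pqx; rewrite !funeposE pqx.
- by apply: filterS pq => x pqx; rewrite !funenegE pqx.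
- by apply: filterS pq => x pqx; rewrite !funenegE pqx.
Qed.

Lemma eq_Rintegral_ae (D : set T) (f g : T -> R) :
  {ae mu, forall x, D x -> f x = g x} ->
  \int[mu]_(x in D) f x = \int[mu]_(x in D) g x.
Proof.
move=> fg; congr fine; apply: eq_integral_ae.
by apply: filterS fg => x fgx Dx; rewrite fgx.
Qed.

Lemma le_Rintegral_ae (D : set T) (f g : T -> R) : measurable D ->
  mu.-integrable D (EFin \o f) -> mu.-integrable D (EFin \o g) ->
  {ae mu, forall x, D x -> f x <= g x} ->
  \int[mu]_(x in D) f x <= \int[mu]_(x in D) g x.
Proof.
move=> mD If Ig fg.
(* The maximum dominates [f] at every point and equals [g] almost everywhere, which reduces the
   claim to the pointwise comparison. *)
have Imax : mu.-integrable D (EFin \o (f \max g)).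
  apply: (@le_integrable _ _ _ mu D mD _ (fun x => `|f x|%:E + `|g x|%:E)%E).
  - apply/measurable_EFinP; apply: measurable_maxr;
      exact/measurable_EFinP/(measurable_int mu).
  - move=> x _; rewrite /= lee_fin; apply: (@le_trans _ _ (`|f x| + `|g x|));
      last exact: ler_norm.
    by rewrite /Num.max; case: ifP => _; rewrite (lerDl, lerDr).
  - by apply: integrableD => //; exact: integrable_norm.
apply: (@le_trans _ _ (\int[mu]_(x in D) ((f \max g) x))).
  by apply: le_Rintegral => // x _; rewrite /= le_max lexx.
rewrite (@eq_Rintegral_ae _ _ g)//.
by apply: filterS fg => x fgx Dx; apply/max_idPr; exact: fgx.
Qed.

Lemma square_integrableM (D : set T) (f g : T -> R) : measurable D ->
  square_integrable mu D f -> square_integrable mu D g ->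
  mu.-integrable D (fun x => (f x * g x)%:E).
Proof.
move=> mD [mf f2] [mg g2].
apply: (@le_integrable _ _ _ mu D mD _ (fun x => (f x ^+ 2)%:E + (g x ^+ 2)%:E)%E).
- by apply/measurable_EFinP; exact: measurable_funM.
- move=> x _; rewrite /= lee_fin; apply: le_trans (ler_norm _);
    rewrite normrM -(real_normK (num_real (f x))) -(real_normK (num_real (g x))).
  by have := sqr_ge0 (`|f x| - `|g x|); have := sqr_ge0 (`|f x|); have := sqr_ge0 (`|g x|); nra.
- exact: integrableD.
Qed.

Lemma square_integrableD (D : set T) (a : R) (f g : T -> R) : measurable D ->
  square_integrable mu D f -> square_integrable mu D g ->
  square_integrable mu D (fun x => a * f x + g x).
Proof.
move=> mD hf hg; have [mf f2] := hf; have [mg g2] := hg.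
have mD' : measurable_fun D (fun x => a * f x + g x).
  by apply: measurable_funD => //; apply: measurable_funM => //; exact: measurable_cst.
split => //.
apply: (@le_integrable _ _ _ mu D mD _ (fun x => (2 * a ^+ 2)%:E * (f x ^+ 2)%:E + 2%:E * (g x ^+ 2)%:E)%E).
- by apply/measurable_EFinP; exact: measurable_funX.
- move=> x _; rewrite /= lee_fin ger0_norm ?sqr_ge0//; apply: le_trans (ler_norm _).
  by have := sqr_ge0 (a * f x - g x); nra.
- by apply: integrableD => //; exact: integrableZl.
Qed.

Lemma integrableM_bounded (D : set T) (k f : T -> R) (M : R) : measurable D ->
  measurable_fun D k -> (forall x, `|k x| <= M) ->
  mu.-integrable D (EFin \o f) -> mu.-integrable D (fun x => (k x * f x)%:E).
Proof.
move=> mD mk kM If.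
apply: (@le_integrable _ _ _ mu D mD _ (fun x => M%:E * (f x)%:E)%E).
- apply/measurable_EFinP; apply: measurable_funM => //.
  by apply/measurable_EFinP; exact: measurable_int If.
- move=> x _; rewrite /= lee_fin !normrM ler_wpM2r// (le_trans (kM x))//.
  exact: ler_norm.
- exact: integrableZl.
Qed.

(* Works although the limit [f] need not be measurable. *)
Lemma measurable_cvg_off_null (f_ : nat -> T -> R) (f : T -> R) (N : set T) :
  measurable N -> (forall k, measurable_fun setT (f_ k)) ->
  (forall x, ~ N x -> f_ k x @[k --> \oo] --> f x) ->
  measurable_fun setT (fun x => f x * \1_(~` N) x).
Proof.
move=> mN mf cf.
apply: (@measurable_fun_cvg _ _ _ setT (fun k x => f_ k x * \1_(~` N) x)) => //.
  move=> k; apply: measurable_funM => //.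
  by apply: measurable_indic; exact: measurableC.
move=> x _; rewrite indicE; have [xN|xN] := boolP (x \in ~` N).
  rewrite /= mulr1; under eq_fun do rewrite mulr1; apply: cf.
  by move: xN; rewrite inE.
rewrite mulr0; under eq_fun do rewrite mulr0; exact: cvg_cst.
Qed.

End ae_integral.

(** * Smooth functions of one variable *)

Section smooth.
Context {R : realType}.
Implicit Types (f g : R -> R).

(** The regularity clause of [time_test_function]. *)
Record smoothR f : Prop := {
  smoothR_derivable : forall k t, derivable (derive1n k f) t 1 }.

(* Coinduction principle for smoothness. *)
Lemma smoothR_class (P : (R -> R) -> Prop) :
  (forall f, P f -> exists2 f', P f' & forall x : R, is_derive x 1 f (f' x)) ->
  forall f, P f -> smoothR f.
Proof.
move=> HP f Pf; split=> k t.
suff H j : P (derive1n j f).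
  by have [f' _ Hf'] := HP _ (H k); have := Hf' t; case.
elim: j => [|j /HP[f' Pf' Hf']]; first by rewrite derive1n0.
rewrite derive1nS (_ : derive1 _ = f')//; apply/funext => x.
by rewrite derive1E; have := Hf' x; case.
Qed.

Lemma smoothR_derive f : smoothR f -> smoothR (derive1 f).
Proof. by move=> [sf]; split=> k t; rewrite -derive1Sn; exact: sf. Qed.

Lemma smoothR_derivable1 f (x : R) : smoothR f -> derivable f x 1.
Proof. by case=> sf; exact: (sf 0%N). Qed.

Lemma smoothR_is_derive f (x : R) : smoothR f -> is_derive x 1 f (derive1 f x).
Proof. by move=> sf; rewrite derive1E; apply/derivableP; exact: smoothR_derivable1. Qed.

Lemma smoothR_continuous f : smoothR f -> continuous f.
Proof.
by move=> sf x; apply: differentiable_continuous; apply/derivable1_diffP;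
  exact: smoothR_derivable1.
Qed.

Lemma smoothR_cst (c : R) : smoothR (fun=> c).
Proof.
apply: (@smoothR_class (fun f => exists c, f = cst c)); last by exists c.
by move=> _ [d ->]; exists (cst 0) => [|x]; [exists 0|exact: is_derive_cst].
Qed.

(** The coinduction principle asks for a class that contains the derivatives of its members; those
    of products and inverses are sums of products, so all the operations have to be closed off
    together. *)
Inductive smooth_alg : (R -> R) -> Prop :=
| SA_base f : smoothR f -> smooth_alg f
| SA_add f g : smooth_alg f -> smooth_alg g -> smooth_alg (fun x => f x + g x)
| SA_mul f g : smooth_alg f -> smooth_alg g -> smooth_alg (fun x => f x * g x)
| SA_inv f : smooth_alg f -> (forall x, f x != 0) -> smooth_alg (fun x => (f x)^-1).

Lemma smooth_alg_smooth f : smooth_alg f -> smoothR f.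
Proof.
apply: smoothR_class => {}f;
  elim=> {f} [f sf|f g Pf [f' Pf' df] Pg [g' Pg' dg]|f g Pf [f' Pf' df] Pg [g' Pg' dg]|f Pf [f' Pf' df] f0].
- exists (derive1 f); first by apply: SA_base; exact: smoothR_derive.
  by move=> x; exact: smoothR_is_derive.
- exists (fun x => f' x + g' x); first exact: SA_add.
  by move=> x; have := df x; have := dg x => ? ?; exact: is_deriveD.
- exists (fun x => f x * g' x + g x * f' x); first by apply: SA_add; exact: SA_mul.
  move=> x; have := df x; have := dg x => ? ?.
  exact: (@is_deriveM _ _ f g x 1 (f' x) (g' x)).
- exists (fun x => (-1) * ((f x)^-1 * (f x)^-1) * f' x).
    apply: SA_mul => //; apply: SA_mul; first exact/SA_base/smoothR_cst.
    by apply: SA_mul; exact: SA_inv.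
  move=> x; have dfx := df x.
  have := @is_deriveV _ f x (f' x) 1 (f0 x) dfx.
  move/is_derive_eq; apply; by rewrite -[_ *: _]/(_ * _) mulN1r -invfM -expr2.
Qed.

Lemma smoothR_add f g : smoothR f -> smoothR g -> smoothR (fun x => f x + g x).
Proof. by move=> sf sg; apply/smooth_alg_smooth/SA_add; exact: SA_base. Qed.

Lemma smoothR_mul f g : smoothR f -> smoothR g -> smoothR (fun x => f x * g x).
Proof. by move=> sf sg; apply/smooth_alg_smooth/SA_mul; exact: SA_base. Qed.

Lemma smoothR_inv f : smoothR f -> (forall x, f x != 0) ->
  smoothR (fun x => (f x)^-1).
Proof. by move=> sf f0; apply/smooth_alg_smooth/SA_inv => //; exact: SA_base. Qed.

Lemma smoothR_affine f (k b : R) : smoothR f -> smoothR (fun x => f (k * x + b)).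
Proof.
move=> sf; apply: (@smoothR_class (fun h => exists c g, smoothR g /\
   h = fun x => c * g (k * x + b))); last first.
  by exists 1, f; split => //; apply/funext => x; rewrite mul1r.
move=> _ [c [g [sg ->]]]; exists (fun x => (c * k) * derive1 g (k * x + b)).
  by exists (c * k), (derive1 g); split => //; exact: smoothR_derive.
move=> x; have dg := smoothR_is_derive (k * x + b) sg.
have da : is_derive x 1 (fun x : R => k * x + b) k.
  have di : is_derive x 1 (k *: (@idfun R)) (k *: 1) by exact: is_deriveZ.
  have := is_deriveD di (is_derive_cst b x 1).
  by rewrite addr0 -[k *: 1]/(k * 1) mulr1.
have -> : (fun x => c * g (k * x + b)) = c *: (g \o (fun x : R => k * x + b)) by [].
have dc := @is_derive1_comp _ g (fun x : R => k * x + b) x _ _ dg da.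
have := @is_deriveZ _ _ _ (g \o (fun x : R => k * x + b)) c x 1 _ dc.
by move/is_derive_eq; apply; rewrite -![_ *: _]/(_ * _); ring.
Qed.

Lemma smoothR_expR (c : R) : smoothR (fun x => expR (c * x)).
Proof.
suff sexp : smoothR expR.
  have := smoothR_affine c 0 sexp.
  by congr smoothR; apply/funext => x; rewrite addr0.
apply: (@smoothR_class (fun h => h = expR)) => // _ ->.
by exists expR => // x; exact: is_derive_expR.
Qed.

(** For [p = 1] this is the classical flat function exp(-1/x), extended by 0. The polynomial factor
    in 1/x makes the family stable under differentiation. *)
Definition flat (p : {poly R}) (x : R) : R :=
  if 0 < x then p.[x^-1] * expR (- x^-1) else 0.

(** The exponential series gives the bound n! for the monomial of degree n; the coefficients of [p]
    are then summed. *)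
Lemma horner_expRN_bounded (p : {poly R}) :
  exists2 C, 0 < C & forall y, 0 <= y -> `|p.[y] * expR (- y)| <= C.
Proof.
have mono n (y : R) : 0 <= y -> y ^+ n * expR (- y) <= n`!%:R.
  move=> y0; rewrite expRN ler_pdivrMr ?expR_gt0//.
  case: n => [|n]; first by rewrite expr0 mul1r (le_trans _ (expR_ge1Dx _)) ?lerDl.
  rewrite mulrC -ler_pdivrMr ?ltr0n ?fact_gt0//.
  by apply: le_trans (expR_ge1Dxn n y0); rewrite lerDr.
exists (1 + \sum_(i < size p) `|p`_i| * i`!%:R).
  by rewrite ltr_pwDl// sumr_ge0// => i _; rewrite mulr_ge0.
move=> y y0; rewrite horner_coef mulr_suml.
apply: (le_trans (ler_norm_sum _ _ _)); rewrite ler_wpDl//.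
apply: ler_sum => i _; rewrite -mulrA normrM ler_wpM2l// ger0_norm ?mono//.
by rewrite mulr_ge0 ?exprn_ge0 ?expR_ge0.
Qed.

Lemma is_derive_flat (p : {poly R}) (x : R) :
  is_derive x 1 (flat p) (flat ((p - deriv p) * 'X^2) x).
Proof.
rewrite [X in is_derive _ _ _ X]/flat; case: ifPn => [x0|].
- apply: (@near_eq_is_derive R R^o R^o (fun y => p.[y^-1] * expR (- y^-1))).
    by near=> y; rewrite /flat ifT//; near: y; exact: lt_nbhsr.
  have xn0 : x != 0 by rewrite gt_eqF.
  have di : is_derive x 1 (fun y : R => y^-1) (- x ^- 2).
    have := @is_deriveV _ id x 1 1 xn0 (is_derive_id _ _).
    by rewrite -![_ *: _]/(_ * _) mulr1.
  have dp : is_derive x 1 (fun y : R => p.[y^-1]) ((deriv p).[x^-1] * (- x ^- 2)).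
    exact: (@is_derive1_comp _ (horner p) (fun y => y^-1)).
  have de : is_derive x 1 (fun y : R => expR (- y^-1)) (expR (- x^-1) * x ^- 2).
    have dn : is_derive x 1 (fun y : R => - y^-1) (x ^- 2).
      by have := is_deriveN di; rewrite opprK.
    exact: (@is_derive1_comp _ expR (fun y => - y^-1) x _ _ (is_derive_expR _) dn).
  have := is_deriveM dp de.
  move/is_derive_eq; apply.
  rewrite -[_ *: (_ / _)]/(_ * _) -[_ *: (_ * _)]/(_ * _) hornerM hornerD hornerN hornerXn -exprVn.
  by ring.
rewrite -leNgt le_eqVlt => /predU1P[->|x0]; last first.
  apply: (@near_eq_is_derive R R^o R^o (cst 0)).
    near=> y; rewrite /flat ifF//; apply/negbTE; rewrite -leNgt; apply: ltW.
    by near: y; exact: lt_nbhsl.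
(* At 0, the difference quotient for [h > 0] is [h] times the value at 1/h of [p * 'X^2] damped by
   the exponential, hence at most [C * h]. *)
have [C C0 HC] := horner_expRN_bounded (p * 'X^2).
suff lim0 : h^-1 *: ((flat p \o shift 0) (h *: (1 : R^o)) - flat p 0) @[h --> (0 : R)^'] --> (0 : R).
  by apply: DeriveDef; [apply/cvg_ex; exists 0; exact: lim0|exact: cvg_lim].
apply/cvgrPdist_le => e e0; near=> h.
rewrite sub0r normrN [flat p 0]/flat ltxx subr0 /= addr0 -[h *: _]/(h * _) mulr1.
rewrite -[_ *: _]/(_ * _) /flat.
case: ifPn => [h0|_]; last by rewrite mulr0 normr0 ltW.
have -> : h^-1 * (p.[h^-1] * expR (- h^-1)) =
    ((p * 'X^2).[h^-1] * expR (- h^-1)) * h.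
  by rewrite hornerM hornerXn; field; rewrite gt_eqF.
rewrite normrM; apply: (@le_trans _ _ (C * `|h|)).
  by rewrite ler_wpM2r// HC// invr_ge0 ltW.
by rewrite mulrC -ler_pdivlMr//; near: h; apply: dnbhs0_le; exact: divr_gt0.
Unshelve. all: by end_near. Qed.

Lemma smoothR_flat p : smoothR (flat p).
Proof.
apply: (@smoothR_class (fun h => exists p, h = flat p)); last by exists p.
move=> _ [q ->]; exists (flat ((q - deriv q) * 'X^2)); first by eexists.
exact: is_derive_flat.
Qed.

Lemma smooth_step_exists : exists theta : R -> R,
  [/\ smoothR theta, (forall x, x <= 0 -> theta x = 0),
      (forall x, 1 <= x -> theta x = 1) & (forall x, 0 <= theta x <= 1)].
Proof.
pose f := flat 1.
have f0 (x : R) : x <= 0 -> f x = 0 by move=> x0; rewrite /f /flat ltNge x0.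
have fp (x : R) : 0 < x -> 0 < f x by move=> x0; rewrite /f /flat x0 hornerC mul1r expR_gt0.
have fge0 x : 0 <= f x by have [/f0->//|/fp/ltW] := leP x 0.
(* The step is f(x) / (f(x) + f(1 - x)); the denominator is positive because [x] and [1 - x] are
   never both nonpositive. *)
pose g (x : R) := f ((-1) * x + 1).
have gE x : g x = f (1 - x) by rewrite /g mulN1r addrC.
have den x : 0 < f x + g x.
  have [x0|x0] := ltP 0 x; first by rewrite ltr_wpDr// ?gE// fp.
  by rewrite ltr_wpDl// gE fp// subr_gt0 (le_lt_trans x0).
exists (fun x => f x * (f x + g x)^-1); split.
- apply: smoothR_mul; first exact: smoothR_flat.
  apply: smoothR_inv => [|x]; last by rewrite gt_eqF.
  by apply: smoothR_add; [|apply: smoothR_affine]; exact: smoothR_flat.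
- by move=> x /f0 ->; rewrite mul0r.
- move=> x x1; have gx : g x = 0 by rewrite gE f0// subr_le0.
  by have := den x; rewrite gx addr0 => /gt_eqF/negbT/mulfV.
- move=> x; apply/andP; split; first by rewrite divr_ge0// ltW.
  by rewrite ler_pdivrMr// mul1r lerDl gE.
Qed.

End smooth.

(** * Weak derivatives in time *)

Section interval_integral.
Context {R : realType}.
Local Notation mu := (@lebesgue_measure R).
Implicit Types (f g : R -> R) (a b : R).

Lemma integrable_itvcc f a b : continuous f -> mu.-integrable `[a, b] (EFin \o f).
Proof.
move=> cf; apply: continuous_compact_integrable; first exact: segment_compact.
exact: continuous_subspaceT.
Qed.

Lemma continuous_bounded_itvcc f a b : continuous f ->
  exists M, forall x, a <= x <= b -> `|f x| <= M.
Proof.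
move=> cf; have [ab|ba] := leP a b; last first.
  by exists 0 => x /andP[ax xb]; have := le_trans ax xb; rewrite leNgt ba.
have [|c _ Hc] := @EVT_max R (fun x => `|f x|) a b ab.
  by apply: continuous_subspaceT => x; apply: cvg_norm; exact: cf.
by exists `|f c| => x xab; apply: Hc; rewrite in_itv.
Qed.

Lemma Rintegral_cst_itvcc a b (c : R) : a <= b ->
  \int[mu]_(x in `[a, b]) c = c * (b - a).
Proof.
move=> ab; rewrite Rintegral_cst//= lebesgue_measure_itv/= lte_fin.
move: ab; rewrite le_eqVlt => /predU1P[->|ab]; first by rewrite ltxx subrr.
by rewrite ab.
Qed.

Lemma Rintegral_itvcc_norm_le f a b (M : R) : a <= b ->
  mu.-integrable `[a, b] (EFin \o f) ->
  (forall x, a <= x <= b -> `|f x| <= M) ->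
  `|\int[mu]_(x in `[a, b]) f x| <= M * (b - a).
Proof.
move=> ab If fM; apply: (le_trans (le_normr_Rintegral _ If)) => //.
rewrite -Rintegral_cst_itvcc//; apply: le_Rintegral => //.
- exact: integrable_norm.
- by apply: integrable_itvcc => x; exact: cvg_cst.
Qed.

Lemma Rintegral_derive f a b : smoothR f -> a < b ->
  \int[mu]_(x in `[a, b]) derive1 f x = f b - f a.
Proof.
move=> sf ab; rewrite /Rintegral (@continuous_FTC2 _ _ f)//.
- by apply: continuous_subspaceT; exact/smoothR_continuous/smoothR_derive.
- have cf := smoothR_continuous sf; split.
  + by move=> x _; exact: smoothR_derivable1.
  + exact: cvg_at_right_filter (cf a).
  + exact: cvg_at_left_filter (cf b).
Qed.

Lemma Rintegral_support f (A B : set R) : A `<=` B ->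
  (forall x, B x -> ~ A x -> f x = 0) ->
  \int[mu]_(x in B) f x = \int[mu]_(x in A) f x.
Proof.
move=> AB f0; rewrite Rintegral_mkcond [RHS]Rintegral_mkcond.
congr (Rintegral _ _ _); apply/funext => x; rewrite !patchE.
case: ifPn => [/set_mem xB|xB]; case: ifPn => [/set_mem xA|xA] //.
- by apply: f0 => //; move: xA; rewrite notin_setE.
- by move: xB; rewrite notin_setE => xB; case: xB; exact: AB.
Qed.

Lemma Rintegral_cvg_dominated (D : set R) (F : nat -> R -> R) f g :
  measurable D -> (forall k, measurable_fun D (F k)) -> measurable_fun D f ->
  (forall x, D x -> F k x @[k --> \oo] --> f x) ->
  mu.-integrable D (EFin \o g) ->
  (forall k x, D x -> `|F k x| <= g x) ->
  \int[mu]_(x in D) F k x @[k --> \oo] --> \int[mu]_(x in D) f x.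
Proof.
move=> mD mF mf Ff Ig Fg.
have [|||||If _ lim] := @dominated_convergence _ _ _ mu D mD
    (fun k x => (F k x)%:E) (EFin \o f) (EFin \o g).
- by move=> k; apply/measurable_EFinP; exact: mF.
- exact/measurable_EFinP.
- by apply: aeW => x Dx; apply: cvg_EFin; [exact: nearW|exact: Ff].
- exact: Ig.
- by apply: aeW => x k Dx; rewrite lee_fin Fg.
apply: fine_cvg; move: lim.
by rewrite /Rintegral fineK//; exact: integrable_fin_num.
Qed.

End interval_integral.

Section weak_derivative.
Context {R : realType}.
Local Notation mu := (@lebesgue_measure R).
Variables (theta : R -> R).
Hypothesis theta_smooth : smoothR theta.
Hypothesis theta0 : forall x, x <= 0 -> theta x = 0.
Hypothesis theta1 : forall x, 1 <= x -> theta x = 1.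
Hypothesis theta01 : forall x, 0 <= theta x <= 1.

(* [step e s] rises from 0 to 1 on [[s + e, s + 2 * e]]: its derivative
   approaches the Dirac mass at [s]. *)
Let step (e s t : R) : R := theta (e^-1 * t + - (s + e) / e).

Let stepE e s t : step e s t = theta ((t - s - e) / e).
Proof. by rewrite /step; congr theta; ring. Qed.

Let step_smooth e s : smoothR (step e s).
Proof. exact: smoothR_affine. Qed.

Let step0 e s t : 0 < e -> t <= s + e -> step e s t = 0.
Proof.
move=> e0 te; rewrite stepE theta0// pmulr_lle0 ?invr_gt0//.
by rewrite -addrA -opprD subr_le0.
Qed.

Let step1 e s t : 0 < e -> s + 2 * e <= t -> step e s t = 1.
Proof. by move=> e0 te; rewrite stepE theta1// ler_pdivlMr//; lra. Qed.

Let step_derive e s t : derive1 (step e s) t = e^-1 * derive1 theta (e^-1 * t + - (s + e) / e).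
Proof.
have d1 := smoothR_is_derive (e^-1 * t + - (s + e) / e) theta_smooth.
have d2 : is_derive t 1 (fun t : R => e^-1 * t + - (s + e) / e) e^-1.
  have di : is_derive t 1 (e^-1 *: (@idfun R)) (e^-1 *: 1) by exact: is_deriveZ.
  have := is_deriveD di (is_derive_cst (- (s + e) / e) t 1).
  by rewrite addr0 -[_ *: 1]/(_ * 1) mulr1.
have [_] := @is_derive1_comp _ theta _ t _ _ d1 d2.
by rewrite [RHS]mulrC -derive1E => <-.
Qed.

Let near_zero_derive (f : R -> R) (t : R) : (\near t, f t = 0) -> derive1 f t = 0.
Proof.
move=> f0; rewrite derive1E (@near_eq_derive R R^o R^o f (cst 0))//.
exact: derive_cst.
Qed.

Lemma smooth_step_derive_bounded : exists2 C, 0 <= C & forall x, `|derive1 theta x| <= C.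
Proof.
have [M HM] := continuous_bounded_itvcc 0 1
  (smoothR_continuous (smoothR_derive theta_smooth)).
exists `|M| => // x.
have [x0|x0] := ltP x 0.
  rewrite near_zero_derive ?normr0//; near=> y; rewrite theta0// ltW//.
  by near: y; exact: lt_nbhsl.
have [x1|x1] := ltP 1 x.
  rewrite derive1E (@near_eq_derive R R^o R^o theta (cst 1)) ?derive_cst ?normr0//.
  near=> y; rewrite theta1// ltW//; near: y; exact: lt_nbhsr.
by apply: le_trans (ler_norm M); apply: HM; rewrite x0.
Unshelve. all: by end_near. Qed.

Let step'_supp e s t : 0 < e -> ~ (s + e <= t <= s + 2 * e) ->
  derive1 (step e s) t = 0.
Proof.
move=> e0 /negP; rewrite negb_and -!ltNge => /orP[ts|ts].
  apply: near_zero_derive; near=> x; apply: step0 => //; apply: ltW.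
  by near: x; exact: lt_nbhsl.
rewrite derive1E (@near_eq_derive R R^o R^o _ (cst 1)) ?derive_cst//.
near=> x; apply: step1 => //; apply: ltW; near: x; exact: lt_nbhsr.
Unshelve. all: by end_near. Qed.

Variable tf : R.

(** The derivative of the step has integral 1 and is at most C / e in absolute value on an interval
    of length e, so replacing [Y t] by [Y s] costs at most C times the oscillation of [Y] there. *)
Lemma step'_concentrates (Y : R -> R) (s : R) (e : nat -> R) : continuous Y ->
  0 <= s -> (forall k, 0 < e k) -> (forall k, s + 2 * e k < tf) ->
  e k @[k --> \oo] --> 0 ->
  \int[mu]_(t in `]0, tf[) (Y t * derive1 (step (e k) s) t) @[k --> \oo] --> Y s.
Proof.
move=> cY s0 e0 etf ecvg.
have [C C0 HC] := smooth_step_derive_bounded.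
have cs k : continuous (derive1 (step (e k) s)).
  exact/smoothR_continuous/smoothR_derive.
have cYs k : continuous (fun t => Y t * derive1 (step (e k) s) t).
  by move=> t; apply: cvgM; [exact: cY|exact: cs].
have E k : \int[mu]_(t in `]0, tf[) (Y t * derive1 (step (e k) s) t) =
    \int[mu]_(t in `[s + e k, s + 2 * e k]) (Y t * derive1 (step (e k) s) t).
  apply: Rintegral_support => [t /=|t _ /= nt].
    rewrite !in_itv/= => /andP[h1 h2]; have := e0 k; have := etf k; lra.
  by rewrite step'_supp ?mulr0//; move: nt; rewrite in_itv.
have D k : Y s = \int[mu]_(t in `[s + e k, s + 2 * e k]) (Y s * derive1 (step (e k) s) t).
  rewrite RintegralZl//; last exact: integrable_itvcc.
  rewrite Rintegral_derive//; last by have := e0 k; lra.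
  by rewrite step1// step0// subr0 mulr1.
apply/cvgrPdist_le => d d0.
have d'0 : 0 < d / (C + 1) by rewrite divr_gt0// ltr_wpDl.
have /cvgrPdist_le /(_ _ d'0) [r /= r0 Hr] := cY s.
(* The support reaches up to [s + 2 * e k], so [e k < r / 3] keeps it within distance [r] of [s]. *)
have /cvgrPdist_lt /(_ _ (divr_gt0 r0 (ltr0n R 3))) He := ecvg.
near=> k.
rewrite E {1}(D k) -RintegralB//; [|apply: integrable_itvcc..]; last 2 first.
- by move=> t; apply: cvgM; [exact: cvg_cst|exact: cs].
- exact: cYs.
have ek : e k < r / 3.
  have : `|0 - e k| < r / 3 by near: k.
  by rewrite sub0r normrN gtr0_norm.
apply: (@le_trans _ _ ((d / (C + 1) * (e k)^-1 * C) * (s + 2 * e k - (s + e k)))).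
  apply: Rintegral_itvcc_norm_le; first by have := e0 k; lra.
    apply: integrable_itvcc => t; apply: cvgB; last exact: cYs.
    by apply: cvgM; [exact: cvg_cst|exact: cs].
  move=> t /andP[t1 t2]; rewrite -mulrBl normrM -mulrA ler_pM//.
    apply: Hr; rewrite /ball_/= distrC ger0_norm; have := e0 k; lra.
  rewrite step_derive normrM gtr0_norm ?invr_gt0// ler_wpM2l// ?invr_ge0//.
  exact/ltW.
rewrite (_ : _ * _ = d * (C / (C + 1))); last first.
  by field; rewrite !gt_eqF//= ltr_wpDl.
by rewrite ler_piMr ?ltW// ltr_pdivrMr ?mul1r ?ltrDl// ltr_wpDl.
Unshelve. all: by end_near. Qed.

Variables y G : R -> R.
Hypothesis cy : continuous y.
Hypothesis intG : mu.-integrable `]0, tf[ (EFin \o G).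
Hypothesis weak : forall eta, smoothR eta ->
  (exists a b, [/\ 0 < a, b < tf & forall t, ~ (a <= t <= b) -> eta t = 0]) ->
  \int[mu]_(t in `]0, tf[) (derive1 eta t * y t) =
  \int[mu]_(t in `]0, tf[) (eta t * G t).

(** The weak equation is tested with [omega] times the difference of the steps at [t1] and [t2]; in
    the limit the derivatives of the steps give the two boundary values. The steps rise strictly to
    the right of their base points, so that the test function vanishes near 0 even for [t1 = 0]. *)
Lemma weak_derivative_FTC (omega : R -> R) (t1 t2 : R) : smoothR omega ->
  0 <= t1 -> t1 < t2 -> t2 < tf ->
  omega t2 * y t2 - omega t1 * y t1 =
  \int[mu]_(t in `]t1, t2]) (derive1 omega t * y t - omega t * G t).
Proof.
move=> so t10 t12 t2f.
(* One third of the remaining time keeps [t2 + 2 * e k] below [tf]. *)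
pose e (k : nat) : R := (tf - t2) / 3 * k.+1%:R^-1.
have e0 k : 0 < e k by rewrite mulr_gt0 ?divr_gt0 ?subr_gt0// invr_gt0.
have e3 k : e k <= (tf - t2) / 3.
  apply: ler_piMr; first by rewrite divr_ge0// subr_ge0 ltW.
  by rewrite invf_le1 ?ltr0n// ler1n.
have ecvg : e k @[k --> \oo] --> 0.
  rewrite -[X in _ --> X](mulr0 ((tf - t2) / 3)); apply: cvgMr.
  exact: cvg_harmonic.
pose q t := derive1 omega t * y t - omega t * G t.
pose D : set R := `]0, tf[%classic.
have mD : measurable D by exact: measurable_itv.
have co := smoothR_continuous so.
have co' := smoothR_continuous (smoothR_derive so).
have iOO (f : R -> R) : continuous f -> mu.-integrable D (EFin \o f).
  move=> cf; apply: (integrableS _ _ _ (integrable_itvcc 0 tf cf)) => //.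
  exact: subset_itv_oo_cc.
have cc (f g : R -> R) : continuous f -> continuous g -> continuous (fun t => f t * g t).
  by move=> cf cg t; apply: cvgM; [exact: cf|exact: cg].
have imul (f g : R -> R) : continuous f -> mu.-integrable D (EFin \o g) ->
    mu.-integrable D (EFin \o (fun t => f t * g t)).
  move=> cf ig; have [M HM] := continuous_bounded_itvcc 0 tf cf.
  apply: (@le_integrable _ _ _ mu D mD _ (fun x => `|M|%:E * (g x)%:E)%E).
  - apply/measurable_EFinP; apply: measurable_funM.
      by apply: measurable_funTS; exact: continuous_measurable_fun.
    by apply/measurable_EFinP; exact: measurable_int ig.
  - move=> x; rewrite /D/= in_itv/= => /andP[x0 xf].
    rewrite lee_fin !normrM normr_id ler_wpM2r//.
    by rewrite (le_trans _ (ler_norm _))// HM// !ltW.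
  - exact: integrableZl.
have iq : mu.-integrable D (EFin \o q).
  apply: (@integrableB _ _ _ mu D mD (EFin \o (fun t => derive1 omega t * y t))
     (EFin \o (fun t => omega t * G t))); first by apply: iOO; exact: cc.
  exact: imul.
pose st k t := step (e k) t1 t - step (e k) t2 t.
have cst' k : continuous (st k).
  by move=> t; apply: cvgB; exact/smoothR_continuous/step_smooth.
have sst k : smoothR (st k).
  have -> : st k = fun t => step (e k) t1 t + (-1) * step (e k) t2 t.
    by apply/funext => t; rewrite mulN1r.
  apply: smoothR_add; first exact: step_smooth.
  by apply: smoothR_mul; [exact: smoothR_cst|exact: step_smooth].
have dst k t : derive1 (st k) t = derive1 (step (e k) t1) t - derive1 (step (e k) t2) t.
  have d1 := smoothR_is_derive t (@step_smooth (e k) t1).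
  have d2 := smoothR_is_derive t (@step_smooth (e k) t2).
  by have [_] := is_deriveB d1 d2; rewrite -derive1E.
have key k : \int[mu]_(t in D) (st k t * q t) +
   (\int[mu]_(t in D) ((omega t * y t) * derive1 (step (e k) t1) t) -
    \int[mu]_(t in D) ((omega t * y t) * derive1 (step (e k) t2) t)) = 0.
  have W : \int[mu]_(t in D) (derive1 (fun t => omega t * st k t) t * y t) =
      \int[mu]_(t in D) (omega t * st k t * G t).
    apply: weak; first exact: smoothR_mul.
    exists (t1 + e k), (t2 + 2 * e k); split.
    - by have := e0 k; lra.
    - by have := e0 k; have := e3 k; lra.
    - move=> t /negP; rewrite negb_and -!ltNge /st => /orP[h|h].
        by rewrite !step0 ?subrr ?mulr0//; have := e0 k; lra.
      by rewrite !step1 ?subrr ?mulr0//; have := e0 k; lra.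
  have dW t : derive1 (fun t => omega t * st k t) t =
      omega t * derive1 (st k) t + st k t * derive1 omega t.
    have d1 := smoothR_is_derive t so; have d2 := smoothR_is_derive t (sst k).
    by have [_] := is_deriveM d1 d2; rewrite -derive1E.
  have c1 j : continuous (fun t => omega t * y t * derive1 (step (e k) j) t).
    by apply: (cc _ _); [exact: cc|apply/smoothR_continuous/smoothR_derive].
  have i1 := imul _ _ (cst' k) iq.
  rewrite -RintegralB//; [|exact: iOO..].
  rewrite -RintegralD//; last first.
    by apply: (iOO (fun t => _ - _)) => t; apply: cvgB; exact: c1.
  rewrite -[RHS](subrr (\int[mu]_(t in D) (omega t * st k t * G t))) -{1}W.
  rewrite -RintegralB//; first last.
  - by apply: (imul _ _) => //; exact: cc.
  - apply: (iOO _); apply: (cc _ _) => //; apply/smoothR_continuous/smoothR_derive.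
    exact: smoothR_mul.
  by apply: eq_Rintegral => t _; rewrite dW dst /q; ring.
have L1 := @step'_concentrates (fun t => omega t * y t) t1 e (cc _ _ co cy) t10 e0 _ ecvg.
have L2 := @step'_concentrates (fun t => omega t * y t) t2 e (cc _ _ co cy) _ e0 _ ecvg.
have L3 : \int[mu]_(t in D) (st k t * q t) @[k --> \oo] -->
    \int[mu]_(t in D) (\1_(`]t1, t2]%classic) t * q t).
  apply: (@Rintegral_cvg_dominated _ _ _ _ (fun t => `|q t|)) => //.
  - by move=> k; apply/measurable_EFinP; exact: (measurable_int mu (imul _ _ (cst' k) iq)).
  - apply: measurable_funM; first exact: measurable_indic.
    by apply/measurable_EFinP; exact: (measurable_int mu iq).
  - move=> t _; apply: cvgMl; rewrite indicE.
    have stE s : (step (e k) s t) @[k --> \oo] --> (if s < t then 1 else 0 : R).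
      case: ifPn => [st_|]; last first.
        rewrite -leNgt => ts; have -> : (fun k => step (e k) s t) = cst 0.
          by apply/funext => k; rewrite step0// (le_trans ts)// lerDl ltW.
        exact: cvg_cst.
      have ts3 : 0 < (t - s) / 2 by rewrite divr_gt0// subr_gt0.
      have /cvgrPdist_lt /(_ _ ts3) He := ecvg.
      apply: cvg_near_cst; near=> k; apply: step1 => //.
      have : `|0 - e k| < (t - s) / 2 by near: k.
      by rewrite sub0r normrN gtr0_norm//; lra.
    rewrite (_ : (t \in _)%:R = (if t1 < t then 1 else 0) - (if t2 < t then 1 else 0)).
      exact: (cvgB (stE t1) (stE t2)).
    rewrite mem_setE in_itv/=; case: (ltP t1 t) => h1; case: (ltP t2 t) => h2 /=;
      rewrite ?subrr ?subr0//.
    by have := lt_le_trans (lt_trans t12 h2) h1; rewrite ltxx.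
  - exact: integrable_norm.
  - move=> k t _; rewrite normrM ler_piMl//.
    rewrite /st !stepE ler_norml; have := theta01 ((t - t1 - e k) / e k).
    by have := theta01 ((t - t2 - e k) / e k); lra.
have h1 k : t1 + 2 * e k < tf by have := e0 k; have := e3 k; lra.
have h2 k : t2 + 2 * e k < tf by have := e0 k; have := e3 k; lra.
have E0 : \int[mu]_(t in D) (\1_(`]t1, t2]%classic) t * q t) +
    (omega t1 * y t1 - omega t2 * y t2) = 0.
  have L := cvgD L3 (cvgB (L1 h1) (L2 (ltW (le_lt_trans t10 t12)) h2)).
  apply: (cvg_unique _ (L _ _)) => //.
  rewrite (_ : _ + _ = cst 0); first exact: cvg_cst.
  by apply/funext => k; exact: key.
rewrite -[LHS]opprK opprB -(addr0_eq E0) ?opprK.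
rewrite (@Rintegral_support _ _ `]t1, t2]%classic).
- by apply: eq_Rintegral => t tt; rewrite indicE tt mul1r.
- move=> t; rewrite /D /= !in_itv/= => /andP[tt1 tt2].
  by rewrite (le_lt_trans t10 tt1) (le_lt_trans tt2).
- by move=> t _ tt; rewrite indicE memNset// mul0r.
Unshelve. all: by end_near. Qed.

End weak_derivative.

(** * Increments of a symmetric kernel *)

Section primitive.
Context {R : realType}.
Local Notation mu := (@lebesgue_measure R).
Implicit Types (f g : R -> R) (c d e : R).

Lemma is_derive_eps f (x l : R) :
  (forall e : R, 0 < e -> exists2 d : R, 0 < d & forall t, `|t| < d ->
    `|f (x + t) - f x - t * l| <= e * `|t|) -> is_derive x 1 f l.
Proof.
move=> H.
suff lim : h^-1 *: ((f \o shift x) (h *: (1 : R^o)) - f x) @[h --> (0 : R)^'] --> (l : R).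
  by apply: DeriveDef; [apply/cvg_ex; exists l; exact: lim|exact: cvg_lim].
apply/cvgrPdist_le => e e0; have [d d0 Hd] := H _ e0; near=> h.
have h0 : h != 0 by near: h; exact: nbhs_dnbhs_neq.
rewrite /= -[h *: _]/(h * _) mulr1 -[_ *: _]/(_ * _) distrC.
rewrite (_ : _ - l = h^-1 * (f (x + h) - f x - h * l)); last first.
  by rewrite (addrC h x); field.
rewrite normrM normfV ler_pdivrMl ?normr_gt0// [`|h| * e]mulrC; apply: Hd.
by near: h; exact: dnbhs0_lt.
Unshelve. all: by end_near. Qed.

(* Locked: unfolding it makes [ring] and unification diverge. *)
Definition prim := locked (fun f c => \int[mu]_(x in `[-1, c]) f x).

Lemma primE f c : prim f c = \int[mu]_(x in `[-1, c]) f x.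
Proof. by rewrite /prim -lock. Qed.

Lemma primB f c d : continuous f -> -1 <= c -> c <= d ->
  prim f d - prim f c = \int[mu]_(x in `[c, d]) f x.
Proof.
move=> cf c1 cd; rewrite !primE Rintegral_itvB//; last exact: integrable_itvcc.
rewrite Rintegral_itv_obnd_cbnd//.
apply: (integrableS _ _ _ (integrable_itvcc c d cf)) => //.
exact: subset_itv_oc_cc.
Qed.

Lemma primD f g (k : R) c : continuous f -> continuous g ->
  prim (fun x => f x + k * g x) c = prim f c + k * prim g c.
Proof.
move=> cf cg; rewrite !primE RintegralD//; last 2 first.
- exact: integrable_itvcc.
- by apply: integrable_itvcc => x; apply: cvgM; [exact: cvg_cst|exact: cg].
by rewrite RintegralZl//; exact: integrable_itvcc.
Qed.

Lemma prim_norm_le f (M : R) c : continuous f -> -1 <= c ->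
  (forall x, `|f x| <= M) -> `|prim f c| <= M * (c + 1).
Proof.
move=> cf c1 fM; rewrite primE -[1 in leRHS]opprK; apply: Rintegral_itvcc_norm_le => //.
exact: integrable_itvcc.
Qed.

Lemma prim_approx f (K e : R) c d : continuous f -> -1 <= c -> -1 <= d ->
  (forall x, `|x - c| <= `|d - c| -> `|f x - K| <= e) ->
  `|prim f d - prim f c - (d - c) * K| <= e * `|d - c|.
Proof.
move=> cf c1 d1 H.
have cfK : continuous (fun x => f x - K).
  by move=> x; apply: cvgB; [exact: cf|exact: cvg_cst].
have key (a b : R) : -1 <= a -> a <= b -> (forall x, a <= x <= b -> `|f x - K| <= e) ->
    `|prim f b - prim f a - (b - a) * K| <= e * (b - a).
  move=> a1 ab Hab; rewrite primB// [(b - a) * K]mulrC -(@Rintegral_cst_itvcc _ a b K ab).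
  rewrite -RintegralB//; [|exact: integrable_itvcc|by apply: integrable_itvcc => x;
    exact: cvg_cst].
  by apply: Rintegral_itvcc_norm_le => //; exact: integrable_itvcc.
have [cd|dc] := leP c d.
  rewrite (ger0_norm (_ : 0 <= d - c)) ?subr_ge0//; apply: key => // x /andP[cx xd].
  by apply: H; rewrite !ger0_norm ?subr_ge0// lerB.
have -> : prim f d - prim f c - (d - c) * K = - (prim f c - prim f d - (c - d) * K).
  by ring.
have cd0 : 0 <= c - d by rewrite subr_ge0 ltW.
rewrite normrN (distrC d) (ger0_norm cd0).
apply: key => //; first exact: ltW.
move=> x /andP[dx xc]; apply: H.
by rewrite distrC (distrC d) (ger0_norm cd0) ger0_norm ?subr_ge0// lerB.
Qed.

End primitive.

(** * Integrals of a symmetric kernel over moving squares *)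

Section double_primitive.
Context {R : realType}.
Local Notation mu := (@lebesgue_measure R).
Variables (F : R -> R -> R) (M : R).
Hypothesis F_sym : forall r q, F r q = F q r.
Hypothesis F_bounded : forall r q, `|F r q| <= M.
Hypothesis F_equicontinuous : forall q (e : R), 0 < e -> exists2 d : R, 0 < d &
  forall q', `|q' - q| < d -> forall r, `|F r q' - F r q| <= e.

Lemma kernel_continuous r : continuous (F r).
Proof.
move=> q; apply/cvgrPdist_le => e e0; have [d d0 Hd] := F_equicontinuous q e0.
by exists d => //= q' qq; rewrite distrC; apply: Hd; rewrite distrC.
Qed.

Lemma kernel_continuousl q : continuous (F^~ q).
Proof.
by rewrite (_ : F^~ q = F q); [exact: kernel_continuous|exact/funext/(F_sym^~ q)].
Qed.

Let M_ge0 : 0 <= M. Proof. exact: le_trans (F_bounded 0 0). Qed.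

Let P c q := prim (F^~ q) c.
(** The integral of [F] over the rectangle [[-1, c]] by [[-1, d]]. The base point lies to the left
    of 0 so that two-sided derivatives exist at 0 as well. *)
Let Q c d := prim (P c) d.

Let P_continuous (c : R) : -1 <= c -> continuous (P c).
Proof.
move=> c1 q; apply/cvgrPdist_le => e e0.
have e'0 : 0 < e / (c + 2) by rewrite divr_gt0//; lra.
have [d d0 Hd] := F_equicontinuous q e'0.
exists d => //= q'; rewrite /ball_/= distrC => qq.
have -> : P c q - P c q' = prim (fun r => F r q + (-1) * F r q') c.
  by rewrite primD ?mulN1r//; exact: kernel_continuousl.
apply: (@le_trans _ _ (e / (c + 2) * (c + 1))).
  apply: prim_norm_le => //.
    move=> r; apply: cvgD; first exact: kernel_continuousl.
    by apply: cvgM; [exact: cvg_cst|exact: kernel_continuousl].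
  by move=> r; rewrite mulN1r distrC Hd.
by rewrite mulrAC ler_pdivrMr; [nra|lra].
Qed.

(** The increment is taken in one argument after the other. In the first one, the increment of [P]
    is [t * F C q] up to an error [r q] that equicontinuity makes small uniformly in [q], hence also
    after integration in [q]. *)
Let Q_derive (a b c : R) : -1 < c + a -> -1 < c + b ->
  is_derive c 1 (fun t => Q (t + a) (t + b))
    (prim (F (c + a)) (c + b) + prim (F (c + b)) (c + a)).
Proof.
set C := c + a; set D := c + b => C1 D1.
apply: is_derive_eps => e e0.
(* The three error terms below are at most [D + 2], 1 and 1 times [e1 * |t|]. *)
have e10 : 0 < e / (D + 4) by rewrite divr_gt0//; lra.
pose e1 := e / (D + 4).
have e1D : e = e1 * (D + 4) by rewrite /e1 divfK// gt_eqF//; lra.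
have [d1 d10 H1] := F_equicontinuous C e10.
have /cvgrPdist_le /(_ _ e10) [/= d2 d20 H2] := @P_continuous C (ltW C1) D.
pose d := Num.min (Num.min d1 d2) (Num.min (Num.min 1 (C + 1)) (Num.min (D + 1) (e1 / (M + 1)))).
have M1 : 0 < M + 1 by rewrite ltr_wpDl.
exists d; first by rewrite !lt_min d10 d20 ltr01 divr_gt0//=; apply/andP; split; lra.
move=> t; rewrite !lt_min => /andP[/andP[td1 td2] /andP[/andP[t1 tC] /andP[tD tM]]].
have tC' : c + t + a = C + t by rewrite /C addrAC.
have tD' : c + t + b = D + t by rewrite /D addrAC.
rewrite {}tC' {}tD'.
have Ct : -1 <= C + t by move: tC; rewrite ltr_norml => /andP[]; lra.
have Dt : -1 <= D + t by move: tD; rewrite ltr_norml => /andP[]; lra.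
pose r q := P (C + t) q + (-1) * P C q + - t * F C q.
have cPP : continuous (fun q => P (C + t) q + (-1) * P C q).
  move=> q; apply: cvgD; first exact: P_continuous.
  by apply: cvgM; [exact: cvg_cst|apply: P_continuous; exact: ltW].
have cr : continuous r.
  move=> q; apply: cvgD; first exact: cPP.
  by apply: cvgM; [exact: cvg_cst|exact: kernel_continuous].
have rE : Q (C + t) (D + t) - Q C (D + t) = t * prim (F C) (D + t) + prim r (D + t).
  rewrite /r primD//; last exact: kernel_continuous.
  rewrite primD//; [|exact: P_continuous|by apply: P_continuous; exact: ltW].
  by rewrite /Q; ring.
have r_le q : `|r q| <= e1 * `|t|.
  have := @prim_approx _ (F^~ q) (F C q) e1 C (C + t) (@kernel_continuousl q) (ltW C1) Ct.
  rewrite /r mulN1r mulNr (_ : C + t - C = t); last by rewrite addrC addKr.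
  apply=> x xt; rewrite F_sym (F_sym C); apply: H1; exact: le_lt_trans xt _.
have r_prim : `|prim r (D + t)| <= e1 * `|t| * (D + 2).
  apply: le_trans (prim_norm_le cr Dt r_le) _.
  rewrite ler_wpM2l//; first by rewrite mulr_ge0// ltW.
  by move: t1; rewrite ltr_norml => /andP[]; lra.
have q1_approx : `|prim (F C) (D + t) - prim (F C) D| <= e1.
  have := @prim_approx _ (F C) 0 M D (D + t) (@kernel_continuous C) (ltW D1) Dt.
  rewrite (_ : D + t - D = t) ?mulr0 ?subr0; last by rewrite addrC addKr.
  move=> H; apply: le_trans (H _) _; first by move=> x _; rewrite subr0.
  rewrite (@le_trans _ _ ((M + 1) * `|t|))//; first by rewrite ler_wpM2r// lerDl.
  by rewrite mulrC -ler_pdivlMr// ltW.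
have q2_approx : `|Q C (D + t) - Q C D - t * P C D| <= e1 * `|t|.
  have := @prim_approx _ (P C) (P C D) e1 D (D + t) (P_continuous (ltW C1)) (ltW D1) Dt.
  rewrite (_ : D + t - D = t); last by rewrite addrC addKr.
  apply=> x xt; rewrite distrC; apply: H2.
  by rewrite /ball_/= distrC; exact: le_lt_trans xt _.
have PE : prim (F D) C = P C D by congr (prim _ _); apply/funext => x; exact: F_sym.
rewrite PE (_ : _ - _ - _ = prim r (D + t) + t * (prim (F C) (D + t) - prim (F C) D) +
   (Q C (D + t) - Q C D - t * P C D)); last first.
  have : Q (C + t) (D + t) = Q C (D + t) + (t * prim (F C) (D + t) + prim r (D + t)).
    by rewrite -rE; ring.
  by move=> ->; ring.
apply: (le_trans (ler_normD _ _)).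
apply: (le_trans (lerD (ler_normD _ _) q2_approx)).
rewrite normrM e1D.
have := ler_wpM2l (normr_ge0 t) q1_approx.
by move: r_prim; lra.
Qed.

Let A (h c : R) := \int[mu]_(q in `[c, c + h]) (F c q - F (c + h) q).
(** By inclusion and exclusion, the integral of [F] over the square of side [h] with lower corner
    [(c, c)]. As [c] moves, opposite sides of the square contribute with opposite signs, and the
    symmetry of [F] doubles them. *)
Let N (h c : R) := Q (c + h) (c + h) - Q c (c + h) - Q (c + h) c + Q c c.

Let A_primE (h c : R) : 0 < h -> -1 < c -> A h c =
  prim (F c) (c + h) - prim (F c) c - prim (F (c + h)) (c + h) + prim (F (c + h)) c.
Proof.
move=> h0 c1; rewrite /A RintegralB//; [|exact/integrable_itvcc/kernel_continuous..].
rewrite -!primB//; [ring|..]; by [exact: kernel_continuous|lra].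
Qed.

Let N_derive (h c : R) : 0 < h -> -1 < c -> is_derive c 1 (N h) (-2 * A h c).
Proof.
move=> h0 c1; rewrite A_primE//.
have c10 : -1 < c + 0 by rewrite addr0.
have ch1 : -1 < c + h by lra.
have D1 := Q_derive ch1 ch1; have D2 := Q_derive c10 ch1.
have D3 := Q_derive ch1 c10; have D4 := Q_derive c10 c10.
have -> : N h = (fun t => Q (t + h) (t + h)) - (fun t => Q (t + 0) (t + h)) -
    (fun t => Q (t + h) (t + 0)) + (fun t => Q (t + 0) (t + 0)).
  by apply/funext => t; rewrite !fctE !addr0.
have := is_deriveD (is_deriveB (is_deriveB D1 D2) D3) D4.
by move/is_derive_eq; apply; rewrite !addr0; ring.
Qed.

Lemma prim2_continuous (a b c : R) : -1 < c + b ->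
  {for c, continuous (fun t => prim (F (t + a)) (t + b))}.
Proof.
set C := c + a; set D := c + b => D1.
apply/cvgrPdist_le => e e0.
have e10 : 0 < e / (D + 4) by rewrite divr_gt0//; lra.
pose e1 := e / (D + 4).
have e1D : e = e1 * (D + 4) by rewrite /e1 divfK// gt_eqF//; lra.
have [d1 d10 H1] := F_equicontinuous C e10.
have M1 : 0 < M + 1 by rewrite ltr_wpDl.
pose d := Num.min (Num.min d1 1) (Num.min (D + 1) (e1 / (M + 1))).
have d0 : 0 < d by rewrite !lt_min d10 ltr01 divr_gt0//=; apply/andP; split; lra.
exists d => //= s; rewrite /ball_/= distrC !lt_min => /andP[/andP[td1 t1] /andP[tD tM]].
pose t := s - c.
have sC : s + a = C + t by rewrite /C /t; ring.
have sD : s + b = D + t by rewrite /D /t; ring.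
rewrite sC sD.
have Dt : -1 <= D + t by move: tD; rewrite ltr_norml -/t => /andP[]; lra.
rewrite (_ : _ - _ = (prim (F C) D - prim (F C) (D + t)) +
   prim (fun q => F C q + (-1) * F (C + t) q) (D + t)); last first.
  by rewrite primD; [ring|exact: kernel_continuous..].
apply: (le_trans (ler_normD _ _)).
have h1 : `|prim (F C) D - prim (F C) (D + t)| <= e1.
  rewrite distrC.
  have := @prim_approx _ (F C) 0 M D (D + t) (@kernel_continuous C) (ltW D1) Dt.
  rewrite (_ : D + t - D = t) ?mulr0 ?subr0; last by rewrite addrC addKr.
  move=> H; apply: le_trans (H _) _; first by move=> x _; rewrite subr0.
  rewrite (@le_trans _ _ ((M + 1) * `|t|))//; first by rewrite ler_wpM2r// lerDl.
  by rewrite mulrC -ler_pdivlMr// ltW.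
have h2 : `|prim (fun q => F C q + (-1) * F (C + t) q) (D + t)| <= e1 * (D + t + 1).
  apply: prim_norm_le => //.
    move=> q; apply: cvgD; first exact: kernel_continuous.
    by apply: cvgM; [exact: cvg_cst|exact: kernel_continuous].
  move=> q; rewrite mulN1r distrC (F_sym C) (F_sym (C + t)); apply: H1.
  by rewrite addrC addKr.
have : t <= 1 by move: t1; rewrite ltr_norml -/t => /andP[_ /ltW].
by move: h1 h2; rewrite e1D; nra.
Qed.

Let A_continuous (h c : R) : 0 < h -> -1 < c -> {for c, continuous (A h)}.
Proof.
move=> h0 c1.
have c10 : -1 < c + 0 by rewrite addr0.
have ch1 : -1 < c + h by lra.
have L : prim (F (t + 0)) (t + h) - prim (F (t + 0)) (t + 0) -
    prim (F (t + h)) (t + h) + prim (F (t + h)) (t + 0) @[t --> c] -->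
    prim (F (c + 0)) (c + h) - prim (F (c + 0)) (c + 0) -
    prim (F (c + h)) (c + h) + prim (F (c + h)) (c + 0).
  by apply: cvgD; [apply: cvgB; [apply: cvgB|]|]; exact: prim2_continuous.
rewrite /prop_for /continuous_at A_primE//.
move: L; rewrite !addr0; apply: cvg_trans; apply: near_eq_cvg.
near=> x; rewrite addr0 A_primE//.
by near: x; exact: lt_nbhsr.
Unshelve. all: by end_near. Qed.

Let N_approx (h c e : R) : 0 < h -> 0 <= c ->
  (forall r q, c <= r <= c + h -> c <= q <= c + h -> `|F r q - F c c| <= e) ->
  `|N h c - h ^+ 2 * F c c| <= e * h ^+ 2.
Proof.
move=> h0 c0 H.
have cP c' : 0 <= c' -> continuous (P c') by move=> ?; apply: P_continuous; lra.
have cPP : continuous (fun q => P (c + h) q + (-1) * P c q).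
  move=> q; apply: cvgD; first by apply: cP; lra.
  by apply: cvgM; [exact: cvg_cst|exact: cP].
have -> : N h c = prim (fun q => P (c + h) q + (-1) * P c q) (c + h) -
    prim (fun q => P (c + h) q + (-1) * P c q) c.
  rewrite !primD//; try by apply: cP; lra.
  by rewrite /N /Q; ring.
rewrite primB//; [|lra|lra].
have hc : c <= c + h by lra.
have -> : h ^+ 2 * F c c = \int[mu]_(x in `[c, c + h]) (h * F c c).
  by rewrite Rintegral_cst_itvcc//; ring.
have -> : e * h ^+ 2 = (e * h) * (c + h - c) by ring.
rewrite -RintegralB//; last 2 first.
- exact: integrable_itvcc.
- by apply: integrable_itvcc => x; exact: cvg_cst.
apply: Rintegral_itvcc_norm_le => //.
- by apply: integrable_itvcc => x; apply: cvgB; [exact: cPP|exact: cvg_cst].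
move=> q hq.
rewrite mulN1r /P primB//; [|exact: kernel_continuousl|lra].
have -> : h * F c c = \int[mu]_(x in `[c, c + h]) F c c.
  by rewrite Rintegral_cst_itvcc//; ring.
have -> : e * h = e * (c + h - c) by ring.
rewrite -RintegralB//; last 2 first.
- exact/integrable_itvcc/kernel_continuousl.
- by apply: integrable_itvcc => x; exact: cvg_cst.
apply: Rintegral_itvcc_norm_le => //.
  apply: integrable_itvcc => x; apply: cvgB; [exact: kernel_continuousl|exact: cvg_cst].
by move=> r hr; exact: H.
Qed.

Let F_near (c e : R) : 0 < e -> exists2 h0 : R, 0 < h0 & forall h, 0 < h < h0 ->
  forall r q, c <= r <= c + h -> c <= q <= c + h -> `|F r q - F c c| <= e.
Proof.
move=> e0; have e20 : 0 < e / 2 by rewrite divr_gt0.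
have [d d0 Hd] := F_equicontinuous c e20.
exists d => // h /andP[h0 hd] r q /andP[cr rh] /andP[cq qh].
have near x : c <= x -> x <= c + h -> `|x - c| < d.
  by move=> cx xh; rewrite ger0_norm ?subr_ge0//; lra.
have h1 := Hd _ (near _ cq qh) r; have h2 := Hd _ (near _ cr rh) c.
have -> : F r q - F c c = (F r q - F r c) + (F c r - F c c) by rewrite (F_sym c r); ring.
by apply: le_trans (ler_normD _ _) _; rewrite (splitr e) lerD.
Qed.

(* [A h c] stands for the derivative of minus half the squared norm of
   [\int_c^(c+h) u], for [F r q] the inner product of [u r] and [u q]. *)
Lemma integral_increment_le (T e : R) : 0 < T -> 0 < e -> 0 <= F T T ->
  exists2 h0 : R, 0 < h0 & forall h, 0 < h < h0 ->
    mu.-integrable `[0, T] (EFin \o A h) /\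
    \int[mu]_(c in `[0, T]) A h c <= h ^+ 2 * (2^-1 * F 0 0 + e).
Proof.
move=> T0 e0 FTT.
have [h1 h10 H1] := F_near 0 e0; have [h2 h20 H2] := F_near T e0.
exists (Num.min h1 h2); first by rewrite lt_min h10.
move=> h /andP[h0]; rewrite lt_min => /andP[hh1 hh2].
have cA : {within `[0, T], continuous (A h)}.
  apply: continuous_in_subspaceT => x; rewrite inE/= in_itv/= => /andP[x0 _].
  by apply: A_continuous => //; lra.
split; first by apply: continuous_compact_integrable => //; exact: segment_compact.
have dN (c : R) : 0 <= c -> is_derive c 1 (N h) (-2 * A h c).
  by move=> c0; apply: N_derive => //; lra.
have cN (c : R) : 0 <= c -> {for c, continuous (N h)}.
  move=> /dN[dNc _]; apply: differentiable_continuous.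
  exact/derivable1_diffP.
(* Each [N h c] is [h ^+ 2 * F c c] up to [e * h ^+ 2]; two halves of that error make up [e], and
   the term in [F T T] has the favourable sign. *)
have E : \int[mu]_(c in `[0, T]) A h c = - 2^-1 * N h T - (- 2^-1 * N h 0).
  have dN' (c : R) : 0 <= c -> is_derive c 1 (fun x => - 2^-1 * N h x) (A h c).
    move=> c0; have dc := dN _ c0.
    have := @is_deriveZ _ _ _ (N h) (- 2^-1 : R) c 1 _ dc.
    by move/is_derive_eq; apply; rewrite -[_ *: _]/(_ * _); field.
  have cN' (c : R) : 0 <= c -> {for c, continuous (fun x => - 2^-1 * N h x)}.
    by move=> c0; apply: cvgM; [exact: cvg_cst|exact: cN].
  rewrite /Rintegral (@continuous_FTC2 _ _ (fun x => - 2^-1 * N h x))//.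
  - split.
    + by move=> x; rewrite in_itv/= => /andP[/ltW/dN'[]].
    + exact: cvg_at_right_filter (cN' 0 (lexx _)).
    + exact: cvg_at_left_filter (cN' T (ltW T0)).
  - move=> x; rewrite in_itv/= => /andP[/ltW/dN'[_ <-]] _.
    by rewrite derive1E.
have h01 : 0 < h < h1 by rewrite h0.
have h02 : 0 < h < h2 by rewrite h0.
have := N_approx h0 (lexx 0) (H1 h h01); have := N_approx h0 (ltW T0) (H2 h h02).
rewrite E !ler_norml; have := mulr_ge0 (sqr_ge0 h) FTT.
by nra.
Qed.

End double_primitive.

(** * The abstract energy inequality *)

Section right_average.
Context {R : realType}.
Local Notation mu := (@lebesgue_measure R).

Lemma cvg_right_average (f : R -> R) (tf : R) :
  mu.-integrable `]0, tf[ (EFin \o f) ->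
  {ae mu, forall t, `]0, tf[%classic t -> forall h : nat -> R, (forall k, 0 < h k) ->
    h k @[k --> \oo] --> 0 ->
    (h k)^-1 * (\int[mu]_(r in `]t, t + h k]) f r) @[k --> \oo] --> f t}.
Proof.
(* Extension by 0 allows Lebesgue differentiation on the whole line; the interval []t, t + h k]]
   lies in []0, tf[] for large [k]. *)
move=> If; pose g := f \_ `]0, tf[.
have Ig : mu.-integrable setT (EFin \o g).
  by rewrite -restrict_EFin; apply/integrable_restrict => //=; rewrite setTI.
have Igy y : mu.-integrable `]-oo, y] (EFin \o g).
  by apply: (integrableS _ _ _ Ig).
have := FTC1Ny Igy (open_integrable_locally openT Ig).
apply: filterS; first exact: (ae_filter_ringOfSetsType mu).
move=> t [dF F'] tin h h0 hcvg.
move: (tin); rewrite /= in_itv/= => /andP[t0 ttf].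
have gt : g t = f t by rewrite /g patchE mem_set.
move: dF => /cvg_ex[/= l dF].
have ll : l = f t.
  rewrite -gt -F' derive1E; apply/esym/cvg_lim => //.
have hh : (forall k, h k != 0) /\ h k @[k --> \oo] --> 0.
  by split => // k; rewrite gt_eqF.
move: dF => /cvgr_dnbhsP/(_ _ hh); rewrite ll.
apply: cvg_trans; apply: near_eq_cvg.
have tft : 0 < tf - t by rewrite subr_gt0.
have /cvgrPdist_lt /(_ _ tft) hsmall := hcvg.
near=> k.
have hk : h k < tf - t.
  have : `|0 - h k| < tf - t by near: k.
  by rewrite sub0r normrN gtr0_norm.
rewrite -[_ *: (_ - _)]/(_ * _) -[h k *: _]/(h k * _) mulr1; congr (_ * _).
rewrite (addrC (h k)) Rintegral_itvB//; last by rewrite bnd_simp lerDl ltW.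
apply: eq_Rintegral => r; rewrite inE/= in_itv/= => /andP[tr rth].
rewrite /g patchE mem_set//= in_itv/= (lt_trans t0 tr)/=; apply: le_lt_trans rth _; lra.
Unshelve. all: by end_near. Qed.

Lemma le_limn_einf (v u : nat -> \bar R) : (forall k, (v k <= u k)%E) ->
  (limn_einf v <= limn_einf u)%E.
Proof.
move=> vu; rewrite !limn_einf_lim; apply: lee_lim; try exact: is_cvg_einfs.
apply: nearW => n; apply: le_ereal_inf_tmp => _ [m /= nm <-].
by apply: le_trans (vu m); apply: ereal_inf_lbound; exists m.
Qed.

End right_average.

Section energy.
Context {R : realType} (V : lmodType R).
Local Notation mu := (@lebesgue_measure R).
Variables (H : V -> Prop) (a : V -> V -> R).
Hypothesis H_lin : forall c v w, H v -> H w -> H (c *: v + w).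
Hypothesis a_lin : forall c v w x, H v -> H w -> H x ->
  a (c *: v + w) x = c * a v x + a w x.
Hypothesis a_sym : forall v w, H v -> H w -> a v w = a w v.
Hypothesis a_ge0 : forall v, H v -> 0 <= a v v.

Lemma form_expand c v w : H v -> H w ->
  a (c *: v + w) (c *: v + w) = c ^+ 2 * a v v + 2 * c * a v w + a w w.
Proof.
move=> Hv Hw; have Hc := H_lin c Hv Hw.
by rewrite a_lin// !(a_sym _ Hc)// !a_lin// (a_sym Hw Hv); ring.
Qed.

Lemma form_subE v w : H v -> H w ->
  a (v - w) (v - w) = a v v - 2 * a v w + a w w.
Proof.
move=> Hv Hw; rewrite (_ : v - w = (-1) *: w + v); last by rewrite scaleN1r addrC.
by rewrite form_expand// (a_sym Hw Hv); ring.
Qed.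

(** Nonnegativity of the form at [w - e v], divided by [e]. *)
Lemma form_double_le v w (e : R) : 0 < e -> H v -> H w ->
  2 * a v w <= e * a v v + e^-1 * a w w.
Proof.
move=> e0 Hv Hw; have := a_ge0 (H_lin (- e) Hv Hw).
rewrite form_expand// => h.
have : 0 <= e^-1 * ((- e) ^+ 2 * a v v + 2 * - e * a v w + a w w).
  by rewrite mulr_ge0// invr_ge0 ltW.
rewrite !mulrDr (_ : e^-1 * ((- e) ^+ 2 * a v v) = e * a v v); last by field; lra.
by rewrite (_ : e^-1 * (2 * - e * a v w) = - (2 * a v w)); [lra|field; lra].
Qed.

Lemma form_dom0 w : H w -> H 0.
Proof. by move=> Hw; have := H_lin (-1) Hw Hw; rewrite scaleN1r addNr. Qed.

Lemma form_domZ c w : H w -> H (c *: w).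
Proof. by move=> Hw; rewrite -[_ *: _]addr0; apply: H_lin => //; exact: form_dom0 Hw. Qed.

Lemma form_scale c w x : H w -> H x -> a (c *: w) x = c * a w x.
Proof.
move=> Hw Hx; have a0 : a 0 x = 0.
  by have := a_lin (-1) Hw Hw Hx; rewrite scaleN1r addNr mulN1r addNr.
by rewrite -[c *: w]addr0 a_lin ?a0 ?addr0//; exact: form_dom0 Hw.
Qed.

Variable z : R -> V.
Hypothesis Hz : forall t, H (z t).

Section average.
Variable D : set (measurableTypeR R).
Hypothesis mD : measurable D.
Hypothesis muD : (mu D < +oo)%E.
Hypothesis int_a : forall w, H w -> mu.-integrable D (fun r => (a (z r) w)%:E).
Hypothesis int_aa : mu.-integrable D (fun r => (a (z r) (z r))%:E).

Let l w := \int[mu]_(r in D) a (z r) w.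
(** The Dirichlet functional of [l]: a minimiser [S] would satisfy [a S v = l v] for all [v] in the
    domain. *)
Let J w := a w w - 2 * l w.

Let l_lin c v w : H v -> H w -> l (c *: v + w) = c * l v + l w.
Proof.
move=> Hv Hw; rewrite /l -RintegralZl//; last exact: int_a.
rewrite -RintegralD//; last 2 first.
- by apply: (@integrableZl _ _ _ mu D mD c (fun r => (a (z r) v)%:E)); exact: int_a.
- exact: int_a.
apply: eq_Rintegral => r _.
by rewrite a_sym// ?a_lin// ?(a_sym (Hz r))//; exact: H_lin.
Qed.

Let int_cst (c : R) : mu.-integrable D (fun=> c%:E).
Proof.
apply: measurable_bounded_integrable => //; exact: bounded_cst.
Qed.

Let m : R := fine (mu D).

Let J_lb : exists K, forall w, H w -> K <= J w.
Proof.
(* With this Young parameter the integral of the term in [a w w] has the factor [m / d <= 1], and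
   [a w w] in [J w] absorbs it. *)
pose d : R := m + 1; have d0 : 0 < d by rewrite ltr_wpDl// fine_ge0.
exists (- (d * \int[mu]_(r in D) a (z r) (z r))) => w Hw.
suff : 2 * l w <= d * (\int[mu]_(r in D) a (z r) (z r)) + a w w.
  by rewrite /J; lra.
rewrite /l -(RintegralZl 2 mD (int_a Hw)) -(RintegralZl d mD int_aa).
apply: (@le_trans _ _ (\int[mu]_(r in D) (d * a (z r) (z r) + d^-1 * a w w))).
  apply: le_Rintegral => //.
  - exact: (integrableZl mD 2 (int_a Hw)).
  - exact: (integrableD mD (integrableZl mD d int_aa) (int_cst _)).
  - by move=> r _; exact: form_double_le.
rewrite RintegralD//; [|exact: (integrableZl mD d int_aa)|exact: int_cst].
rewrite lerD2l Rintegral_cst// -/m mulrAC ler_piMl ?a_ge0//.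
by rewrite mulrC ler_pdivrMr// mul1r lerDl.
Qed.

(* If some [S] represents [l], i.e. [l v = a S v], then the integral of [f] is
   [l S = a S S], and the claim is [0 <= a (S - w) (S - w)].  As [V] need not be
   complete for [a], the proof takes a near minimiser of [J] for [S]. *)
Lemma average_form_ge (f : R -> R) (w : V) : H w ->
  mu.-integrable D (EFin \o f) ->
  {ae mu, forall q, D q -> f q = l (z q)} ->
  2 * l w - a w w <= \int[mu]_(q in D) f q.
Proof.
move=> Hw If fl; set X := 2 * l w - a w w; set A := \int[mu]_(q in D) f q.
pose K := m + \int[mu]_(q in D) a (z q) (z q).
have K0 : 0 <= K.
  by apply: addr_ge0; [exact: fine_ge0|apply: Rintegral_ge0 => r _; exact: a_ge0].
pose C := 2 * `|A| + 4 * K + `|X| + 4.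
have C0 : 0 < C by rewrite ltr_wpDl// !addr_ge0// mulr_ge0.
suff key d : 0 < d -> d <= 1 -> X - A <= d * C.
  apply/ler_addgt0Pr => e e0.
  have : X - A <= Num.min 1 (e / C) * C.
    apply: key; last by rewrite ge_min lexx.
    by rewrite lt_min ltr01 divr_gt0.
  have : Num.min 1 (e / C) * C <= e by rewrite -ler_pdivlMr// ge_min lexx orbT.
  by lra.
move=> d0 d1.
have [k Hk] := J_lb.
have hJ : has_inf [set J v | v in H].
  by split; [exists (J w); exists w|exists k => _ [v Hv <-]; exact: Hk].
have d20 : 0 < d ^+ 2 by rewrite exprn_gt0.
have [_ [S HS <-] HJS] := inf_adherent d20 hJ.
have Jmin v : H v -> J S - d ^+ 2 <= J v.
  move=> Hv; have : inf [set J v | v in H] <= J v by apply: ge_inf; [exact: hJ.2|exists v].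
  by lra.
have JE c v : H v -> J (c *: v + S) = c ^+ 2 * a v v + 2 * c * a v S + a S S - 2 * (c * l v + l S).
  by move=> Hv; rewrite /J form_expand// l_lin.
(* [S] minimises [J] up to [d ^+ 2]; the comparison with [S - d v], divided by [d], is the
   first-order condition at [S] up to an error of order [d]. *)
have h1 v : H v -> a S v - d * (1 + a v v) <= l v.
  move=> Hv; have := Jmin _ (H_lin (- d) Hv HS); rewrite JE// /J (a_sym Hv HS).
  have := a_ge0 Hv => v0 hh.
  have : 0 <= d * (2 * (l v - a S v) + d * (1 + a v v)) by lra.
  by rewrite pmulr_rge0//; have := mulr_ge0 (ltW d0) (_ : 0 <= 1 + a v v); lra.
(* The comparison with [(1 + d) S]: the first-order condition in the direction of [S] itself. *)
have h2 : 2 * l S - d <= (2 + d) * a S S.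
  have := Jmin _ (H_lin d HS HS); rewrite JE// /J => hh.
  have : 0 <= d * ((2 + d) * a S S - 2 * l S + d) by lra.
  by rewrite pmulr_rge0//; lra.
have h3 : X + a S S - d ^+ 2 <= 2 * l S.
  by have := Jmin _ Hw; rewrite /J /X; lra.
have h4 : l S - d * K <= A.
  rewrite /l /K.
  have -> : \int[mu]_(r in D) a (z r) S - d * (m + \int[mu]_(q in D) a (z q) (z q)) =
     \int[mu]_(q in D) (a (z q) S - d * (1 + a (z q) (z q))).
    have I1 : mu.-integrable D (EFin \o (fun q => 1 + a (z q) (z q))) :=
      integrableD mD (int_cst 1) int_aa.
    rewrite RintegralB//; [|exact: int_a|exact: (integrableZl mD d I1)].
    rewrite (RintegralZl d mD I1) RintegralD//; last exact: int_cst.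
    by rewrite Rintegral_cst// mul1r.
  apply: le_Rintegral_ae => //.
    have I1 := integrableD mD (int_cst 1) int_aa.
    exact: (integrableB mD (int_a HS) (integrableZl mD d I1)).
  by apply: filterS fl => q fq Dq; rewrite fq// (a_sym (Hz q) HS) h1.
(* [h2] eliminates [a S S] from [h3]. The estimates after it only collect terms of order [d] into
   [d * C]. *)
have h5 : (2 + 2 * d) * l S >= (2 + d) * (X - d ^+ 2) - d.
  have := ler_wpM2l (_ : 0 <= 2 + d) h3.
  by move=> /(_ ltac:(lra)); lra.
have h6 : (2 + 2 * d) * l S <= (2 + 2 * d) * (A + d * K).
  by rewrite ler_wpM2l; lra.
have h7 : A <= `|A| by exact: ler_norm.
have h8 : - X <= `|X| by rewrite -normrN; exact: ler_norm.
have h9 : 2 * (X - A) <= d * (2 * A + 2 * K + 2 * d * K - X + 2 * d + d ^+ 2 + 1) by lra.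
have h10 : d * K <= K by rewrite ler_piMl.
have h11 : d ^+ 2 <= 1 by rewrite expr_le1// ltW.
have : d * (2 * A + 2 * K + 2 * d * K - X + 2 * d + d ^+ 2 + 1) <= d * C.
  by apply: ler_wpM2l; [exact: ltW|rewrite /C; lra].
have : 0 <= d * C by rewrite mulr_ge0// ltW.
by lra.
Qed.

End average.

(** In the application [y t w] is the weighted inner product of [u t] and [w], and [F t s] that of
    [u t] and [u s]. The path [z] agrees with [u] at almost every time only, whence the null set in
    [Fy]; that null set depends on [s] alone and serves all [t]. *)
Variables (tf : R) (y : R -> V -> R) (F : R -> R -> R) (M : R) (W : nat -> V).
Local Notation I := (`]0, tf[%classic).
Hypothesis int_a : forall w, H w -> mu.-integrable I (fun r => (a (z r) w)%:E).
Hypothesis int_aa : mu.-integrable I (fun r => (a (z r) (z r))%:E).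
Hypothesis y_FTC : forall w t1 t2, H w -> 0 <= t1 -> t1 < t2 -> t2 < tf ->
  y t2 w - y t1 w = - \int[mu]_(r in `]t1, t2]) a (z r) w.
Hypothesis F_sym : forall r q, F r q = F q r.
Hypothesis F_bounded : forall r q, `|F r q| <= M.
Hypothesis F_equicontinuous : forall q (e : R), 0 < e -> exists2 d : R, 0 < d &
  forall q', `|q' - q| < d -> forall r, `|F r q' - F r q| <= e.
Hypothesis F_ge0 : forall t, 0 <= F t t.
Hypothesis Fy : {ae mu, forall s, I s -> forall t, 0 <= t -> t < tf ->
  F t s = y t (z s)}.
Hypothesis HW : forall i, H (W i).
Hypothesis W_dense : forall t (e : R), I t -> 0 < e ->
  exists i, a (z t - W i) (z t - W i) < e.

Let A (h c : R) := \int[mu]_(q in `[c, c + h]) (F c q - F (c + h) q).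

Let sub_I t1 t2 : 0 <= t1 -> t2 < tf ->
  `]t1, t2]%classic `<=` I.
Proof.
move=> t10 t2f r /=; rewrite !in_itv/= => /andP[r1 r2].
by rewrite (le_lt_trans t10 r1) (le_lt_trans r2 t2f).
Qed.

Lemma increment_form_ge h t w : 0 < h -> 0 <= t -> t + h < tf -> H w ->
  2 * (\int[mu]_(r in `]t, t + h]) a (z r) w) - a w w <= A h t.
Proof.
move=> h0 t0 thf Hw.
have sI := sub_I t0 thf.
have cF c : continuous (F c) by exact: (@kernel_continuous _ F F_equicontinuous).
have cB : continuous (fun q => F t q - F (t + h) q).
  by move=> q; apply: cvgB; exact: cF.
have IB : mu.-integrable `]t, t + h] (EFin \o (fun q => F t q - F (t + h) q)).
  apply: (integrableS _ _ _ (integrable_itvcc t (t + h) cB)) => //.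
  exact: subset_itv_oc_cc.
rewrite /A -Rintegral_itv_obnd_cbnd//.
apply: (@average_form_ge `]t, t + h]%classic) => //.
- rewrite lebesgue_measure_itv/=; case: ifP => // _.
  by rewrite -EFinD ltry.
- by move=> v Hv; apply: (integrableS _ _ _ (int_a Hv)).
- by apply: (integrableS _ _ _ int_aa).
- move: Fy; apply: filterS; first exact: (ae_filter_ringOfSetsType mu).
  move=> q Fq qI.
  have {}Fq := Fq (sI q qI).
  rewrite !Fq//; [|lra|lra].
  have := y_FTC (Hz q) t0 (_ : t < t + h) thf.
  by rewrite ltrDl => /(_ h0); lra.
Qed.

Theorem energy_le (T : R) : 0 < T -> T < tf ->
  (\int[mu]_(t in `]0%R, T[) (a (z t) (z t))%:E <= (2^-1 * F 0 0)%:E)%E.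
Proof.
move=> T0 Ttf; apply/lee_addgt0Pr => e e0.
have [h0 h00 Hh] := integral_increment_le F_sym F_bounded F_equicontinuous T0 e0 (F_ge0 T).
have [h [hkh0 hkT hcvg]] : exists h : nat -> R, [/\ forall k, 0 < h k < h0,
    forall k, h k < tf - T & h k @[k --> \oo] --> 0].
  have [h1 [h10 h1h0 h1T]] : exists h1 : R, [/\ 0 < h1, h1 <= h0 & h1 <= tf - T].
    exists (Num.min h0 (tf - T)); split.
    - by rewrite lt_min h00 subr_gt0.
    - by rewrite ge_min lexx.
    - by rewrite ge_min lexx orbT.
  have lt_h1 k : h1 / 2 * k.+1%:R^-1 < h1.
    apply: (@le_lt_trans _ _ (h1 / 2)); last by lra.
    by apply: ler_piMr; [lra|rewrite invf_le1 ?ltr0n// ler1n].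
  exists (fun k => h1 / 2 * k.+1%:R^-1); split.
  - move=> k; rewrite (lt_le_trans (lt_h1 k) h1h0) andbT.
    by rewrite mulr_gt0 ?divr_gt0// invr_gt0.
  - by move=> k; exact: lt_le_trans (lt_h1 k) h1T.
  - rewrite -[X in _ --> X](mulr0 (h1 / 2)); apply: cvgMr.
    exact: cvg_harmonic.
have hk0 k : 0 < h k by have /andP[] := hkh0 k.
pose g k t : \bar R := (A (h k) t / h k ^+ 2)%:E.
pose D : set (measurableTypeR R) := `]0, T[%classic.
have mD : measurable D by exact: measurable_itv.
have DI t : D t -> I t.
  by rewrite /D/= !in_itv/= => /andP[-> tT]; exact: lt_trans tT Ttf.
have IA k : mu.-integrable `[0, T] (EFin \o A (h k)) by have [] := Hh _ (hkh0 k).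
have mg k : measurable_fun D (g k).
  apply/measurable_EFinP; apply: measurable_funM; last exact: measurable_cst.
  apply: (@measurable_funS _ _ _ _ `[0, T]%classic) => //.
    exact: subset_itv_oo_cc.
  by apply/measurable_EFinP; exact: measurable_int (IA k).
(* The previous bound at [h k *: w], divided by [h k ^+ 2]: with this scaling the averages converge
   to [a (z t) w]. *)
have Age k t w : 0 <= t <= T -> H w ->
    2 * ((h k)^-1 * \int[mu]_(r in `]t, t + h k]) a (z r) w) - a w w <= A (h k) t / h k ^+ 2.
  move=> /andP[t0 tT] Hw.
  have thf : t + h k < tf by have := hkT k; lra.
  have := increment_form_ge (hk0 k) t0 thf (form_domZ (h k) Hw).
  rewrite (form_scale _ Hw (form_domZ _ Hw)) (a_sym Hw (form_domZ _ Hw)) (form_scale _ Hw Hw).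
  have -> : \int[mu]_(r in `]t, t + h k]) a (z r) (h k *: w) =
      h k * \int[mu]_(r in `]t, t + h k]) a (z r) w.
    rewrite -RintegralZl//; last by apply: (integrableS _ _ _ (int_a Hw)) => //; exact: sub_I.
    apply: eq_Rintegral => r _.
    by rewrite a_sym ?form_scale// ?(a_sym (Hz r))//; exact: form_domZ.
  rewrite ler_pdivlMr ?exprn_gt0// => /(le_trans _); apply.
  rewrite le_eqVlt; apply/orP; left; apply/eqP; field.
  by rewrite gt_eqF.
have Dc t : D t -> 0 <= t <= T.
  by rewrite /D/= in_itv/= => /andP[/ltW -> /ltW ->].
(* The choice [w = 0] gives the sign that Fatou's lemma requires. *)
have g0 k t : 0 <= t <= T -> (0 <= g k t)%E.
  move=> Dt; rewrite lee_fin; have H0 := form_dom0 (Hz 0).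
  apply: le_trans (Age k t _ Dt H0).
  have a0 x : H x -> a 0 x = 0.
    by move=> Hx; rewrite -[X in a X](scale0r (z 0)) form_scale// mul0r.
  have -> : \int[mu]_(r in `]t, t + h k]) a (z r) 0 = 0.
    rewrite -[RHS](mul0r (fine (mu `]t, t + h k]))) -Rintegral_cst//.
    by apply: eq_Rintegral => r _; rewrite a_sym// a0.
  by rewrite a0// !mulr0 subrr.
have lim_ge : {ae mu, forall t, D t -> ((a (z t) (z t))%:E <= limn_einf (g^~ t))%E}.
  (* Countability of [W] lets one null set of times serve for all [W i]. *)
  have : {ae mu, forall t i, I t -> (h k)^-1 * \int[mu]_(r in `]t, t + h k]) a (z r) (W i)
       @[k --> \oo] --> a (z t) (W i)}.
    apply/ae_foralln => i.
    have := cvg_right_average (int_a (HW i)).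
    apply: filterS; first exact: (ae_filter_ringOfSetsType mu).
    by move=> t Ht It; exact: Ht.
  apply: filterS; first exact: (ae_filter_ringOfSetsType mu).
  move=> t Ht Dt; have It := DI t Dt.
  (* The limit of the lower bound for [W i] is [a (z t) (z t)] minus the square of [z t - W i],
     hence larger than [a (z t) (z t) - d]. *)
  apply/lee_addgt0Pr => d d0; have [i Hi] := W_dense It d0.
  have Lt := Ht i It.
  pose v k := (2 * ((h k)^-1 * \int[mu]_(r in `]t, t + h k]) a (z r) (W i)) - a (W i) (W i))%:E.
  have cv : v k @[k --> \oo] --> (2 * a (z t) (W i) - a (W i) (W i))%:E.
    apply: cvg_EFin; first exact: nearW.
    by apply: cvgB; [apply: cvgMr|exact: cvg_cst].
  apply: (@le_trans _ _ (limn_einf v + d%:E)%E); last first.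
    by rewrite leeD2r//; apply: le_limn_einf => k; rewrite lee_fin; apply: Age => //; exact: Dc.
  rewrite is_cvg_limn_einfE; last by apply/cvg_ex; eexists; exact: cv.
  rewrite (cvg_lim _ cv)// -EFinD lee_fin.
  by move: Hi; rewrite form_subE//; lra.
apply: (@le_trans _ _ (\int[mu]_(t in D) limn_einf (g^~ t))%E).
  apply: ge0_le_integral_ae => //.
  - by move=> t _; rewrite lee_fin a_ge0.
  - move=> t Dt; rewrite limn_einf_lim; apply: lime_ge; first exact: is_cvg_einfs.
    by apply: nearW => n; apply: le_ereal_inf_tmp => _ [m /= nm <-]; exact/g0/Dc.
apply: (le_trans (fatou mu mD mg (fun k t Dt => g0 k t (Dc t Dt)))).
rewrite limn_einf_lim; apply: lime_le; first exact: is_cvg_einfs.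
apply: nearW => n; apply: (@le_trans _ _ (\int[mu]_(t in D) g n t)%E).
  by apply: ereal_inf_lbound; exists n => /=.
apply: (@le_trans _ _ (\int[mu]_(t in `[0%R, T]) (A (h n) t / h n ^+ 2)%:E)%E).
  apply: ge0_subset_integral => //.
  - have [mA _] := integrableP _ _ _ (IA n).
    apply/measurable_EFinP; apply: measurable_funM; last exact: measurable_cst.
    exact/measurable_EFinP.
  - by move=> t /=; rewrite in_itv/=; exact: g0.
have -> : (\int[mu]_(t in `[0%R, T]) (A (h n) t / h n ^+ 2)%:E)%E =
    ((\int[mu]_(t in `[0, T]) A (h n) t) / h n ^+ 2)%:E.
  rewrite -RintegralZr// /Rintegral fineK//.
  apply: integrable_fin_num => //.
  exact: (integrableZr _ (h n ^+ 2)^-1 (IA n)).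
rewrite -EFinD lee_fin ler_pdivrMr ?exprn_gt0// mulrC.
by have [] := Hh _ (hkh0 n).
Qed.

End energy.

(** * Borel sets and Lebesgue measure on R^n *)

Section rV_borel.
Context {R : realType}.
Implicit Types n : nat.

Lemma nbhs_rVP n (x : 'rV[R]_n) (A : set 'rV[R]_n) :
  nbhs x A <-> exists2 e : R, 0 < e & forall y : 'rV[R]_n, (forall j, `|x 0 j - y 0 j| < e) -> A y.
Proof.
split => [/nbhs_ballP[e /= e0 eA]|[e e0 eA]].
  by exists e => // y xy; apply: eA; split => // i j; rewrite ord1; exact: xy.
apply/nbhs_ballP; exists e => //= y [_ xy]; apply: eA => j; exact: xy.
Qed.

Lemma continuous_cons_rVr n (r : R) : continuous (fun y : 'rV[R]_n => cons_rV (r, y)).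
Proof.
move=> y A /nbhs_rVP[e e0 eA]; apply/nbhs_rVP; exists e => // y' yy'.
apply: eA => j; have [k ->|->] := unliftP ord0 j.
  by rewrite !cons_rVS; exact: yy'.
by rewrite !cons_rV0 subrr normr0.
Qed.

Lemma continuous_cons_rVl n (y : 'rV[R]_n) : continuous (fun r : R => cons_rV (r, y)).
Proof.
move=> r A /nbhs_rVP[e e0 eA]; apply/nbhs_ballP; exists e => //= r' rr'.
apply: eA => j; have [k ->|->] := unliftP ord0 j.
  by rewrite !cons_rVS subrr normr0.
by rewrite !cons_rV0.
Qed.

Lemma measurable_box n (B : 'I_n -> set R) : (forall j, measurable (B j)) ->
  measurable [set x : 'rV[R]_n | forall j, B j (x 0 j)].
Proof.
move=> mB.
rewrite (_ : mkset _ = \bigcap_(j in [set: 'I_n]) [set x : 'rV[R]_n | B j (x 0 j)]).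
  apply: fin_bigcap_measurable => // j _.
  by rewrite -[X in measurable X]setTI; exact: measurable_coord.
by apply/seteqP; split => x /= Bx j => [_|]; exact: Bx.
Qed.

(** An open set is the countable union of the cubes with rational centre and radius [1 / (m + 1)]
    that it contains. Such a cube is a box in the coordinates, and [pickle] enumerates them. *)
Lemma measurable_open_rV n (A : set 'rV[R]_n) : open A -> measurable A.
Proof.
move=> oA.
pose cube (p : nat * 'rV[rat]_n) := [set x : 'rV[R]_n | forall j,
  ball (ratr (p.2 0 j) : R) (p.1.+1%:R^-1) (x 0 j)].
pose F k := if @unpickle (nat * 'rV[rat]_n)%type k is Some p then
  if `[< cube p `<=` A >] then cube p else set0 else set0.
have -> : A = \bigcup_k F k.
  apply/seteqP; split => [x Ax|x [k _]]; last first.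
    by rewrite /F; case: unpickle => // p; case: ifPn => // /asboolP; apply.
  have /nbhs_rVP[e e0 eA] : nbhs x A by exact: open_nbhs_nbhs.
  have [m] := ltr_add_invr (divr_gt0 e0 (ltr0n R 2)); rewrite add0r => me.
  have m0 : 0 < m.+1%:R^-1 :> R by rewrite invr_gt0.
  have qP j : exists q, ratr q \in `]x 0 j, x 0 j + m.+1%:R^-1[.
    by apply: rat_in_itvoo; rewrite ltrDl.
  pose q := \row_j projT1 (cid (qP j)).
  have qx j : `|ratr (q 0 j) - x 0 j| < m.+1%:R^-1.
    rewrite mxE; case: cid => /= s; rewrite in_itv/= => /andP[xs sx].
    by rewrite gtr0_norm ?subr_gt0// ltrBlDl.
  exists (pickle (m, q)) => //; rewrite /F pickleK ifT//.
  apply/asboolP => y /= yq; apply: eA => j.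
  rewrite (_ : _ - _ = - (ratr (q 0 j) - x 0 j) + (ratr (q 0 j) - y 0 j)); last by ring.
  apply: (le_lt_trans (ler_normD _ _)); rewrite normrN [e]splitr.
  by apply: ltrD; [exact: lt_trans (qx j) me|exact: lt_trans (yq j) me].
apply: bigcupT_measurable => k; rewrite /F; case: unpickle => // p.
case: ifPn => // _.
apply: (measurable_box (B := fun j => ball (ratr (p.2 0 j) : R) p.1.+1%:R^-1)) => j.
exact: measurable_ball.
Qed.

Lemma measurable_closed_rV n (A : set 'rV[R]_n) : closed A -> measurable A.
Proof.
move=> /closed_openC/measurable_open_rV/measurableC; by rewrite setCK.
Qed.

Lemma measurable_continuous_rV n (f : 'rV[R]_n -> R) : continuous f ->
  measurable_fun setT f.
Proof.
move=> /continuousP cf.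
apply: (measurability _ (measurable_realfun.RGenOInfty.measurableE R)).
move=> _ [_ [c ->] <-]; rewrite setTI; apply: measurable_open_rV; apply: cf.
exact: interval_open.
Qed.

Definition ccube n (c : 'rV[R]_n) (d : R) : set 'rV[R]_n :=
  [set x | forall j, `[c 0 j - d, c 0 j + d]%classic (x 0 j)].

Lemma measurable_ccube n c d : measurable (@ccube n c d).
Proof.
exact: (measurable_box (B := fun j => `[c 0 j - d, c 0 j + d]%classic)).
Qed.

Lemma lebesgue_ccube n c (d : R) : 0 <= d ->
  lebesgue_rV n (ccube c d) = ((2 * d) ^+ n)%:E.
Proof.
move=> d0; elim: n c => [|n IH] c.
  rewrite /= diracE mem_set ?expr0//= => j; by case: j.
have -> : lebesgue_rV n.+1 (ccube c d) =
    (@lebesgue_measure R \x lebesgue_rV n)%E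
      (`[c 0 ord0 - d, c 0 ord0 + d]%classic `*` ccube (\row_j c 0 (lift ord0 j)) d).
  rewrite [LHS]/= /lebesgue_push /pushforward; congr (_ _).
  apply/seteqP; split => -[r y] /=.
    move=> H; split; first by have := H ord0; rewrite cons_rV0.
    by move=> j; have := H (lift ord0 j); rewrite cons_rVS mxE.
  move=> [Hr Hy] j; have [k ->|->] := unliftP ord0 j.
    by have := Hy k; rewrite cons_rVS mxE.
  by rewrite cons_rV0.
rewrite product_measure1E//; last exact: measurable_ccube.
rewrite IH; have := lebesgue_measure_itv `[c 0 ord0 - d, c 0 ord0 + d].
move=> /= ->; rewrite lte_fin.
rewrite exprS EFinM; congr (_ * _)%E.
case: ifPn => [_|]; first by rewrite -EFinB; congr EFin; ring.
rewrite -leNgt => h; congr EFin; lra.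
Qed.

Lemma integral_lebesgue_rVS n (f : 'rV[R]_n.+1 -> \bar R) :
  measurable_fun setT f ->
  (@lebesgue_measure R \x lebesgue_rV n)%E.-integrable setT (f \o @cons_rV R n) ->
  (\int[lebesgue_rV n.+1]_x f x =
   \int[(@lebesgue_measure R \x lebesgue_rV n)%E]_p f (cons_rV p))%E.
Proof.
move=> mf If.
have E : (lebesgue_rV n.+1 : set 'rV[R]_n.+1 -> \bar R) = pushforward (@lebesgue_measure R \x lebesgue_rV n)%E (@cons_rV R n) by [].
rewrite E integral_pushforward//; exact: measurable_cons_rV.
Qed.

End rV_borel.

(** * Vanishing integrals of compactly supported partial derivatives *)

Section integral_partial.
Context {R : realType}.

Lemma measurable_indic_integrable d (T : measurableType d)
    (mu : {measure set T -> \bar R}) (A : set T) :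
  measurable A -> (mu A < +oo)%E -> mu.-integrable setT (EFin \o \1_A).
Proof.
move=> mA muA; apply/integrableP; split; first exact/measurable_EFinP.
rewrite (eq_integral (EFin \o \1_A)); last first.
  by move=> t _; rewrite /= ger0_norm.
by rewrite integral_indic// setIT.
Qed.

Lemma integral_derive_compact (f g : R -> R) (K : R) : continuous g ->
  (forall x : R, is_derive x 1 f (g x)) ->
  (forall x, ~ (- K <= x <= K) -> f x = 0 /\ g x = 0) ->
  (\int[@lebesgue_measure R]_x (g x)%:E = 0)%E.
Proof.
move=> cg dfg f0.
pose L := `|K| + 1.
have L0 : 0 < L by rewrite ltr_wpDl.
have KL : K < L by rewrite /L; have := ler_norm K; lra.
have cf : continuous f.
  by move=> x; apply: differentiable_continuous; apply/derivable1_diffP; case: (dfg x).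
rewrite (_ : (\int[_]_x _ = \int[@lebesgue_measure R]_(x in `[(- L)%R, L]) (g x)%:E)%E).
  rewrite (@continuous_FTC2 _ g f).
  - have [|-> _] := f0 L; first by move=> /andP[]; lra.
    by have [|-> _] := f0 (- L); [move=> /andP[]; lra|rewrite subee].
  - lra.
  - exact: continuous_subspaceT.
  - split; [by move=> x _; case: (dfg x)| |].
    + exact: cvg_at_right_filter (cf (- L)).
    + exact: cvg_at_left_filter (cf L).
  - by move=> x _; rewrite derive1E; case: (dfg x).
rewrite [RHS]integral_mkcond; apply: eq_integral => x _.
rewrite /= patchE; case: ifPn => // xL.
suff /f0[_ ->] : ~ (- K <= x <= K) by [].
move=> /andP[Kx xK].
by move: xL; rewrite notin_setE/= in_itv/=; apply; apply/andP; split; lra.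
Qed.

(** Fubini after splitting off the first coordinate: if [i] is that coordinate, the inner integral
    is taken along it and vanishes by the fundamental theorem of calculus; otherwise it is taken
    over the others and vanishes by induction. *)
Lemma integral_partial0 n (i : 'I_n) (f g : 'rV[R]_n -> R) (C K : R) : 0 <= K ->
  continuous g -> (forall x, `|g x| <= C) ->
  (forall x, is_derive x (delta_mx 0 i) f (g x)) ->
  (forall x, ~ ccube 0 K x -> f x = 0 /\ g x = 0) ->
  (\int[lebesgue_rV n]_x (g x)%:E = 0)%E.
Proof.
move=> K0; elim: n i f g => [|n IH] i f g cg gC dfg f0; first by case: (i) => - [].
have mg : measurable_fun setT (EFin \o g).
  by apply/measurable_EFinP; exact: measurable_continuous_rV.
have mgc : measurable_fun [set: measurableTypeR R * 'rV[R]_n] ((EFin \o g) \o @cons_rV R n).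
  by apply: measurableT_comp => //; exact: measurable_cons_rV.
have cons_ccube r y : ccube 0 K (@cons_rV R n (r, y)) -> - K <= r <= K /\ ccube 0 K y.
  move=> H; split.
    by have := H ord0; rewrite cons_rV0/= mxE in_itv/= sub0r add0r.
  by move=> j; have := H (lift ord0 j); rewrite cons_rVS/= !mxE.
have If : (@lebesgue_measure R \x lebesgue_rV n)%E.-integrable setT
    ((EFin \o g) \o @cons_rV R n).
  apply: (@le_integrable _ _ _ (@lebesgue_measure R \x lebesgue_rV n)%E _ measurableT _
    (EFin \o (fun p : measurableTypeR R * 'rV[R]_n => C * \1_(`[- K, K]%classic `*` ccube 0 K) p))) => //.
  - move=> [r y] _; rewrite lee_fin indicE; have [xK|xK] := boolP (_ \in _).
      by rewrite mulr1 (le_trans (gC _))// ler_norm.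
    suff /f0[_ /= ->] : ~ ccube 0 K (cons_rV (r, y)) by rewrite normr0.
    move=> /cons_ccube[rK yK].
    by move: xK; rewrite notin_setE; apply; split => //=; rewrite in_itv.
  - have mB : measurable (`[- K, K]%classic `*` @ccube R n 0 K).
      by apply: measurableX => //; exact: measurable_ccube.
    apply: (@integrableZl _ _ _ (@lebesgue_measure R \x lebesgue_rV n)%E _ measurableT C
      (EFin \o \1_(`[- K, K]%classic `*` ccube 0 K))).
    apply: measurable_indic_integrable; first exact: mB.
    have /= -> := @product_measure1E _ _ _ _ R (@lebesgue_measure R) (lebesgue_rV n)
      `[- K, K]%classic (ccube 0 K) (measurable_itv _) (measurable_ccube _ _).
    have /= -> := lebesgue_ccube (0 : 'rV[R]_n) K0.
    have := lebesgue_measure_itv `[- K, K]; rewrite /= => ->.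
    by case: ifP => _; rewrite ?mul0e// -EFinD -EFinM ltry.
rewrite integral_lebesgue_rVS//.
have dcons r y h (k : 'I_n) : @cons_rV R n (r, h *: delta_mx 0 k + y) =
    h *: delta_mx 0 (lift ord0 k) + cons_rV (r, y).
  apply/rowP => j; rewrite [RHS]mxE [X in _ = X + _]mxE [delta_mx _ _ _ _]mxE.
  have [l ->|->] := unliftP ord0 j.
    by rewrite !cons_rVS /= !mxE (inj_eq lift_inj).
  by rewrite !cons_rV0 /= mulr0 add0r.
have dcons0 r y h : @cons_rV R n (h + r, y) = h *: delta_mx 0 ord0 + cons_rV (r, y).
  apply/rowP => j; rewrite [RHS]mxE [X in _ = X + _]mxE [delta_mx _ _ _ _]mxE.
  have [l ->|->] := unliftP ord0 j.
    by rewrite !cons_rVS /= mulr0 add0r.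
  by rewrite !cons_rV0 /= mulr1.
have [k ik|i0] := unliftP ord0 i.
  rewrite -integral12_prod_meas1//.
  under eq_integral => r _.
    rewrite /fubini_F.
    have -> : (\int[lebesgue_rV n]_y ((EFin \o g) \o @cons_rV R n) (r, y) = 0)%E.
      apply: (IH k (fun y => f (cons_rV (r, y)))).
      - move=> y; apply: (@continuous_comp _ _ _ (fun y => cons_rV (r, y)) g); last exact: cg.
        exact: continuous_cons_rVr.
      - by move=> y; exact: gC.
      - move=> y; have [df dfE] := dfg (cons_rV (r, y)).
        have E : (fun h : R => h^-1 *: (((fun y => f (cons_rV (r, y))) \o shift y) (h *: delta_mx 0 k) - f (cons_rV (r, y)))) =
           (fun h : R => h^-1 *: ((f \o shift (cons_rV (r, y))) (h *: delta_mx 0 i) - f (cons_rV (r, y)))).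
          by apply/funext => h /=; rewrite dcons ik.
        split; first by rewrite /derivable E.
        by rewrite -dfE /derive E.
      - move=> y yK; apply: f0 => /cons_ccube[_]; exact: yK.
    over.
  by rewrite integral0.
rewrite -integral21_prod_meas1//.
under eq_integral => y _.
  rewrite /fubini_G.
  have -> : (\int[@lebesgue_measure R]_r ((EFin \o g) \o @cons_rV R n) (r, y) = 0)%E.
    apply: (@integral_derive_compact (fun r => f (cons_rV (r, y))) _ K).
    - move=> r; apply: (@continuous_comp _ _ _ (fun r => cons_rV (r, y)) g); last exact: cg.
      exact: continuous_cons_rVl.
    - move=> r; have [df dfE] := dfg (cons_rV (r, y)).
      have E : (fun h : R => h^-1 *: (((fun r => f (cons_rV (r, y))) \o shift r) (h *: (1 : R^o)) - f (cons_rV (r, y)))) =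
         (fun h : R => h^-1 *: ((f \o shift (cons_rV (r, y))) (h *: delta_mx 0 i) - f (cons_rV (r, y)))).
        by apply/funext => h /=; rewrite -[h *: 1]/(h * 1) mulr1 dcons0 i0.
      split; first by rewrite /derivable E.
      by rewrite -dfE /derive E.
    - by move=> r rK; apply: f0 => /cons_ccube[].
  over.
by rewrite integral0.
Qed.

End integral_partial.

(** * The boundary and the constant functions *)

Section surface_positive.
Context {R : realType}.

Lemma unit_ball_vol_gt0 m : 0 < @unit_ball_vol R m.
Proof.
suff: 0 < @unit_ball_vol R m /\ 0 < @unit_ball_vol R m.+1 by case.
elim: m => [|m [IH1 IH2]]; first by split => /=.
by split => //=; rewrite mulr_gt0// divr_gt0// mulr_gt0// pi_gt0.
Qed.

Lemma bounded_set_coord n (A : set 'rV[R]_n) : bounded_set A ->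
  exists2 M : R, 0 < M & forall x, A x -> forall j, `|x 0 j| <= M.
Proof.
move=> [M [_ HM]]; exists (`|M| + 1); first by rewrite ltr_wpDl.
move=> x Ax j.
have /(HM _) /(_ x Ax) : M < `|M| + 1 by rewrite (le_lt_trans (ler_norm _))// ltrDl.
apply: le_trans; rewrite [leRHS]/Num.norm /= mx_normrE; apply/bigmax_geP; right => /=.
by exists (0, j).
Qed.

Variable n : nat.
Variable Omega : set 'rV[R]_n.+1.
Hypothesis oOmega : open Omega.
Hypothesis bOmega : bounded_set Omega.

(** The supremum of the section of [Omega] by the line is a limit of points of [Omega], and is not
    in [Omega], as openness would allow a larger one. *)
Lemma line_meets_boundary r y : Omega (cons_rV (r, y)) ->
  exists s, boundary Omega (cons_rV (s, y)).
Proof.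
move=> Or; have [M M0 HM] := bounded_set_coord bOmega.
pose S := [set s : R | Omega (cons_rV (s, y))].
have supS : has_sup S.
  split; first by exists r.
  exists M => s Ss; have := HM _ Ss ord0; rewrite cons_rV0.
  by apply: le_trans; exact: ler_norm.
exists (sup S); split.
  move=> B /nbhs_rVP[e e0 eB].
  have [s Ss es] := sup_adherent e0 supS.
  exists (cons_rV (s, y)); split => //; apply: eB => j.
  have [k ->|->] := unliftP ord0 j; first by rewrite !cons_rVS subrr normr0.
  rewrite !cons_rV0 /= ger0_norm ?subr_ge0; first by rewrite ltrBlDl -ltrBlDr.
  by apply: ub_le_sup => //; exact: supS.2.
move/(@interior_subset _ Omega) => Os.
have /nbhs_rVP[e e0 eO] : nbhs (cons_rV (sup S, y)) Omega by exact: open_nbhs_nbhs.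
have : S (sup S + e / 2).
  apply: eO => j; have [k ->|->] := unliftP ord0 j.
    by rewrite !cons_rVS subrr normr0.
  rewrite !cons_rV0 /= opprD addrA subrr add0r normrN gtr0_norm ?divr_gt0//.
  by rewrite ltr_pdivrMr// ltr_pMr// ltr1n.
move=> Se; have := ub_le_sup supS.2 Se; rewrite leNgt ltrDl divr_gt0//.
Qed.

(** The factor compares the volume [(2 d) ^ n] of the cube of half-side [d] with the size of a set
    of diameter [d], which is the ball volume times [(d / 2) ^ n]. *)
Lemma hausdorff_size_ccube (F : set 'rV[R]_n.+1) (x : 'rV[R]_n.+1) : F x ->
  (hausdorff_size n 1 F < +oo)%E ->
  exists d, [/\ 0 <= d, (forall p, F p -> ccube (uncons_rV x).2 d (uncons_rV p).2) &
    (lebesgue_rV n (ccube (uncons_rV x).2 d) =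
     (4 ^+ n / unit_ball_vol n)%:E * hausdorff_size n 1 F)%E].
Proof.
move=> Fx; rewrite /hausdorff_size; case: eqVneq => [F0|_]; first by move: Fx; rewrite F0.
case: ifPn => // d1 _.
have d0 := ediam_ge0 Fx.
have dfin : ediam F \is a fin_num.
  by rewrite ge0_fin_numE// (le_lt_trans d1)// ltry.
exists (fine (ediam F)); split; first exact: fine_ge0.
  move=> p Fp j; rewrite /= in_itv/= !mxE.
  have : `|(p - x) 0 (lift ord0 j)| <= fine (ediam F).
    apply: le_trans (coord_le_enorm _ _) _.
    rewrite -lee_fin fineK//; apply: ereal_sup_ubound => /=.
    by exists p => //; exists x.
  by rewrite !mxE ler_norml => /andP[]; lra.
rewrite lebesgue_ccube ?fine_ge0// -EFinM; congr EFin.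
have v0 := unit_ball_vol_gt0 n.
rewrite mulrA divfK ?gt_eqF// -exprMn; by congr (_ ^+ _); field.
Qed.

(* Each vertical line over a small cube of base points meets the boundary; hence
   a covering of the boundary projects to a covering of the cube, and a set of
   diameter [d] projects into a cube of side [2 * d]. *)
Lemma surface_measure_boundary_gt0 : Omega !=set0 ->
  (0 < surface_measure (boundary Omega))%E.
Proof.
move=> [x0 Ox0]; rewrite ltNge; apply/negP => surf0.
have /nbhs_rVP[e e0 eO] : nbhs x0 Omega by exact: open_nbhs_nbhs.
pose rho := e / 2; have rho0 : 0 < rho by rewrite divr_gt0.
pose Q := ccube (uncons_rV x0).2 rho.
have QO y : Q y -> Omega (cons_rV (x0 0 ord0, y)).
  move=> Qy; apply: eO => j; have [k ->|->] := unliftP ord0 j; last first.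
    by rewrite cons_rV0 subrr normr0.
  rewrite cons_rVS /=; have := Qy k; rewrite /= in_itv/= !mxE /rho => /andP[h1 h2].
  by rewrite ltr_norml; apply/andP; split; lra.
pose C : R := 4 ^+ n / unit_ball_vol n.
have C0 : 0 < C by rewrite divr_gt0 ?exprn_gt0// unit_ball_vol_gt0.
(* A covering of cost below [d] projects to cubes of total volume at most [C * d], half the volume
   of [Q]. *)
pose d := (2 * rho) ^+ n / (2 * C).
have d0 : 0 < d.
  rewrite /d; apply: divr_gt0; last by rewrite mulr_gt0.
  by apply: exprn_gt0; rewrite mulr_gt0.
have : (hausdorff_delta n 1 (boundary Omega) < d%:E)%E.
  apply: (@le_lt_trans _ _ 0%E); last by rewrite lte_fin.
  by apply: le_trans surf0; exact: (@hausdorff_delta_le R n.+1 n 1 _ ltr01).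
move=> /ereal_inf_lt[_ [F [mF FO] <-]] sumF.
have size_lty i : (hausdorff_size n 1 (F i) < +oo)%E.
  apply: (@le_lt_trans _ _ d%:E); last by rewrite ltry.
  apply: le_trans (ltW sumF).
  rewrite -[leLHS]adde0 (nneseriesD1 (n := i))//; last by move=> *; exact: hausdorff_size_ge0.
  by rewrite leeD2l//; apply: nneseries_ge0 => *; exact: hausdorff_size_ge0.
have cubeP i : exists G : set 'rV[R]_n, [/\ measurable G,
    (forall p, F i p -> G (uncons_rV p).2) &
    (lebesgue_rV n G <= C%:E * hausdorff_size n 1 (F i))%E].
  have [F0|/set0P[x Fx]] := eqVneq (F i) set0.
    exists set0; split => //; first by rewrite F0.
    by rewrite measure0; apply: mule_ge0; [rewrite lee_fin ltW|exact: hausdorff_size_ge0].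
  have [l [l0 Fl lE]] := hausdorff_size_ccube Fx (size_lty i).
  by exists (ccube (uncons_rV x).2 l); split => //; [exact: measurable_ccube|rewrite lE].
pose G i := projT1 (cid (cubeP i)).
have GP i := projT2 (cid (cubeP i)).
have QG : Q `<=` \bigcup_i G i.
  move=> y Qy; have [s sO] := line_meets_boundary (QO _ Qy).
  have [i _ Fi] := FO _ sO; exists i => //.
  have [_ /(_ _ Fi) + _] := GP i.
  by rewrite cons_rVK.
have : (lebesgue_rV n Q <= \sum_(i <oo) lebesgue_rV n (G i))%E.
  apply: measure_sigma_subadditive => //; last exact: measurable_ccube.
  by move=> i; have [] := GP i.
have sumG : (\sum_(i <oo) lebesgue_rV n (G i) <= C%:E * d%:E)%E.
  apply: (@le_trans _ _ (\sum_(i <oo) (C%:E * hausdorff_size n 1 (F i)))%E).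
    apply: lee_nneseries => [i _ _|i _]; first exact: measure_ge0.
    by have [] := GP i.
  rewrite nneseriesZl//; last by move=> *; exact: hausdorff_size_ge0.
  by rewrite lee_pmul2l// ?ltW//.
move=> /le_trans/(_ sumG); have /= -> := lebesgue_ccube (uncons_rV x0).2 (ltW rho0).
rewrite -EFinM lee_fin /d leNgt (_ : C * _ = (2 * rho) ^+ n / 2); last by field; rewrite gt_eqF.
by rewrite ltr_pdivrMr// ltr_pMr ?ltr1n// exprn_gt0 ?mulr_gt0.
Qed.

End surface_positive.

Section constant_H1.
Context {R : realType} {n : nat}.
Local Notation leb := (lebesgue_rV n.+1).
Variable Omega : set 'rV[R]_n.+1.

Lemma test_function_partial_supp i (f : 'rV[R]_n.+1 -> R) :
  test_function Omega f -> exists K, [/\ compact K, K `<=` Omega,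
    (forall x, ~ K x -> f x = 0) & forall x, ~ K x -> partial i f x = 0].
Proof.
move=> [sf [K [cK KO f0]]]; exists K; split => // x Kx.
have oK : open (~` K).
  apply: closed_openC; apply: compact_closed => //; exact: norm_hausdorff.
have xK : nbhs x (~` K) by exact: open_nbhs_nbhs.
rewrite /partial -(@derive_cst _ _ R^o 0 x (delta_mx 0 i)).
apply: near_eq_derive.
by apply: filterS xK => y /f0.
Qed.

Lemma test_function_bounded i (f : 'rV[R]_n.+1 -> R) :
  test_function Omega f -> exists C K, [/\ 0 <= K,
    (forall x, `|f x| <= C), (forall x, `|partial i f x| <= C) &
    (forall x, ~ ccube 0 K x -> f x = 0 /\ partial i f x = 0)].
Proof.
move=> tf; have [K [cK KO f0 p0]] := test_function_partial_supp i tf.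
have [sf _] := tf; have [cf _] := sf [::]; have [cp _] := sf [:: i].
have bnd (g : 'rV[R]_n.+1 -> R) : continuous g -> (forall x, ~ K x -> g x = 0) ->
    exists C, 0 <= C /\ forall x, `|g x| <= C.
  move=> cg g0.
  have : compact (g @` K).
    by apply: continuous_compact => //; exact: continuous_subspaceT.
  move=> /compact_bounded[M [_ HM]]; exists (`|M| + 1); split; first by rewrite addr_ge0.
  move=> x; have [Kx|nKx] := pselect (K x); last by rewrite g0// normr0 addr_ge0.
  by apply: (HM (`|M| + 1)); [rewrite (le_lt_trans (ler_norm _))// ltrDl|exists x].
have [C1 [C10 H1]] := bnd f cf f0; have [C2 [C20 H2]] := bnd (partial i f) cp p0.
have [M M0 HM] := bounded_set_coord (compact_bounded cK).
exists (C1 + C2), M; split; first exact: ltW.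
- by move=> x; apply: le_trans (H1 x) _; rewrite lerDl.
- by move=> x; apply: le_trans (H2 x) _; rewrite lerDr.
- move=> x xM; have nK : ~ K x.
    by move=> /HM H; apply: xM => j; rewrite /= in_itv/= mxE sub0r add0r -ler_norml.
  by rewrite f0// p0.
Qed.

(** The constant 1 is the test function that produces the domain average. That its weak gradient is
    0 means that partial derivatives of test functions have integral 0. *)
Lemma H1_cst1 : measurable Omega -> (leb Omega < +oo)%E ->
  H1 Omega (fun=> 1) (fun=> 0).
Proof.
move=> mO Oy.
have ic (c : R) : leb.-integrable Omega (fun=> c%:E).
  by apply: measurable_bounded_integrable => //; exact: bounded_cst.
split.
- split; first exact: measurable_cst.
  by have := ic (1 ^+ 2).
- move=> i; split; first by under eq_fun do rewrite mxE; exact: measurable_cst.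
  by under eq_fun do rewrite mxE; exact: ic.
move=> i f tf.
under [in RHS]eq_Rintegral => x _ do rewrite mxE mul0r.
rewrite Rintegral_cst// mul0r oppr0.
have [C [K [K0 fC pC f0]]] := test_function_bounded i tf.
have [L [cL LO _ p0]] := test_function_partial_supp i tf.
have [sf _] := tf; have [cp _] := sf [:: i]; have [_ df] := sf [::].
rewrite Rintegral_mkcond.
rewrite (_ : _ \_ Omega = partial i f); last first.
  apply/funext => x; rewrite patchE mul1r; case: ifPn => //.
  rewrite notin_setE => Ox; rewrite p0// => /LO; exact: Ox.
rewrite /Rintegral.
have -> : (\int[leb]_x (partial i f x)%:E = 0)%E; last by [].
apply: (@integral_partial0 _ _ i f (partial i f) C K) => // x.
Qed.

End constant_H1.

(** * Paths in the domain of a nonnegative form *)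

Section nonneg_form.
Context {R : realType} (V : lmodType R).
Implicit Types (H : V -> Prop) (a : V -> V -> R).

(** The laws are required on [H] only, since the integrals behind the forms obey them only for
    square integrable functions. Definiteness is absent because null functions are not divided
    out. *)
Record nonneg_form H a : Prop := {
  form_lin : forall c v w, H v -> H w -> H (c *: v + w) ;
  form_linl : forall c v w x, H v -> H w -> H x ->
    a (c *: v + w) x = c * a v x + a w x ;
  form_sym : forall v w, H v -> H w -> a v w = a w v ;
  form_ge0 : forall v, H v -> 0 <= a v v }.

Variables (H : V -> Prop) (a : V -> V -> R).
Hypothesis ha : nonneg_form H a.

Let H_lin := form_lin ha.
Let a_lin := form_linl ha.
Let a_sym := form_sym ha.
Let a_ge0 := form_ge0 ha.

Lemma form0l x : H x -> a 0 x = 0.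
Proof.
by move=> Hx; rewrite -(scale0r x) (form_scale H_lin a_lin)// mul0r.
Qed.

Lemma form_domB v w : H v -> H w -> H (v - w).
Proof.
move=> Hv Hw; rewrite (_ : v - w = (-1) *: w + v); last by rewrite scaleN1r addrC.
exact: H_lin.
Qed.

(** Young's inequality for [v] and for its opposite; it takes the place of the Cauchy-Schwarz
    inequality. *)
Lemma form_norm_le v w (e : R) : 0 < e -> H v -> H w ->
  2 * `|a v w| <= e * a v v + e^-1 * a w w.
Proof.
move=> e0 Hv Hw.
have h1 := form_double_le H_lin a_lin a_sym a_ge0 e0 Hv Hw.
have HN : H ((-1) *: v) by exact: form_domZ.
have h2 := form_double_le H_lin a_lin a_sym a_ge0 e0 HN Hw.
have sc x : H x -> a ((-1) *: v) x = - a v x.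
  by move=> Hx; rewrite (form_scale H_lin a_lin)// mulN1r.
move: h2; rewrite (sc w Hw) (sc _ HN) (a_sym Hv HN) (sc v Hv) opprK => h2.
by have [|] := ger0P (a v w); lra.
Qed.

Lemma form_subl v w x : H v -> H w -> H x -> a (v - w) x = a v x - a w x.
Proof.
move=> Hv Hw Hx; rewrite (_ : v - w = (-1) *: w + v); last by rewrite scaleN1r addrC.
by rewrite a_lin// mulN1r addrC.
Qed.

Lemma form_cvg T (F : set_system T) (FF : ProperFilter F) (g : T -> V) v w :
  (forall t, H (g t)) -> H v -> H w ->
  a (g t - v) (g t - v) @[t --> F] --> (0 : R) ->
  a (g t) w @[t --> F] --> a v w.
Proof.
move=> Hg Hv Hw gv; apply/cvgrPdist_le => e e0.
have w1 : 0 < a w w + 1 by rewrite ltr_wpDl// a_ge0.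
pose c := e / (a w w + 1); have c0 : 0 < c by rewrite divr_gt0.
have ce : c * a w w <= e by rewrite /c mulrAC ler_pdivrMr// ler_wpM2l ?ltW// ltrDl.
move/cvgrPdist_le : gv => /(_ (e * c)); rewrite mulr_gt0// => /(_ isT).
apply: filterS => t; rewrite sub0r normrN ger0_norm ?a_ge0//; last exact: form_domB.
move=> h; rewrite distrC -form_subl//.
have := form_norm_le (e := c^-1) _ (form_domB (Hg t) Hv) Hw.
rewrite invr_gt0 => /(_ c0); rewrite invrK => h2.
have : c^-1 * a (g t - v) (g t - v) <= e by rewrite ler_pdivrMl// mulrC.
lra.
Qed.

Lemma form_cvg_diag T (F : set_system T) (FF : ProperFilter F) (g : T -> V) v :
  (forall t, H (g t)) -> H v ->
  a (g t - v) (g t - v) @[t --> F] --> (0 : R) ->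
  a (g t) (g t) @[t --> F] --> a v v.
Proof.
move=> Hg Hv gv.
have E t : a (g t) (g t) = a (g t - v) (g t - v) + 2 * a (g t) v - a v v.
  by rewrite (form_subE H_lin a_lin a_sym)//; ring.
under eq_fun do rewrite E.
have c2 : 2 * a (g t) v @[t --> F] --> 2 * a v v by apply: cvgMr; exact: form_cvg.
have L : a (g t - v) (g t - v) + 2 * a (g t) v - a v v @[t --> F] -->
    0 + 2 * a v v - a v v.
  exact: (cvgB (cvgD gv c2) (@cvg_cst _ (a v v) _ F _)).
have E0 : 0 + 2 * a v v - a v v = a v v by ring.
by rewrite E0 in L.
Qed.

(** This is the equicontinuity hypothesis of [energy_le]. It is uniform in [r] because [K] bounds
    [a (z r) (z r)] for all [r]. *)
Lemma form_path_equicontinuous (z : R -> V) (K : R) : (forall t, H (z t)) ->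
  (forall t, a (z t) (z t) <= K) ->
  (forall t, a (z s - z t) (z s - z t) @[s --> t] --> (0 : R)) ->
  forall q (e : R), 0 < e -> exists2 d : R, 0 < d & forall q', `|q' - q| < d ->
    forall r, `|a (z r) (z q') - a (z r) (z q)| <= e.
Proof.
move=> Hz zK cz q e e0.
have K0 : 0 <= K by apply: le_trans (zK 0); exact: a_ge0.
pose c := e / (K + 1); have c0 : 0 < c by rewrite divr_gt0 ?ltr_wpDl.
have cK : c * K <= e by rewrite /c mulrAC ler_pdivrMr ?ltr_wpDl// ler_wpM2l ?ltW// ltrDl.
move/cvgrPdist_le : (cz q) => /(_ (e * c)); rewrite mulr_gt0// => /(_ isT).
move=> [d /= d0 Hd]; exists d => // q' qq' r.
have := Hd q'; rewrite /= distrC => /(_ qq').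
rewrite sub0r normrN ger0_norm; last by apply/a_ge0/form_domB.
move=> h; rewrite !(a_sym (Hz r))// -form_subl//.
have := form_norm_le (e := c^-1) _ (form_domB (Hz q') (Hz q)) (Hz r).
rewrite invr_gt0 => /(_ c0); rewrite invrK => h2.
have : c^-1 * a (z q' - z q) (z q' - z q) <= e by rewrite ler_pdivrMl// mulrC.
have : c * a (z r) (z r) <= c * K by rewrite ler_wpM2l// ltW.
lra.
Qed.

Lemma form_sum (I : finType) (c : I -> R) (w : I -> V) x : H x ->
  (forall j, H (w j)) ->
  H (\sum_j c j *: w j) /\ a (\sum_j c j *: w j) x = \sum_j c j * a (w j) x.
Proof.
move=> Hx Hw; pose K (v : V) (r : R) := H v /\ a v x = r.
apply: (@big_rec2 _ _ K) => [|j v r _ [Hv av]].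
  by split; [exact: form_dom0 Hx|exact: form0l].
by split; [exact: H_lin|rewrite a_lin// av].
Qed.

End nonneg_form.

(** * Strongly measurable paths *)

Section strongly_measurable.
Context {R : realType} (V : lmodType R).
Local Notation mu := (@lebesgue_measure R).
Variables (H : V -> Prop) (q : V -> V -> R).
Hypothesis hq : nonneg_form H q.

Definition simple_path (g : R -> V) : Prop :=
  exists (N : nat) (A : 'I_N -> set (measurableTypeR R)) (w : 'I_N -> V),
    [/\ (forall j, measurable (A j)), (forall j, H (w j)) &
        g = (fun t => \sum_j (\1_(A j) t : R) *: w j)].

(** Bochner measurability of [z] in the seminorm of [q]: simple paths converge on [D], and [z] is 0
    elsewhere, so that measurability holds on the whole line. *)
Variables (z : R -> V) (g : nat -> R -> V) (D : set (measurableTypeR R)).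
Hypothesis mD : measurable D.
Hypothesis Hz : forall t, H (z t).
Hypothesis gs : forall k, simple_path (g k).
Hypothesis zg : forall t, D t ->
  q (g k t - z t) (g k t - z t) @[k --> \oo] --> (0 : R).
Hypothesis z0 : forall t, ~ D t -> z t = 0.

Let H0 : H 0. Proof. exact: (form_dom0 (form_lin hq) (Hz 0)). Qed.

Let Hg k t : H (g k t).
Proof. by have [N [A [w [_ Hw ->]]]] := gs k;
  have [] := form_sum hq (fun j => \1_(A j) t) H0 Hw. Qed.

Section dominated_form.
(** As [q] dominates [a], the approximation in [q], the squared H^1 norm in the application, carries
    over to [a]. *)
Variables (a : V -> V -> R) (C : R).
Hypothesis ha : nonneg_form H a.
Hypothesis aC : forall v, H v -> a v v <= C * q v v.

Let zga t : D t -> a (g k t - z t) (g k t - z t) @[k --> \oo] --> (0 : R).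
Proof.
move=> Dt; apply: (@squeeze_cvgr _ _ _ _ (cst 0) (fun k => C * q (g k t - z t) (g k t - z t))).
- apply: nearW => k; have Hk : H (g k t - z t) by exact: (form_domB hq).
  by rewrite (form_ge0 ha)//= aC.
- exact: cvg_cst.
- by rewrite -[X in _ --> X](mulr0 C); apply: cvgMr; exact: zg.
Qed.

Let measurable_path_form k w : H w -> measurable_fun [set: measurableTypeR R] (fun t => a (g k t) w).
Proof.
move=> Hw; have [N [A [v [mA Hv ->]]]] := gs k.
under eq_fun do rewrite (form_sum ha _ Hw Hv).2.
apply: measurable_sum => j; by apply: measurable_funM => //; exact: measurable_indic.
Qed.

Let extend (f : R -> R) (f_ : nat -> R -> R) :
  (forall k, measurable_fun [set: measurableTypeR R] (f_ k)) ->
  (forall t, D t -> f_ k t @[k --> \oo] --> f t) ->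
  (forall t, ~ D t -> f t = 0) -> measurable_fun [set: measurableTypeR R] f.
Proof.
move=> mf cf f0.
have := @measurable_cvg_off_null _ _ R f_ f (~` D) (measurableC mD) mf.
rewrite setCK => /(_ _) mfD.
rewrite (_ : f = fun t => f t * \1_D t); last first.
  apply/funext => t; rewrite indicE; case: (asboolP (D t)) => Dt.
    by rewrite mem_set// mulr1.
  by rewrite f0// mul0r.
by apply: mfD => t Dt; apply: cf; exact: contrapT.
Qed.

Lemma measurable_form_path w : H w ->
  measurable_fun [set: measurableTypeR R] (fun t => a (z t) w).
Proof.
move=> Hw; apply: (@extend _ (fun k t => a (g k t) w)).
- by move=> k; exact: measurable_path_form.
- by move=> t Dt; apply: (form_cvg ha) => //; exact: zga.
- move=> t Dt; rewrite z0// (form0l ha)//.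
Qed.

Lemma measurable_form_path_diag :
  measurable_fun [set: measurableTypeR R] (fun t => a (z t) (z t)).
Proof.
apply: (@extend _ (fun k t => a (g k t) (g k t))).
- move=> k; have [N [A [v [mA Hv gE]]]] := gs k.
  have -> : (fun t => a (g k t) (g k t)) = fun t => \sum_j \1_(A j) t * a (g k t) (v j).
    apply/funext => t; rewrite {1}gE (form_sum ha _ (Hg k t) Hv).2.
    by apply: eq_bigr => j _; rewrite (form_sym ha).
  apply: measurable_sum => j; apply: measurable_funM; first exact: measurable_indic.
  exact: measurable_path_form.
- by move=> t Dt; apply: (form_cvg_diag ha) => //; exact: zga.
- move=> t Dt; rewrite z0// (form0l ha)//.
Qed.

Variable I : set (measurableTypeR R).
Hypothesis mI : measurable I.
Hypothesis muI : (mu I < +oo)%E.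

Hypothesis C0 : 0 <= C.
Hypothesis int_q : mu.-integrable I (fun t => (q (z t) (z t))%:E).

Lemma integrable_form_path_diag : mu.-integrable I (fun t => (a (z t) (z t))%:E).
Proof.
apply: (@le_integrable _ _ _ mu I mI _ (fun t => C%:E * (q (z t) (z t))%:E)%E).
- apply/measurable_EFinP.
  by apply: measurable_funTS; exact: measurable_form_path_diag.
- move=> t It; rewrite -EFinM lee_fin !ger0_norm ?(form_ge0 ha)//; first exact: aC.
  by rewrite mulr_ge0// (form_ge0 hq).
- exact: integrableZl.
Qed.

Lemma integrable_form_path w : H w -> mu.-integrable I (fun t => (a (z t) w)%:E).
Proof.
move=> Hw.
apply: (@le_integrable _ _ _ mu I mI _ (fun t => (a (z t) (z t))%:E + (a w w)%:E)%E).
- apply/measurable_EFinP.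
  by apply: measurable_funTS; exact: measurable_form_path.
- move=> t It; rewrite -EFinD lee_fin.
  rewrite [leRHS]ger0_norm; last by apply: addr_ge0; exact: (form_ge0 ha).
  have := form_norm_le ha ltr01 (Hz t) Hw; rewrite invr1 !mul1r.
  have : 0 <= `|a (z t) w| by [].
  lra.
- apply: integrableD => //; first exact: integrable_form_path_diag.
  by apply: measurable_bounded_integrable => //; exact: bounded_cst.
Qed.

(* [W] enumerates the sums of subfamilies of the coefficients of each [g k]. *)
Lemma form_path_dense : exists W : nat -> V, (forall i, H (W i)) /\
  forall t (e : R), 0 < e -> exists i, a (z t - W i) (z t - W i) < e.
Proof.
have /choice[d hd] : forall k, exists d : {N : nat &
    (('I_N -> set (measurableTypeR R)) * ('I_N -> V))%type},
    (forall j, H ((projT2 d).2 j)) /\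
    g k = (fun t => \sum_j (\1_((projT2 d).1 j) t : R) *: (projT2 d).2 j).
  by move=> k; have [N [A [w [_ Hw gE]]]] := gs k; exists (existT _ N (A, w)).
pose N k := projT1 (d k).
pose A k : 'I_(N k) -> set (measurableTypeR R) := (projT2 (d k)).1.
pose w k : 'I_(N k) -> V := (projT2 (d k)).2.
have Hw k j : H (w k j) by have [+ _] := hd k; exact.
have gE k : g k = (fun t => \sum_j (\1_(A k j) t : R) *: w k j) by have [] := hd k.
pose val (p : nat * seq bool) := \sum_j ((nth false p.2 (j : 'I_(N p.1)))%:R : R) *: w p.1 j.
pose W i := if @unpickle (nat * seq bool)%type i is Some p then val p else 0.
have Hval p : H (val p) by have [] := form_sum ha (fun j : 'I_(N p.1) => (nth false p.2 j)%:R) H0 (Hw p.1).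
exists W; split; first by rewrite /W => i; case: unpickle.
move=> t e e0; have [Dt|Dt] := pselect (D t); last first.
  (* Off [D] the path is 0, and so is the sum over the empty subfamily. *)
  exists (pickle (0%N, [::] : seq bool)); rewrite /W pickleK z0// /val.
  rewrite big1 ?subr0; last by move=> j _; rewrite nth_nil scale0r.
  by rewrite (form0l ha).
have /cvgrPdist_lt/(_ e e0) [k _ /(_ k (leqnn k))] := zga Dt.
rewrite /= sub0r normrN => hk.
(* The list records which of the sets [A k i] contain [t]; the default [false] of [insub] is never
   met, since [j < N k]. *)
exists (pickle (k, mkseq (fun j => if insub j is Some i then t \in A k i else false) (N k))).
have -> : W (pickle (k, mkseq (fun j => if insub j is Some i then t \in A k i else false) (N k))) = g k t.
  rewrite /W pickleK gE /val /=; apply: eq_bigr => j _.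
  by rewrite nth_mkseq// valK indicE.
have Hd : H (g k t - z t) by exact: (form_domB hq).
rewrite -opprB -scaleN1r.
rewrite (form_scale (form_lin ha) (form_linl ha))//; last exact: (form_domZ (form_lin ha)).
rewrite (form_sym ha)//; last exact: (form_domZ (form_lin ha)).
rewrite (form_scale (form_lin ha) (form_linl ha))// !mulN1r opprK.
by apply: le_lt_trans hk; exact: ler_norm.
Qed.

End dominated_form.
End strongly_measurable.

(** * Forms on H^1 *)

Section weighted_form.
Context d (T : measurableType d) (R : realType) (mu : {measure set T -> \bar R}).
Variable D : set T.
Hypothesis mD : measurable D.
Local Notation sq := (square_integrable mu D).

Definition wform (k f g : T -> R) : R := \int[mu]_(x in D) (k x * (f x * g x)).

Variables (k : T -> R) (M : R).
Hypothesis mk : measurable_fun D k.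
Hypothesis kM : forall x, `|k x| <= M.
Hypothesis k0 : forall x, 0 <= k x.

Lemma integrable_wform f g : sq f -> sq g ->
  mu.-integrable D (fun x => (k x * (f x * g x))%:E).
Proof.
by move=> sf sg; apply: (integrableM_bounded mD mk kM); exact: square_integrableM.
Qed.

Lemma wform_nonneg : @nonneg_form R (T -> R^o) sq (wform k).
Proof.
split.
- by move=> c f g sf sg; exact: square_integrableD.
- move=> c f g h sf sg sh; rewrite /wform.
  rewrite -RintegralZl//; last exact: integrable_wform.
  rewrite -RintegralD//; last 2 first.
  + exact: (integrableZl mD c (integrable_wform sf sh)).
  + exact: integrable_wform.
  by apply: eq_Rintegral => x _; rewrite -[(c *: f + g) x]/(c * f x + g x); ring.
- by move=> f g _ _; apply: eq_Rintegral => x _; ring.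
- move=> f _; apply: Rintegral_ge0 => x _.
  by rewrite mulr_ge0// -expr2 sqr_ge0.
Qed.

Lemma wform_le f : sq f -> wform k f f <= M * wform (cst 1) f f.
Proof.
move=> sf; have i1 : mu.-integrable D (fun x => (1 * (f x * f x))%:E).
  by under eq_fun do rewrite mul1r; exact: square_integrableM.
rewrite -RintegralZl//; apply: le_Rintegral => //; first exact: integrable_wform.
  exact: (integrableZl mD M i1).
move=> x _; rewrite mul1r ler_wpM2r// -?expr2 ?sqr_ge0//.
exact: le_trans (ler_norm _) (kM x).
Qed.

End weighted_form.

Section form_algebra.
Context {R : realType} (V : lmodType R).
Implicit Types (H : V -> Prop) (a b : V -> V -> R).

Lemma nonneg_formD H a b : nonneg_form H a -> nonneg_form H b ->
  nonneg_form H (fun v w => a v w + b v w).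
Proof.
move=> ha hb; split.
- exact: form_lin ha.
- by move=> c v w x *; rewrite (form_linl ha)// (form_linl hb)//; ring.
- by move=> v w *; rewrite (form_sym ha)// (form_sym hb).
- by move=> v Hv; rewrite addr_ge0// ?(form_ge0 ha)// (form_ge0 hb).
Qed.

Lemma nonneg_formZ H a (c : R) : 0 <= c -> nonneg_form H a ->
  nonneg_form H (fun v w => c * a v w).
Proof.
move=> c0 ha; split.
- exact: form_lin ha.
- by move=> e v w x *; rewrite (form_linl ha)//; ring.
- by move=> v w *; rewrite (form_sym ha).
- by move=> v Hv; rewrite mulr_ge0// (form_ge0 ha).
Qed.

Lemma nonneg_form_sum H (I : finType) (a : I -> V -> V -> R) :
  (forall c v w, H v -> H w -> H (c *: v + w)) ->
  (forall i, nonneg_form H (a i)) ->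
  nonneg_form H (fun v w => \sum_i a i v w).
Proof.
move=> Hlin ha; split => //.
- move=> c v w x *; rewrite mulr_sumr -big_split/=; apply: eq_bigr => i _.
  by rewrite (form_linl (ha i)).
- by move=> v w *; apply: eq_bigr => i _; rewrite (form_sym (ha i)).
- by move=> v Hv; apply: sumr_ge0 => i _; rewrite (form_ge0 (ha i)).
Qed.

(** Linearity of [L] is asked only as far as [b'] can see it: the trace is linear up to surface-null
    sets only. *)
Lemma nonneg_form_pullback (V' : lmodType R) (H' : V' -> Prop)
    (b' : V' -> V' -> R)
    H (L : V -> V') :
  (forall c v w, H v -> H w -> H (c *: v + w)) ->
  (forall v, H v -> H' (L v)) ->
  (forall c v w x, H v -> H w -> H' x ->
    b' (L (c *: v + w)) x = b' (c *: L v + L w) x) ->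
  nonneg_form H' b' -> nonneg_form H (fun v w => b' (L v) (L w)).
Proof.
move=> Hlin HL Lb hb; split => //.
- move=> c v w x Hv Hw Hx; rewrite Lb//; last exact: HL.
  by rewrite (form_linl hb)//; exact: HL.
- by move=> v w Hv Hw; rewrite (form_sym hb)//; exact: HL.
- by move=> v Hv; rewrite (form_ge0 hb)//; exact: HL.
Qed.

End form_algebra.

Section H1_forms.
Context {R : realType} {n : nat}.
Local Notation E := 'rV[R]_n.+1.
Local Notation leb := (lebesgue_rV n.+1).
Local Notation surf := surface_measure.
Variable Omega : set E.
Hypothesis mOmega : measurable Omega.
Hypothesis Omega_fin : (leb Omega < +oo)%E.

(** A function together with a representative of its weak gradient, which the function determines
    only up to null sets. *)
Definition pairs : lmodType R := ((E -> R^o) * (E -> E))%type.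

Definition H1_pair (z : pairs) : Prop := H1 Omega z.1 z.2.

Lemma bounded_square_integrable (f : E -> R) (C : R) : measurable_fun Omega f ->
  (forall x, `|f x| <= C) -> square_integrable leb Omega f.
Proof.
move=> mf fC; split => //.
have C0 : 0 <= C by apply: le_trans (fC 0).
have i1 : leb.-integrable Omega (EFin \o cst (1 : R)).
  by apply: measurable_bounded_integrable => //; exact: bounded_cst.
have := @integrableM_bounded _ _ _ _ _ _ _ (C ^+ 2) mOmega (measurable_funX 2 mf) _ i1.
rewrite /cst /=; under eq_fun do rewrite mulr1.
by apply => x; rewrite normrX lerXn2r// nnegrE.
Qed.

Lemma H1_pair_lin c v w : H1_pair v -> H1_pair w -> H1_pair (c *: v + w).
Proof.
move: v w => [u Du] [v Dv] [/= su sDu wu] [/= sv sDv wv]; split => /=.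
- exact: square_integrableD.
- move=> i; under eq_fun do rewrite !mxE.
  exact: square_integrableD.
move=> i f tf.
have [C [K [K0 fC pC _]]] := test_function_bounded i tf.
have [sf _] := tf; have [cf _] := sf [::]; have [cp _] := sf [:: i].
have sqf : square_integrable leb Omega f.
  apply: (bounded_square_integrable _ fC).
  by apply: measurable_funTS; exact: measurable_continuous_rV.
have sqp : square_integrable leb Omega (partial i f).
  apply: (bounded_square_integrable _ pC).
  by apply: measurable_funTS; exact: measurable_continuous_rV.
have expand (p q r : E -> R) : square_integrable leb Omega p ->
    square_integrable leb Omega q -> square_integrable leb Omega r ->
    \int[leb]_(x in Omega) ((c * p x + q x) * r x) =
    c * \int[leb]_(x in Omega) (p x * r x) + \int[leb]_(x in Omega) (q x * r x).
  move=> sp sq sr; have ip := square_integrableM mOmega sp sr.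
  rewrite -RintegralZl// -RintegralD//; last 2 first.
  + exact: (integrableZl mOmega c ip).
  + exact: square_integrableM.
  by apply: eq_Rintegral => x _; ring.
rewrite [LHS](expand u v (partial i f))// wu// wv//.
under [in RHS]eq_Rintegral => x _ do rewrite !mxE.
by rewrite (expand (fun x => Du x 0 i) (fun x => Dv x 0 i) f)//; ring.
Qed.

Definition grad_form (k : E -> R) (z w : pairs) : R :=
  \sum_i wform leb Omega k (fun x => z.2 x 0 i) (fun x => w.2 x 0 i).

Definition value_form (k : E -> R) (z w : pairs) : R :=
  wform leb Omega k z.1 w.1.

Definition H1_form (z w : pairs) : R :=
  value_form (cst 1) z w + grad_form (cst 1) z w.

Section bounded_weight.
Variables (k : E -> R) (M : R).
Hypothesis mk : measurable_fun Omega k.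
Hypothesis kM : forall x, `|k x| <= M.
Hypothesis k0 : forall x, 0 <= k x.

Lemma grad_form_nonneg : nonneg_form H1_pair (grad_form k).
Proof.
apply: nonneg_form_sum => [|i]; first exact: H1_pair_lin.
apply: (nonneg_form_pullback (L := fun z : pairs => (fun x => z.2 x 0 i) : E -> R^o))
  (wform_nonneg leb mOmega mk kM k0).
- exact: H1_pair_lin.
- by move=> v [].
- move=> c v w x _ _ _; congr (wform _ _ _ _ _); apply/funext => y.
  by rewrite /= !mxE.
Qed.

Lemma value_form_nonneg : nonneg_form H1_pair (value_form k).
Proof.
apply: (nonneg_form_pullback (L := fun z : pairs => z.1)) (wform_nonneg leb mOmega mk kM k0).
- exact: H1_pair_lin.
- by move=> v [].
- by [].
Qed.

Lemma grad_formE z w : H1_pair z -> H1_pair w ->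
  \int[leb]_(x in Omega) (k x * dot (z.2 x) (w.2 x)) = grad_form k z w.
Proof.
move=> [_ sz _] [_ sw _].
have int i := @integrable_wform _ _ _ leb _ mOmega _ _ mk kM _ _ (sz i) (sw i).
rewrite /grad_form /wform.
transitivity (fine (\sum_i \int[leb]_(x in Omega) (k x * (z.2 x 0 i * w.2 x 0 i))%:E)%E).
  rewrite -(integral_sum mOmega)//; congr fine; apply: eq_integral => x _.
  by rewrite sumEFin /dot mulr_sumr.
rewrite -sum_fine//= => i _; exact: (integrable_fin_num mOmega).
Qed.

End bounded_weight.

Lemma H1_form_nonneg : nonneg_form H1_pair H1_form.
Proof.
have m1 : measurable_fun Omega (cst (1 : R)) by exact: measurable_cst.
have b1 (x : E) : `|cst (1 : R) x| <= 1 by rewrite /= normr1.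
apply: nonneg_formD.
  exact: (value_form_nonneg m1 b1 (fun=> ler01)).
exact: (grad_form_nonneg m1 b1 (fun=> ler01)).
Qed.

Lemma H1_sqnormE z : H1_pair z -> H1_sqnorm Omega z.1 z.2 = (H1_form z z)%:E.
Proof.
move=> Hz; have [s1 s2 _] := Hz.
have m1 : measurable_fun Omega (cst (1 : R)) by exact: measurable_cst.
have b1 (x : E) : `|cst (1 : R) x| <= 1 by rewrite /= normr1.
have i2 i := @integrable_wform _ _ _ leb _ mOmega _ _ m1 b1 _ _ (s2 i) (s2 i).
have i1 := @integrable_wform _ _ _ leb _ mOmega _ _ m1 b1 _ _ s1 s1.
have id : leb.-integrable Omega (fun x => (dot (z.2 x) (z.2 x))%:E).
  rewrite (_ : (fun x => _) = fun x => (\sum_i (1 * (z.2 x 0 i * z.2 x 0 i))%:E)%E).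
    by apply: integrable_sum => // i _; exact: i2.
  by apply/funext => x; rewrite sumEFin; congr EFin; apply: eq_bigr => i _; rewrite mul1r.
have iu : leb.-integrable Omega (fun x => (z.1 x ^+ 2)%:E) by case: s1.
rewrite /H1_sqnorm /H1_form /value_form -(grad_formE m1 b1)// /wform.
under eq_integral do rewrite EFinD.
rewrite integralD// EFinD; congr (_ + _)%E; rewrite /Rintegral fineK.
- by apply: eq_integral => x _; rewrite mul1r expr2.
- by apply: (integrable_fin_num mOmega); exact: i1.
- by apply: eq_integral => x _; rewrite mul1r.
- by apply: (integrable_fin_num mOmega); under eq_fun do rewrite mul1r.
Qed.

Section energy_form.
Variable tr : (E -> R) -> E -> R.
Hypothesis htr : trace_operator Omega tr.
Hypothesis mbd : measurable (boundary Omega).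
Variables (B : R) (k : E -> R) (M : R).
Hypothesis B0 : 0 <= B.
Hypothesis mk : measurable_fun Omega k.
Hypothesis kM : forall x, `|k x| <= M.
Hypothesis k0 : forall x, 0 <= k x.

Definition trace_form (z w : pairs) : R :=
  wform surf (boundary Omega) (cst 1) (tr z.1) (tr w.1).

Definition robin_form (z w : pairs) : R := grad_form k z w + B * trace_form z w.

Lemma trace_form_nonneg : nonneg_form H1_pair trace_form.
Proof.
have m1 : measurable_fun (boundary Omega) (cst (1 : R)) by exact: measurable_cst.
have b1 (x : E) : `|cst (1 : R) x| <= 1 by rewrite /= normr1.
apply: (nonneg_form_pullback (L := fun z : pairs => tr z.1 : E -> R^o))
  (wform_nonneg surf mbd m1 b1 (fun=> ler01)).
- exact: H1_pair_lin.
- by move=> v /(trace_L2 htr).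
- move=> c v w x Hv Hw _; apply: eq_Rintegral_ae.
  have := trace_linear htr c Hv Hw; apply: filterS => y trE By.
  by rewrite -[(c *: v + w).1]/(fun y => c * v.1 y + w.1 y) trE.
Qed.

Lemma robin_form_nonneg : nonneg_form H1_pair robin_form.
Proof.
apply: nonneg_formD; first exact: grad_form_nonneg kM _.
exact: nonneg_formZ trace_form_nonneg.
Qed.

(** The boundedness of [kappa] and of the trace; this is the domination that carries the Bochner
    approximation over to the form of the equation. *)
Lemma robin_form_le : exists2 C, 0 <= C &
  forall z, H1_pair z -> robin_form z z <= C * H1_form z z.
Proof.
have [Ct HCt] := trace_bounded htr.
have m1 : measurable_fun Omega (cst (1 : R)) by exact: measurable_cst.
have b1 (x : E) : `|cst (1 : R) x| <= 1 by rewrite /= normr1.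
have M0 : 0 <= M by apply: le_trans (kM 0).
(* The trace constant comes without a sign. *)
exists (M + B * Num.max Ct 0); first by rewrite addr_ge0// mulr_ge0// le_max lexx orbT.
move=> z Hz; have [s1 s2 _] := Hz; rewrite mulrDl -mulrA; apply: lerD.
  have g1 : grad_form k z z <= M * grad_form (cst 1) z z.
    by rewrite mulr_sumr; apply: ler_sum => i _; exact: (wform_le mOmega mk).
  apply: le_trans g1 _; rewrite ler_wpM2l// lerDr.
  exact: (form_ge0 (value_form_nonneg m1 b1 (fun=> ler01))).
rewrite ler_wpM2l//.
have tz := trace_L2 htr Hz.
have : trace_form z z <= Ct * H1_form z z.
  have := HCt _ _ Hz; rewrite H1_sqnormE// -EFinM -lee_fin; apply: le_trans.
  rewrite /trace_form /wform /Rintegral; have [_ it] := tz.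
  rewrite (eq_integral (fun x => (tr z.1 x ^+ 2)%:E)); last by move=> x _; rewrite mul1r expr2.
  by rewrite fineK//; exact: (integrable_fin_num mbd).
move/le_trans; apply; rewrite ler_wpM2r ?le_max ?lexx//.
exact: (form_ge0 H1_form_nonneg).
Qed.

End energy_form.

End H1_forms.

(** * The solution as a measurable path *)

Section bounded_version.
Context {R : realType} {n : nat}.
Local Notation leb := (lebesgue_rV n.+1).

(** Truncation between [c] and the larger of [M] and [c] turns the almost everywhere bounds into
    bounds at every point without changing integrals over [Omega]. *)
Lemma bounded_version (Omega : set 'rV[R]_n.+1) (f : 'rV[R]_n.+1 -> R) (c : R) :
  essentially_bounded Omega f -> {ae leb, forall x, Omega x -> c <= f x} ->
  exists (f' : 'rV[R]_n.+1 -> R) (M : R), [/\ measurable_fun Omega f', (forall x, `|f' x| <= M),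
    (forall x, c <= f' x) & {ae leb, forall x, Omega x -> f x = f' x}].
Proof.
move=> [mf [M fM]] cf.
exists (fun x => Num.min (Num.max (f x) c) (Num.max M c)), (`|c| + `|M|); split.
- apply: measurable_minr; last exact: measurable_cst.
  by apply: measurable_maxr => //; exact: measurable_cst.
- move=> x; have := ler_norm c; have := ler_norm M.
  have := ler_norm (- c); have := ler_norm (- M); rewrite !normrN => *.
  rewrite ler_norml /Num.min /Num.max.
  have : 0 <= `|c| by []. have : 0 <= `|M| by [].
  by case: (ltP M c) => ?; case: (ltP (f x) c) => ?; case: ltP => ? *; apply/andP; split; lra.
- move=> x; rewrite /Num.min /Num.max.
  by case: (ltP M c) => ?; case: (ltP (f x) c) => ?; case: ltP => ?; lra.
- apply: filterS2 fM cf => x fM cf Ox.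
  have := ler_norm (f x); have := fM Ox; have := cf Ox; rewrite /Num.min /Num.max.
  by case: (ltP M c) => ?; case: (ltP (f x) c) => ?; case: ltP => ?; lra.
Qed.

End bounded_version.

Section clamp.
Context {R : realType}.

(* Extends a path given on [[0, tf]] to the line, so that the hypotheses of
   [energy_le] hold at all times. *)
Definition clamp (tf r : R) : R := Num.min (Num.max r 0) tf.

Lemma clamp_ge0 tf r : 0 <= tf -> 0 <= clamp tf r.
Proof. by move=> tf0; rewrite /clamp le_min le_max lexx orbT. Qed.

Lemma clamp_le tf r : clamp tf r <= tf.
Proof. by rewrite /clamp ge_min lexx orbT. Qed.

Lemma clamp_id tf r : 0 <= r <= tf -> clamp tf r = r.
Proof. by move=> /andP[r0 rtf]; rewrite /clamp (max_idPl r0) (min_idPl rtf). Qed.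

Lemma clamp_idem tf r : 0 <= tf -> clamp tf (clamp tf r) = clamp tf r.
Proof. by move=> tf0; rewrite clamp_id// clamp_ge0// clamp_le. Qed.

Lemma continuous_clamp tf : continuous (clamp tf).
Proof.
move=> t; apply/cvgrPdist_le => e e0; exists e => //= s st.
apply: le_trans (ltW st); rewrite /clamp /Num.min /Num.max ler_norml.
have := ler_norm (t - s); have := ler_norm (- (t - s)); rewrite normrN.
by case: (ltP t 0) => ?; case: (ltP s 0) => ?; case: ltP => ?; case: ltP => ?;
   move=> *; apply/andP; split; lra.
Qed.

End clamp.

(** * The solution as a continuous path in L^2 *)

Section L2_path.
Context {R : realType} {n : nat}.
Local Notation E := 'rV[R]_n.+1.
Local Notation leb := (lebesgue_rV n.+1).
Variable Omega : set E.
Hypothesis mOmega : measurable Omega.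
Variables (k : E -> R) (M : R).
Hypothesis mk : measurable_fun Omega k.
Hypothesis kM : forall x, `|k x| <= M.
Hypothesis k0 : forall x, 0 <= k x.
Variable u : R -> E -> R^o.
Hypothesis Cu : C0_L2 Omega u.
Variable tf : R.
Hypothesis tf0 : 0 <= tf.

Let hb := wform_nonneg leb mOmega mk kM k0.
Local Notation b := (wform leb Omega k).

Lemma square_integrable_clamp t : square_integrable leb Omega (u (clamp tf t)).
Proof. by apply: Cu.1; exact: clamp_ge0. Qed.

Lemma L2_path_cvg t : b (u (clamp tf s) - u (clamp tf t))
  (u (clamp tf s) - u (clamp tf t)) @[s --> t] --> (0 : R).
Proof.
have M0 : 0 <= M by apply: le_trans (kM 0).
pose h s := \int[leb]_(x in Omega) ((u (clamp tf s) x - u (clamp tf t) x) ^+ 2).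
apply: (@squeeze_cvgr _ _ _ _ (cst 0) (fun s => M * h s)).
- apply: nearW => s; rewrite /cst /=.
  have sq : square_integrable leb Omega (u (clamp tf s) - u (clamp tf t)).
    by apply: (form_domB hb); exact: square_integrable_clamp.
  rewrite (form_ge0 hb)//=; apply: le_trans (wform_le mOmega mk kM sq) _.
  rewrite le_eqVlt; apply/orP; left; apply/eqP; congr (_ * _).
  by apply: eq_Rintegral => x _; rewrite mul1r -expr2.
- exact: cvg_cst.
rewrite -[X in _ --> X](mulr0 M); apply: cvgMr.
have /= C := Cu.2 _ (clamp_ge0 t tf0).
(* [clamp tf] has its values in the half-line, so continuity within the half-line is enough. *)
apply: (cvg_trans _ C) => A; rewrite /= /within /= !near_simpl => HA.
have := @continuous_clamp _ tf t _ HA; rewrite /= !near_simpl.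
by apply: filterS => s; apply; exact: clamp_ge0.
Qed.

Lemma L2_path_bounded : exists K, forall t,
  b (u (clamp tf t)) (u (clamp tf t)) <= K.
Proof.
have c : continuous (fun t => b (u (clamp tf t)) (u (clamp tf t))).
  move=> t; apply: (@form_cvg_diag _ _ _ _ hb _ (nbhs t) _).
  - by move=> s; exact: square_integrable_clamp.
  - exact: square_integrable_clamp.
  - exact: L2_path_cvg.
have [K HK] := continuous_bounded_itvcc 0 tf c.
exists K => t; have := HK (clamp tf t); rewrite clamp_ge0// clamp_le clamp_idem//.
by move=> /(_ isT); apply: le_trans; exact: ler_norm.
Qed.

Lemma L2_path_continuous (w : E -> R^o) : square_integrable leb Omega w ->
  continuous (fun t => b (u (clamp tf t)) w).
Proof.
move=> sw t; apply: (@form_cvg _ _ _ _ hb _ (nbhs t) _) => //.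
- by move=> s; exact: square_integrable_clamp.
- exact: square_integrable_clamp.
- exact: L2_path_cvg.
Qed.

Lemma L2_path_form_bounded : exists K, forall r q,
  `|b (u (clamp tf r)) (u (clamp tf q))| <= K.
Proof.
have [K HK] := L2_path_bounded; exists K => r q.
have := form_norm_le hb ltr01 (square_integrable_clamp r) (square_integrable_clamp q).
rewrite invr1 !mul1r; have := HK r; have := HK q; lra.
Qed.

Lemma L2_path_equicontinuous q (e : R) : 0 < e -> exists2 d : R, 0 < d &
  forall q', `|q' - q| < d -> forall r,
    `|b (u (clamp tf r)) (u (clamp tf q')) - b (u (clamp tf r)) (u (clamp tf q))| <= e.
Proof.
have [K HK] := L2_path_bounded.
apply: (form_path_equicontinuous hb (z := fun r => u (clamp tf r)) _ HK).
- exact: square_integrable_clamp.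
- exact: L2_path_cvg.
Qed.

End L2_path.

(** * The solution as a measurable path in H^1 *)

Section Bochner_path.
Context {R : realType} {n : nat}.
Local Notation E := 'rV[R]_n.+1.
Local Notation leb := (lebesgue_rV n.+1).
Local Notation mu := (@lebesgue_measure R).
Variable Omega : set E.
Hypothesis mOmega : measurable Omega.
Hypothesis Omega_fin : (leb Omega < +oo)%E.
Variables (tf : R) (u : R -> E -> R^o) (Du : R -> E -> E).
Hypothesis uL2 : L2_H1 Omega tf u Du.
Local Notation I := (`]0, tf[%classic : set (measurableTypeR R)).
Local Notation H1p := (H1_pair Omega).
Let hq := H1_form_nonneg mOmega Omega_fin.

Lemma simple_path_H1 (s : R -> E -> R) (Ds : R -> E -> E) : H1_simple Omega s Ds ->
  simple_path H1p (fun t => (s t, Ds t) : pairs).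
Proof.
move=> [N [A [w [Dw [mA Hw -> ->]]]]].
exists N, A, (fun j => (w j, Dw j) : pairs); split => //.
apply/funext => t; rewrite [RHS]surjective_pairing; congr pair.
- by rewrite raddf_sum /= fct_sumE; apply/funext.
- by rewrite raddf_sum /= fct_sumE; apply/funext.
Qed.

(** The path [(u, Du)] is set to 0 at the null set of times where it leaves H^1 or the approximation
    fails. All exceptional times disappear, and [(u, Du)] is recovered almost everywhere. *)
Lemma L2_H1_path : exists (z : R -> pairs) (D : set (measurableTypeR R))
    (g : nat -> R -> pairs),
  [/\ (forall t, H1p (z t)),
      {ae mu, forall t, I t -> z t = (u t, Du t)},
      mu.-integrable I (fun t => (H1_form Omega (z t) (z t))%:E) &
      [/\ measurable D, (forall k, simple_path H1p (g k)),
          (forall t, D t -> H1_form Omega (g k t - z t) (g k t - z t)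
             @[k --> \oo] --> (0 : R)) &
          forall t, ~ D t -> z t = 0]].
Proof.
have [H1u [s [Ds [simple cvgs]]] fin] := uL2.
have [N [mN N0 HN]] := negligibleU H1u cvgs.
pose D := I `\` N.
have HD t : D t -> H1 Omega (u t) (Du t) /\
    H1_sqnorm Omega (fun x => u t x - s k t x)
      (fun x => Du t x - Ds k t x) @[k --> \oo] --> 0%E.
  move=> [It Nt]; split.
    by apply: contrapT => h; apply: Nt; apply: HN; left => /= /(_ It).
  by apply: contrapT => h; apply: Nt; apply: HN; right => /= /(_ It).
pose g k t : pairs := (s k t, Ds k t).
have gs k : simple_path H1p (g k) by exact: simple_path_H1.
pose z t : pairs := if t \in D then (u t, Du t) else 0.
have H0 : H1p 0.
  exact: (@form_dom0 _ _ H1p (H1_pair_lin mOmega Omega_fin) (fun=> 1, fun=> 0)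
    (H1_cst1 mOmega Omega_fin)).
have Hz t : H1p (z t).
  by rewrite /z; case: ifPn => // /set_mem/HD[].
have zE : {ae mu, forall t, I t -> z t = (u t, Du t)}.
  exists N; split => // t /= /not_implyP[It zt]; apply: contrapT => Nt; apply: zt.
  by rewrite /z mem_set.
have mD : measurable D by apply: measurableD.
have z0 t : ~ D t -> z t = 0 by move=> Dt; rewrite /z memNset.
have Hg k t : H1p (g k t).
  have [N1 [A [w [_ Hw ->]]]] := gs k.
  by have [] := form_sum hq (fun j => \1_(A j) t) H0 Hw.
have zg t : D t -> H1_form Omega (g k t - z t) (g k t - z t) @[k --> \oo] --> (0 : R).
  move=> Dt; have [_ /fine_cvg] := HD _ Dt; apply: cvg_trans.
  apply: near_eq_cvg; apply: nearW => k /=.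
  have -> : H1_sqnorm Omega (fun x => u t x - s k t x) (fun x => Du t x - Ds k t x) =
      H1_sqnorm Omega (z t - g k t).1 (z t - g k t).2 by rewrite /z mem_set.
  rewrite H1_sqnormE//=; last exact: (form_domB hq).
  rewrite !(form_subl hq)//; try exact: (form_domB hq).
  by rewrite !(form_sym hq _ (form_domB hq _ _))// !(form_subl hq)//; ring.
exists z, D, g; split => //.
apply/integrableP; split.
  apply/measurable_EFinP; apply: measurable_funTS.
  apply: (measurable_form_path_diag hq mD Hz gs zg z0 hq (C := 1)).
  by move=> v _; rewrite mul1r.
rewrite (@eq_integral_ae _ _ _ mu I _ (fun t => H1_sqnorm Omega (u t) (Du t)))//.
apply: filterS zE => t zt It.
rewrite gee0_abs ?lee_fin ?(form_ge0 hq)// -H1_sqnormE// zt//.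
Qed.

End Bochner_path.

(** * Energy inequality for the heat equation *)

Section heat_energy.
Context {R : realType} {n : nat}.
Local Notation E := 'rV[R]_n.+1.
Local Notation leb := (lebesgue_rV n.+1).
Local Notation surf := surface_measure.
Local Notation mu := (@lebesgue_measure R).
Variable Omega : set E.
Hypothesis mOmega : measurable Omega.
Hypothesis Omega_fin : (leb Omega < +oo)%E.
Hypothesis mbd : measurable (boundary Omega).
Variable tr : (E -> R) -> E -> R.
Hypothesis htr : trace_operator Omega tr.
Variables (sigma kappa sigma' kappa' : E -> R) (Ms Mk : R).
Hypothesis msigma' : measurable_fun Omega sigma'.
Hypothesis sigma'M : forall x, `|sigma' x| <= Ms.
Hypothesis sigma'0 : forall x, 0 <= sigma' x.
Hypothesis sigmaE : {ae leb, forall x, Omega x -> sigma x = sigma' x}.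
Hypothesis mkappa' : measurable_fun Omega kappa'.
Hypothesis kappa'M : forall x, `|kappa' x| <= Mk.
Hypothesis kappa'0 : forall x, 0 <= kappa' x.
Hypothesis kappaE : {ae leb, forall x, Omega x -> kappa x = kappa' x}.
Variable B : R.
Hypothesis B0 : 0 <= B.
Variables (u : R -> E -> R) (Du : R -> E -> E).
Hypothesis hu : heat_solution Omega sigma kappa tr B u Du.
Variable tf : R.
Hypothesis tf0 : 0 < tf.
Local Notation I := (`]0, tf[%classic : set (measurableTypeR R)).
Local Notation H1p := (H1_pair Omega).
Local Notation a := (robin_form Omega tr B kappa').
Local Notation ucl t := (u (clamp tf t) : E -> R^o).
Local Notation y t w := (wform leb Omega sigma' (ucl t) w).

Let ha := robin_form_nonneg mOmega Omega_fin htr mbd B0 mkappa' kappa'M kappa'0.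

Lemma clamp_itv t : I t -> clamp tf t = t.
Proof. by rewrite /= in_itv/= => /andP[t0 ttf]; rewrite clamp_id// !ltW. Qed.

Section weak.
Variable z : R -> @pairs R n.
Hypothesis Hz : forall t, H1p (z t).
Hypothesis zE : {ae mu, forall t, I t -> z t = (u t, Du t)}.

(** The equation in the form that [weak_derivative_FTC] expects: the support of [eta] cuts the
    half-line down to []0, tf[], and there the clamped path and the bounded versions of the
    coefficients can be inserted. *)
Lemma heat_weak w eta : H1p w -> smoothR eta ->
  (exists a b, [/\ 0 < a, b < tf & forall t, ~ (a <= t <= b) -> eta t = 0]) ->
  \int[mu]_(t in `]0, tf[) (derive1 eta t * y t w.1) =
  \int[mu]_(t in `]0, tf[) (eta t * a (z t) w).
Proof.
move=> Hw seta [c [d [c0 dtf eta0]]].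
have test : time_test_function eta.
  split; first exact: smoothR_derivable.
  by exists c, d; split => // t tcd; apply: eta0; move: tcd; rewrite in_itv/= => /negP.
have eta'0 t : ~ (c <= t <= d) -> derive1 eta t = 0.
  move=> tcd; rewrite derive1E -(@derive_cst _ _ R^o 0 t 1).
  apply: near_eq_derive.
  have : open (~` `[c, d]%classic : set R) by apply: closed_openC; exact: interval_closed.
  have tc : (~` `[c, d]%classic : set R) t by rewrite /= in_itv.
  move=> oC; have : nbhs t (~` `[c, d]%classic : set R) by exact: open_nbhs_nbhs.
  apply: filterS => s /=.
  by rewrite in_itv/= => scd; exact: eta0.
have sub : `]0, tf[%classic `<=` (`]0, +oo[%classic : set R).
  by move=> t /=; rewrite !in_itv/= andbT => /andP[].
have notI t : ~ `]0, tf[%classic t -> ~ (c <= t <= d).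
  rewrite /= in_itv/= => nI /andP[ct td]; apply: nI.
  by rewrite (lt_le_trans c0 ct) (le_lt_trans td dtf).
have := heat_eq hu Hw test => /eqP; rewrite addrC subr_eq0 => /eqP eqn.
have lhs : \int[mu]_(t in `]0, +oo[)
      (derive1 eta t * \int[leb]_(x in Omega) (sigma x * u t x * w.1 x)) =
    \int[mu]_(t in `]0, tf[) (derive1 eta t * y t w.1).
  rewrite (Rintegral_support sub); last by move=> t _ /notI/eta'0 ->; rewrite mul0r.
  apply: eq_Rintegral => t /set_mem It; congr (_ * _); rewrite (clamp_itv It).
  apply: eq_Rintegral_ae; apply: filterS sigmaE => x sx Ox.
  by rewrite sx// mulrA.
rewrite -lhs -eqn (Rintegral_support sub); last first.
  by move=> t _ /notI/eta0 ->; rewrite mul0r.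
apply: eq_Rintegral_ae; have [N [mN N0 HN]] := zE; exists N; split => //.
apply: subset_trans HN => t /=; apply: contra_not.
move=> zt It; congr (_ * _); rewrite /robin_form; congr (_ + B * _).
- rewrite -(grad_formE mOmega mkappa' kappa'M)// zt//=.
  apply: eq_Rintegral_ae; apply: filterS kappaE => x kx Ox.
  by rewrite kx.
- by rewrite /trace_form /wform zt//=; apply: eq_Rintegral => x _; rewrite mul1r.
Qed.

End weak.

(** The weight [omega] in the integrated equation serves twice: it is 1 for the energy inequality
    and exp(beta r) for the error. *)
Theorem heat_energy : exists z : R -> @pairs R n,
  [/\ (forall t, H1p (z t)),
      {ae mu, forall t, I t -> z t = (u t, Du t)},
      (forall w, H1p w -> mu.-integrable I (fun t => (a (z t) w)%:E)) /\
      mu.-integrable I (fun t => (a (z t) (z t))%:E),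
      (forall w (omega : R -> R) t1 t2, H1p w -> smoothR omega ->
         0 <= t1 -> t1 < t2 -> t2 < tf ->
         omega t2 * y t2 w.1 - omega t1 * y t1 w.1 =
         \int[mu]_(t in `]t1, t2])
           (derive1 omega t * y t w.1 - omega t * a (z t) w)) &
      forall T, 0 < T -> T < tf ->
        (\int[mu]_(t in `]0%R, T[) (a (z t) (z t))%:E <=
         (2^-1 * wform leb Omega sigma' (u 0) (u 0))%:E)%E].
Proof.
have [z [D [g [Hz zE intq [mD gs zg z0]]]]] := L2_H1_path mOmega Omega_fin (heat_L2_H1 hu tf0).
have hq := H1_form_nonneg mOmega Omega_fin.
have [C C0 aC] := robin_form_le mOmega Omega_fin htr mbd B0 mkappa' kappa'M.
have mI : measurable I by exact: measurable_itv.
have muI : (mu I < +oo)%E by rewrite lebesgue_measure_itv/=; case: ifP => _; rewrite ltry.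
have int_a w : H1p w -> mu.-integrable I (fun t => (a (z t) w)%:E).
  by move=> Hw; exact: (integrable_form_path hq mD Hz gs zg z0 ha aC mI muI C0 intq).
have int_aa := integrable_form_path_diag hq mD Hz gs zg z0 ha aC mI C0 intq.
have [W [HW Wd]] := form_path_dense hq Hz gs zg z0 ha aC.
have [theta [th1 th2 th3 th4]] := @smooth_step_exists R.
have Cu := heat_C0_L2 hu.
have hb := wform_nonneg leb mOmega msigma' sigma'M sigma'0.
have FTC w (omega : R -> R) t1 t2 : H1p w -> smoothR omega ->
    0 <= t1 -> t1 < t2 -> t2 < tf ->
    omega t2 * y t2 w.1 - omega t1 * y t1 w.1 =
    \int[mu]_(t in `]t1, t2]) (derive1 omega t * y t w.1 - omega t * a (z t) w).
  move=> Hw so; apply: (weak_derivative_FTC th1 th2 th3 th4 (G := fun t => a (z t) w)) => //.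
  - by apply: (L2_path_continuous mOmega msigma' sigma'M sigma'0 Cu (ltW tf0)); case: Hw.
  - exact: int_a.
  - by move=> eta seta supp; exact: (heat_weak Hz zE).
exists z; split => // T T0 Ttf.
pose F t s := wform leb Omega sigma' (ucl t) (ucl s).
have [K HK] := L2_path_form_bounded mOmega msigma' sigma'M sigma'0 Cu (ltW tf0).
have sq t := square_integrable_clamp Cu (ltW tf0) t.
have -> : wform leb Omega sigma' (u 0) (u 0) = F 0 0.
  by rewrite /F clamp_id// lexx ltW.
apply: (@energy_le R pairs H1p a (form_lin ha) (form_linl ha) (form_sym ha) (form_ge0 ha)
  z Hz tf (fun t w => y t w.1) F K W) => //.
- move=> w t1 t2 Hw t10 t12 t2f.
  (* The constant weight gives the increment of the inner product itself. *)
  have := FTC w (fun=> 1) t1 t2 Hw (smoothR_cst 1) t10 t12 t2f.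
  rewrite !mul1r => ->.
  rewrite -mulN1r -RintegralZl//; last first.
    apply: (integrableS _ _ _ (int_a _ Hw)) => //.
    move=> t /=; rewrite !in_itv/= => /andP[h1 h2].
    by rewrite (le_lt_trans t10 h1) (le_lt_trans h2 t2f).
  by apply: eq_Rintegral => t _; rewrite derive1_cst mul0r mul1r sub0r mulN1r.
- by move=> r q; exact: (form_sym hb).
- exact: (L2_path_equicontinuous mOmega msigma' sigma'M sigma'0 Cu (ltW tf0)).
- by move=> t; exact: (form_ge0 hb).
- have [N [mN N0 HN]] := zE; exists N; split => //; apply: subset_trans HN => s /=;
    apply: contra_not.
  by move=> zs Is t t0 ttf; rewrite /F zs//= (clamp_itv Is).
- by move=> t e _; exact: Wd.
Qed.

End heat_energy.

(** * The error of the averaged solution *)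

(** For [p > 0] the optimal [l] is the square root of [q / p], written [s / p] below; both terms
    then equal [s]. *)
Lemma le_sqrt_of_weighted_bound (R : realType) (x p q : R) : 0 <= p -> 0 < q ->
  (forall l, 0 < l -> x <= l * p + l^-1 * q) -> x <= 2 * Num.sqrt (p * q).
Proof.
rewrite le_eqVlt => /predU1P[<-|p0] q0 H.
  rewrite mul0r sqrtr0 mulr0 leNgt; apply/negP => x0.
  (* For [p = 0] the infimum over [l] is not attained; this [l] would give [x <= x / 2]. *)
  have := H (2 * q / x); rewrite divr_gt0 ?mulr_gt0// => /(_ isT).
  have -> : (2 * q / x)^-1 * q = x / 2 by field; rewrite !gt_eqF.
  by rewrite mulr0 add0r; lra.
set s := Num.sqrt _; have s0 : 0 < s by rewrite sqrtr_gt0 mulr_gt0.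
have s2 : s ^+ 2 = p * q by rewrite sqr_sqrtr// mulr_ge0// ltW.
apply: le_trans (H (s / p) _) _; first by rewrite divr_gt0.
rewrite divfK ?gt_eqF// invf_div mulrAC -s2 expr2 mulfK ?gt_eqF//.
by rewrite mulr_natl mulr2n.
Qed.

Lemma derive1_expR (R : realType) (c x : R) :
  derive1 (fun x => expR (c * x)) x = c * expR (c * x).
Proof.
have da : is_derive x 1 (fun x : R => c * x) c.
  have di : is_derive x 1 (c *: (@idfun R)) (c *: 1) by exact: is_deriveZ.
  by move: di; rewrite -[c *: 1]/(c * 1) mulr1.
rewrite derive1E.
have := @is_derive1_comp _ expR (fun x : R => c * x) x _ _ (is_derive_expR _) da.
by move=> /@derive_val ->; rewrite mulrC.
Qed.

Lemma Rintegral_expR_le (R : realType) (c t : R) : 0 < c -> 0 < t ->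
  \int[@lebesgue_measure R]_(r in `]0, t]) expR (c * r) <= c^-1 * expR (c * t).
Proof.
move=> c0 t0; have sm := smoothR_expR c.
have cexp : continuous (fun r => expR (c * r)) by exact: smoothR_continuous.
rewrite Rintegral_itv_obnd_cbnd; last first.
  apply: (integrableS _ _ _ (integrable_itvcc 0 t cexp)) => //.
  by move=> x /=; rewrite !in_itv/= => /andP[/ltW -> ->].
have := Rintegral_derive sm t0.
under eq_Rintegral => x _ do rewrite derive1_expR.
rewrite RintegralZl//; last exact: integrable_itvcc.
rewrite mulr0 expR0 => h; rewrite -(ler_pM2l c0) h mulVKf ?gt_eqF//.
by rewrite lerBlDr lerDl.
Qed.

Section heat_content.
Context {R : realType} {n : nat}.
Local Notation E := 'rV[R]_n.+1.
Local Notation leb := (lebesgue_rV n.+1).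
Local Notation surf := surface_measure.
Local Notation mu := (@lebesgue_measure R).
Variable Omega : set E.
Hypothesis hOmega : lipschitz_domain Omega.
Variable tr : (E -> R) -> E -> R.
Hypothesis htr : trace_operator Omega tr.
Variables sigma kappa : E -> R.
Hypothesis hcoef : admissible_coefficients Omega sigma kappa.

Let mOmega : measurable Omega.
Proof. by apply: measurable_open_rV; case: hOmega. Qed.

Let mbd : measurable (boundary Omega).
Proof.
apply: measurableD; first by apply: measurable_closed_rV; exact: closed_closure.
by apply: measurable_open_rV; exact: open_interior.
Qed.

Let V := volume Omega.
Let gamma := surface_to_volume Omega.

(** At volume 0 the inverse is 0 by convention, and the mean of [sigma] would be 0 instead of 1. *)
Lemma volume_gt0 : 0 < volume Omega.
Proof.
have := sigma_mean hcoef; rewrite lt_neqAle fine_ge0// andbT => mean.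
apply/eqP => v0; move: mean; rewrite -v0 invr0 mul0r => /eqP.
by rewrite eq_sym oner_eq0.
Qed.

(** [fine] sends [+oo] to 0, so the positivity of the volume excludes infinite measure. *)
Lemma lebesgue_volume : leb Omega = (volume Omega)%:E.
Proof.
have := volume_gt0; rewrite /volume.
by case: (leb Omega) (measure_ge0 leb Omega) => //=; rewrite ltxx.
Qed.

Let Omega_fin : (leb Omega < +oo)%E.
Proof. by rewrite lebesgue_volume ltry. Qed.

Lemma sigma_integral : \int[leb]_(x in Omega) sigma x = volume Omega.
Proof.
have := sigma_mean hcoef => /(congr1 (fun x => volume Omega * x)).
by rewrite mulVKf ?mulr1// gt_eqF// volume_gt0.
Qed.

Let one : @pairs R n := (fun=> 1, fun=> 0).

Let H1one : H1_pair Omega one.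
Proof. exact: H1_cst1. Qed.

Lemma trace_one : {ae surf, forall x, boundary Omega x -> tr (fun=> 1) x = 1}.
Proof.
apply: (trace_restriction htr H1one).
by apply: continuous_subspaceT; exact: cst_continuous.
Qed.

(** Finiteness, without which [fine] would return 0, holds because the trace of the constant 1 is
    square integrable and equals 1 almost everywhere on the boundary. *)
Lemma surface_gt0 : 0 < surface Omega.
Proof.
have [oO _ O0 bO _] := hOmega.
apply: fine_gt0; rewrite surface_measure_boundary_gt0//=.
have [_ /integrableP[_]] := trace_L2 htr H1one.
rewrite (@eq_integral_ae _ _ _ surf _ _ (fun=> 1%:E)); last first.
  by apply: filterS trace_one => x tx Bx; rewrite /one/= tx// expr1n normr1.
have -> : (\int[surf]_(x in boundary Omega) 1%:E = surf (boundary Omega))%E.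
  by rewrite integral_cst// mul1e.
by [].
Qed.

Lemma surface_to_volume_gt0 : 0 < surface_to_volume Omega.
Proof. by rewrite divr_gt0// ?surface_gt0// volume_gt0. Qed.

Lemma kappa_ge1 : {ae leb, forall x, Omega x -> 1 <= kappa x}.
Proof.
have := ess_inf_le leb (fun x => if x \in Omega then (kappa x)%:E else +oo%E).
rewrite (kappa_inf hcoef); apply: filterS => x + Ox.
by rewrite mem_set// lee_fin.
Qed.

Lemma sigma_ge0 : {ae leb, forall x, Omega x -> 0 <= sigma x}.
Proof.
have [c c0] := sigma_pos hcoef; apply: filterS => x h Ox.
by apply: le_trans (h Ox); exact: ltW.
Qed.

Variables (psi : E -> R) (Dpsi : E -> E).
Hypothesis hpsi : phi_potential Omega sigma kappa tr psi Dpsi.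
Variable B : R.
Hypothesis B0 : 0 < B.
Variables (u : R -> E -> R) (Du : R -> E -> E).
Hypothesis hu : heat_solution Omega sigma kappa tr B u Du.

Let beta := B * gamma.
Let beta0 : 0 < beta. Proof. by rewrite mulr_gt0// surface_to_volume_gt0. Qed.

Lemma domain_average_continuous tf : 0 <= tf ->
  continuous (fun t => domain_average Omega sigma u (clamp tf t)).
Proof.
move=> tf0 t.
have [s' [Ms [ms sM s0 sE]]] := bounded_version (sigma_Linfty hcoef) sigma_ge0.
have c := L2_path_continuous mOmega ms sM s0 (heat_C0_L2 hu) tf0 (w := fun=> 1) _.
have {}c : continuous (fun t => wform leb Omega s' (u (clamp tf t)) (fun=> 1)).
  by apply: c; case: H1one.
rewrite (_ : (fun t => _) = fun t => V^-1 * wform leb Omega s' (u (clamp tf t)) (fun=> 1)).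
  by apply: cvgMr; exact: c.
apply/funext => r; congr (_ * _); apply: eq_Rintegral_ae.
by apply: filterS sE => x sx Ox; rewrite sx// mulr1.
Qed.

Lemma domain_average_at0 : domain_average Omega sigma u 0 = 1.
Proof.
rewrite -(sigma_mean hcoef); congr (_ * _); apply: eq_Rintegral_ae.
by apply: filterS (heat_init hu) => x ux Ox; rewrite ux// mulr1.
Qed.

Section weighted_bound.
Variables (t l : R).
Hypothesis t0 : 0 < t.
Hypothesis l0 : 0 < l.

(** The integrated equation with test function 1 and weight [om r = exp(beta r)] expresses the
    error, times the volume and [om t], as the integral of [om r * (c * m r)], which is bounded
    pointwise in [r] by Young's inequality. *)
Lemma average_error_weighted :
  domain_average Omega sigma u t - expR (- (beta * t)) <=
  l * (B * (Num.sqrt V)^-1 * phi Omega kappa Dpsi / (4 * beta)) +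
  l^-1 * (B * Num.sqrt V / 4).
Proof.
have V0 := volume_gt0; rewrite -/V in V0.
have [s' [Ms [ms sM s0 sE]]] := bounded_version (sigma_Linfty hcoef) sigma_ge0.
have [k' [Mk [mk kM k1 kE]]] := bounded_version (kappa_Linfty hcoef) kappa_ge1.
have k0 x : 0 <= k' x by apply: le_trans (k1 x).
(* The energy inequality is used on []0, t + 1[], which covers the closed end of []0, t]] and still
   ends before [tf]. *)
have tf0 : 0 < t + 2 by rewrite addr_gt0.
have [z [Hz zE [int_a int_aa] FTC energy]] := heat_energy mOmega Omega_fin mbd htr
  ms sM s0 sE mk kM k0 kE (ltW B0) hu tf0.
set tf := t + 2 in tf0 z Hz zE int_a int_aa FTC energy.
pose Y r := wform leb Omega s' (u (clamp tf r)) (fun=> 1).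
pose a := robin_form Omega tr B k'.
pose p : @pairs R n := (psi, Dpsi).
have Hp : H1_pair Omega p by exact: psi_H1 hpsi.
pose m r := grad_form Omega k' p (z r).
have hg := grad_form_nonneg mOmega Omega_fin mk kM k0.
have phiE : phi Omega kappa Dpsi = grad_form Omega k' p p.
  rewrite -(grad_formE mOmega mk kM)//; apply: eq_Rintegral_ae.
  by apply: filterS kE => x kx Ox; rewrite kx.
have t1 : t < t + 1 by rewrite ltrDl.
have t2 : t < tf by rewrite ltrDl.
have := energy (t + 1) (addr_gt0 t0 ltr01); rewrite ltrD2l ltr1n => /(_ isT).
have -> : wform leb Omega s' (u 0) (u 0) = V.
  rewrite /V -sigma_integral; apply: eq_Rintegral_ae.
  by apply: filterS2 sE (heat_init hu) => x sx ux Ox; rewrite ux// !mulr1 sx.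
move=> {}energy.
have sub : `]0, t]%classic `<=` (`]0, tf[%classic : set R).
  by move=> r /=; rewrite !in_itv/= => /andP[-> rt]/=; exact: le_lt_trans t2.
have int_aa' : mu.-integrable `]0, t] (fun r => (a (z r) (z r))%:E).
  by apply: (integrableS _ _ _ int_aa).
have energy' : \int[mu]_(r in `]0, t]) a (z r) (z r) <= V / 2.
  rewrite -lee_fin /Rintegral fineK; last exact: integrable_fin_num.
  rewrite mulrC; apply: le_trans energy; apply: ge0_subset_integral => //.
  - apply: (measurable_int mu); apply: (integrableS _ _ _ int_aa) => //.
    move=> r /=; rewrite !in_itv/= => /andP[-> rt]/=; apply: lt_trans rt _.
    by rewrite ltrD2l ltr1n.
  - by move=> r _; rewrite lee_fin;
      exact: (form_ge0 (robin_form_nonneg mOmega Omega_fin htr mbd (ltW B0) mk kM k0)).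
  - by move=> r /=; rewrite !in_itv/= => /andP[-> rt]/=; exact: le_lt_trans t1.
pose s := Num.sqrt V; have s_gt0 : 0 < s by rewrite sqrtr_gt0.
have sV : V = s ^+ 2 by rewrite sqr_sqrtr// ltW.
pose c := B * s; have c0 : 0 < c by rewrite mulr_gt0.
pose om r := expR (beta * r).
have Yavg r : 0 <= r <= tf -> Y r = V * domain_average Omega sigma u r.
  move=> rtf; rewrite /domain_average mulVKf ?gt_eqF// /Y clamp_id//.
  by apply: eq_Rintegral_ae; apply: filterS sE => x sx Ox; rewrite sx// mulr1.
have flux r : `]0, t]%classic r -> z r = (u r, Du r) ->
    beta * Y r - a (z r) one = c * m r.
  move=> It zr; have Hr : H1_pair Omega (u r, Du r) by rewrite -zr.
  have YE : Y r = \int[leb]_(x in Omega) (sigma x * u r x).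
    rewrite Yavg /domain_average ?mulVKf ?gt_eqF//.
    by have := sub _ It; rewrite /= in_itv/= => /andP[/ltW -> /ltW ->].
  have aE : a (z r) one = B * \int[surf]_(x in boundary Omega) tr (u r) x.
    rewrite /a /robin_form /grad_form big1 ?add0r; last first.
      move=> i _; rewrite /wform.
      under eq_Rintegral => x _ do rewrite mxE !mulr0.
      by rewrite Rintegral_cst// mul0r.
    congr (_ * _); apply: eq_Rintegral_ae; apply: filterS trace_one => x tx Bx.
    by rewrite zr/= tx// mul1r mulr1.
  have mE : m r = s^-1 * (gamma * Y r - \int[surf]_(x in boundary Omega) tr (u r) x).
    rewrite YE -(psi_eq hpsi Hr) /m zr -(grad_formE mOmega mk kM)//.
    by apply: eq_Rintegral_ae; apply: filterS kE => x kx Ox; rewrite kx.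
  by rewrite aE mE /c /beta; field; rewrite gt_eqF.
(* The Young parameter is [mm * om r]: its factor [om r] cancels the weight in front of the
   dissipation, and the factor at time [t] makes the final bound independent of [t]. *)
pose mm := l * expR (- (beta * t)); have mm0 : 0 < mm by rewrite mulr_gt0 ?expR_gt0.
pose bound r := c / 2 * (mm * phi Omega kappa Dpsi * expR (2 * beta * r) +
  mm^-1 * a (z r) (z r)).
have young r : om r * (c * m r) <= bound r.
  have e0 : 0 < om r by exact: expR_gt0.
  have := form_double_le (form_lin hg) (form_linl hg) (form_sym hg) (form_ge0 hg)
    (mulr_gt0 mm0 e0) Hp (Hz r).
  rewrite -phiE -/(m r) invfM => h.
  have ga : grad_form Omega k' (z r) (z r) <= a (z r) (z r).
    rewrite lerDl mulr_ge0 ?(ltW B0)//.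
    exact: (form_ge0 (trace_form_nonneg mOmega Omega_fin htr mbd)).
  have oe : expR (2 * beta * r) = om r ^+ 2.
    by rewrite -expRM_natl /om; congr expR; ring.
  rewrite /bound oe (_ : om r * (c * m r) = c / 2 * (om r * (2 * m r))); last by field.
  rewrite ler_wpM2l ?divr_ge0 ?(ltW c0)//.
  have -> : mm * phi Omega kappa Dpsi * om r ^+ 2 + mm^-1 * a (z r) (z r) =
    om r * (mm * om r * phi Omega kappa Dpsi + mm^-1 / om r * a (z r) (z r)).
    by field; rewrite !gt_eqF.
  rewrite ler_wpM2l ?(ltW e0)//; apply: le_trans h _; rewrite lerD2l.
  by rewrite ler_wpM2l// mulr_ge0 ?invr_ge0 ?(ltW mm0) ?(ltW e0).
have mt : measurable (`]0, t]%classic : set (measurableTypeR R)) by exact: measurable_itv.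
have int_cont (f : R -> R) : continuous f -> mu.-integrable `]0, t] (EFin \o f).
  move=> cf; apply: (integrableS _ _ _ (integrable_itvcc 0 t cf)) => //.
  by move=> x /=; rewrite !in_itv/= => /andP[/ltW -> ->].
have com : continuous om by exact/smoothR_continuous/smoothR_expR.
have cY : continuous Y.
  apply: (L2_path_continuous mOmega ms sM s0 (heat_C0_L2 hu) (ltW tf0) (w := fun=> 1)).
  by case: H1one.
have ce2 : continuous (fun r => expR (2 * beta * r)) by exact/smoothR_continuous/smoothR_expR.
have intL : mu.-integrable `]0, t] (EFin \o (fun r => derive1 om r * Y r - om r * a (z r) one)).
  have i0 : mu.-integrable `]0, t] (EFin \o (fun r => derive1 om r * Y r)).
    apply: int_cont => x; apply: cvgM; last exact: cY.
    by apply: smoothR_continuous; apply: smoothR_derive; exact: smoothR_expR.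
  have i1 : mu.-integrable `]0, t] (EFin \o (fun r => a (z r) one)).
    by apply: (integrableS _ _ _ (int_a _ H1one)).
  (* Clamping makes the exponential bounded on the whole line, as [integrableM_bounded] requires,
     and changes nothing on []0, t]]. *)
  have mcl : measurable_fun `]0, t] (fun r => om (clamp tf r)).
    apply: measurable_funTS; apply: continuous_measurable_fun => x.
    by apply: continuous_comp; [exact: continuous_clamp|exact: com].
  have clM r : `|om (clamp tf r)| <= om tf.
    by rewrite ger0_norm ?expR_ge0// ler_expR ler_pM2l// clamp_le.
  have i2 : mu.-integrable `]0, t] (EFin \o (fun r => om r * a (z r) one)).
    apply: eq_integrable (integrableM_bounded mt mcl clM i1) => //.
    by move=> r /set_mem/sub/clamp_itv -> .
  exact: (integrableB mt i0 i2).
have iA : mu.-integrable `]0, t]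
    (EFin \o (fun r => mm * phi Omega kappa Dpsi * expR (2 * beta * r))).
  exact: (integrableZl mt (mm * phi Omega kappa Dpsi) (int_cont _ ce2)).
have iB : mu.-integrable `]0, t] (EFin \o (fun r => mm^-1 * a (z r) (z r))).
  exact: (integrableZl mt mm^-1 int_aa').
have iAB : mu.-integrable `]0, t] (EFin \o (fun r =>
    mm * phi Omega kappa Dpsi * expR (2 * beta * r) + mm^-1 * a (z r) (z r))).
  exact: (integrableD mt iA iB).
have intU : mu.-integrable `]0, t] (EFin \o bound).
  exact: (integrableZl mt (c / 2) iAB).
have leU : \int[mu]_(r in `]0, t]) (derive1 om r * Y r - om r * a (z r) one) <=
    \int[mu]_(r in `]0, t]) bound r.
  apply: le_Rintegral_ae => //.
  have [N [mN N0 HN]] := zE; exists N; split => //.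
  apply: subset_trans HN => r /=; apply: contra_not => zr rt.
  rewrite derive1_expR -/(om r) mulrAC mulrC -mulrBr flux//.
  exact: (zr (sub _ rt)).
have boundE : \int[mu]_(r in `]0, t]) bound r <=
    c / 2 * (mm * phi Omega kappa Dpsi * ((2 * beta)^-1 * expR (2 * beta * t)) +
      mm^-1 * (V / 2)).
  rewrite /bound RintegralZl// ler_wpM2l ?divr_ge0 ?(ltW c0)// RintegralD//.
  rewrite RintegralZl//; last exact: int_cont.
  rewrite RintegralZl//; apply: lerD; rewrite ler_wpM2l ?invr_ge0 ?(ltW mm0)//.
    by rewrite mulr_ge0 ?(ltW mm0)// phiE (form_ge0 hg).
  by apply: Rintegral_expR_le => //; rewrite mulr_gt0.
have := FTC one _ 0 t H1one (smoothR_expR beta) (lexx 0) t0 t2.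
rewrite -/om -/(Y t) -/(Y 0) => eqn.
have := le_trans leU boundE; rewrite -[X in X <= _]eqn.
rewrite Yavg ?(ltW t0) ?(ltW t2)// Yavg ?lexx ?(ltW tf0)// domain_average_at0 mulr1.
rewrite mulr0 expR0 mul1r -/(om t) => final.
pose e := om t; have e0 : 0 < e by exact: expR_gt0.
have e1 : expR (- (beta * t)) = e^-1 by rewrite expRN.
have e2 : expR (2 * beta * t) = e ^+ 2 by rewrite -expRM_natl /e /om; congr expR; ring.
move: final; rewrite /mm e1 e2 -/e -/s sV => final.
set D := domain_average Omega sigma u t in final *.
(* Division by the volume [s ^+ 2] and the integrating factor [e] at time [t]. *)
have -> : D - e^-1 = (e * s ^+ 2)^-1 * (e * (s ^+ 2 * D) - s ^+ 2).
  by field; rewrite !gt_eqF.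
apply: le_trans (ler_wpM2l _ final) _; first by rewrite invr_ge0 mulr_ge0 ?sqr_ge0 ?(ltW e0).
rewrite le_eqVlt; apply/orP; left; apply/eqP; rewrite /c.
by field; rewrite !gt_eqF.
Qed.

End weighted_bound.
Lemma average_error_le t : 0 <= t ->
  domain_average Omega sigma u t - expR (- (beta * t)) <=
  2^-1 * Num.sqrt (phi Omega kappa Dpsi * B / gamma).
Proof.
rewrite le_eqVlt => /predU1P[<-|t0].
  by rewrite domain_average_at0 mulr0 oppr0 expR0 subrr mulr_ge0// sqrtr_ge0.
have V0 := volume_gt0; rewrite -/V in V0.
have s0 : 0 < Num.sqrt V by rewrite sqrtr_gt0.
have g0 : 0 < gamma by exact: surface_to_volume_gt0.
have phi0 : 0 <= phi Omega kappa Dpsi.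
  (* [kappa] is at least 1 only almost everywhere; the maximum with 1 is nonnegative at every
     point. *)
  rewrite /phi -(@eq_Rintegral_ae _ _ _ leb _
    (fun x => Num.max (kappa x) 1 * dot (Dpsi x) (Dpsi x))).
    apply: Rintegral_ge0 => x _; rewrite mulr_ge0 ?le_max ?ler01 ?orbT//.
    by apply: sumr_ge0 => i _; rewrite -expr2 sqr_ge0.
  by apply: filterS kappa_ge1 => x k1 Ox; rewrite (max_idPl (k1 Ox)).
apply: le_trans (le_sqrt_of_weighted_bound _ _ (fun l l0 => average_error_weighted t0 l0)) _.
- apply: divr_ge0; last by rewrite mulr_ge0// ltW.
  by apply: mulr_ge0 => //; rewrite divr_ge0// ltW.
- by rewrite divr_gt0 ?mulr_gt0.
(* The volume cancels in the product. The square root takes 1/4 out, and the factor 2 of the optimal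
   bound leaves 1/2. *)
have -> : B / Num.sqrt V * phi Omega kappa Dpsi / (4 * beta) * (B * Num.sqrt V / 4) =
    (phi Omega kappa Dpsi * B / gamma) * (4^-1) ^+ 2.
  by rewrite /beta; field; rewrite !gt_eqF.
rewrite sqrtrM; last first.
  by apply: divr_ge0; [rewrite mulr_ge0// ltW|exact: ltW].
by rewrite sqrtr_sqr ger0_norm// le_eqVlt; apply/orP; left; apply/eqP; field.
Qed.

End heat_content.

(** The maximum is attained because the error is continuous on a compact interval, and the bound on
    the error at each time applies at the maximiser. *)
Theorem proposition6p6 (R : realType) (n : nat) (hn : (n < 3)%N)
    (Omega : set 'rV[R]_n.+1) (hOmega : lipschitz_domain Omega)
    (tr : ('rV[R]_n.+1 -> R) -> 'rV[R]_n.+1 -> R)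
    (htr : trace_operator Omega tr)
    (sigma kappa : 'rV[R]_n.+1 -> R)
    (hcoef : admissible_coefficients Omega sigma kappa)
    (psi : 'rV[R]_n.+1 -> R) (Dpsi : 'rV[R]_n.+1 -> 'rV[R]_n.+1)
    (hpsi : phi_potential Omega sigma kappa tr psi Dpsi)
    (B : R) (hB : 0 < B)
    (u : R -> 'rV[R]_n.+1 -> R) (Du : R -> 'rV[R]_n.+1 -> 'rV[R]_n.+1)
    (hu : heat_solution Omega sigma kappa tr B u Du)
    (Tfinal : R) (hT : 0 <= Tfinal) :
  exists E : R, lumped_error Omega sigma B u Tfinal E /\
    E <= 2^-1 * Num.sqrt (phi Omega kappa Dpsi * B / surface_to_volume Omega).
Proof.
have b0 : 0 < B * surface_to_volume Omega.
  by rewrite mulr_gt0// (surface_to_volume_gt0 hOmega htr hcoef).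
set b := B * surface_to_volume Omega in b0.
pose err T := slow_average Omega sigma B u T - expR (- T).
pose tf := Tfinal / b.
have tf0 : 0 <= tf by rewrite divr_ge0// ltW.
(* The solution is continuous in time on the half-line only; the clamped error is continuous on the
   whole line and agrees with [err] on the interval. *)
pose errc T := domain_average Omega sigma u (clamp tf (T / b)) - expR (- T).
have errE T : T \in `[0, Tfinal] -> err T = errc T.
  rewrite in_itv/= => /andP[T0 TT]; rewrite /err /errc /slow_average -/b clamp_id//.
  by rewrite divr_ge0 ?(ltW b0)//= ler_pM2r ?invr_gt0.
have cerr : continuous errc.
  have cdiv : continuous (fun T : R => T / b) by move=> T; apply: cvgMl; exact: cvg_id.
  have cavg := domain_average_continuous hOmega hcoef hu tf0.
  have cexp : continuous (fun T : R => expR (- T)).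
    by move=> T; apply: (@continuous_comp _ _ _ -%R expR);
      [exact: opp_continuous|exact: continuous_expR].
  have cavgb : continuous
      ((fun t => domain_average Omega sigma u (clamp tf t)) \o (fun T : R => T / b)).
    by move=> T; apply: continuous_comp; [exact: cdiv|exact: cavg].
  by move=> T; apply: cvgB; [exact: cavgb|exact: cexp].
have [T TI Tmax] := EVT_max hT (continuous_subspaceT cerr).
exists (err T); split.
  split; first by exists T.
  by move=> S SI; rewrite [leLHS]errE// errE//; exact: Tmax.
have := average_error_le hOmega htr hcoef hpsi hB hu (t := T / b).
rewrite divr_ge0 ?(ltW b0)//; last by move: TI; rewrite in_itv/= => /andP[].
move=> /(_ isT); rewrite -/b (_ : b * (T / b) = T)//.
by rewrite mulrC divfK// gt_eqF.
Qed.
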